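(* Let $(T(t))_{t\ge0}$ be a $C_0$-semigroup on a Banach space $X$. (a) If $\mathcal{R}\{T(t):0<t<1\}<\infty$ and there is a polynomial $f\in\mathbb{C}[z]$ such that $$\lim_{\varepsilon\downarrow0}\mathcal{R}\{f(T(t)):0<t<\varepsilon\}<\|f\|_{\mathbb{D}},$$ then $(T(t))_{t\ge0}$ extends to an $\mathcal{R}$-analytic semigroup. (b) Conversely, if $(T(t))_{t\ge0}$ is $\mathcal{R}$-analytic, then for each $f\in\mathbb{C}_1[z]$ there exists $N_0\in\mathbb{N}$ such that for every $N\ge N_0$ there exists $K_0\in\mathbb{R}_+$ such that $$\lim_{\varepsilon\downarrow0}\mathcal{R}\{f^N(T(t))\,T(Kt):0<t<\varepsilon\}<\|f^N\|_{\mathbb{D}}\qquad\text{for all real }K\ge K_0.$$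
   Context: Banach spaces are complex. For $f\in\mathbb{C}[z]$, $\|f\|_{\mathbb{D}}:=\sup_{|z|\le 1}|f(z)|$. For a bounded operator $S$ and $f(z)=\sum_k a_k z^k$, $f(S)=\sum_k a_k S^k$; $f^N$ is the $N$-th power of the polynomial $f$. $\mathbb{C}_1[z]$ is the set of $f\in\mathbb{C}[z]$ with $|f(1)|<\|f\|_{\mathbb{D}}$. Fix $p\in[1,\infty)$. Let $r_k(t)=\operatorname{sign}\sin(2^k\pi t)$ be the $k$-th Rademacher function on $[0,1]$. For $\mathcal{T}\subseteq\mathcal{L}(X)$, the $\mathcal{R}$-bound $\mathcal{R}\{\mathcal{T}\}\in[0,\infty]$ is the smallest constant $C$ such that $$\Big\|\sum_{k=1}^n r_kT_kx_k\Big\|_{L^p([0,1];X)}\le C\Big\|\sum_{k=1}^n r_kx_k\Big\|_{L^p([0,1];X)}$$ for all $n\in\mathbb{N}$, $T_1,\dots,T_n\in\mathcal{T}$, $x_1,\dots,x_n\in X$ ($\infty$ if there is none). Finiteness of the $\mathcal{R}$-bound does not depend on $p$, although its value does; all $\mathcal{R}$-bounds in the statement are taken with respect to the same fixed $p$. With $\Sigma_\delta=\{z\in\mathbb{C}\setminus\{0\}:|\arg z|<\delta\}$, a semigroup $(T(t))_{t\ge0}$ is $\mathcal{R}$-analytic if it is holomorphic (extends to a holomorphic $\mathcal{L}(X)$-valued map on a sector) and there is $\delta>0$ such that the extension is defined on $\Sigma_\delta$ and $\mathcal{R}\{T(z):z\in\Sigma_\delta,|z|\le1\}<\infty$. *)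

(* Defs.v *)
From HB Require Import structures.
From mathcomp Require Import all_boot all_order all_algebra.
From mathcomp Require Import all_classical all_reals all_analysis.
From mathcomp Require Export complex.
Set Implicit Arguments.
Unset Strict Implicit.
Unset Printing Implicit Defensive.
Import Order.TTheory GRing.Theory Num.Theory.
Import numFieldNormedType.Exports.

Local Open Scope classical_set_scope.
Local Open Scope ring_scope.
Local Open Scope complex_scope.

(* The norm of a normed space over R[i] takes its values in R[i]; it is a
   nonnegative real number, and [rnorm] is that number seen in [R]. *)
Definition rnorm (R : realType) (X : normedModType R[i]) (x : X) : R :=
  complex.Re `|x|.

Definition disk_norm (R : realType) (f : {poly R[i]}) : R :=
  sup [set complex.Re `|f.[z]| | z in [set z : R[i] | `|z| <= 1]].

Definition bounded_operator (R : realType) (X : normedModType R[i])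
    (S : X -> X) : Prop :=
  linear S /\ exists M : R, forall x, rnorm (S x) <= M * rnorm x.

(* Meaningful for bounded operators, the only ones it is applied to. *)
Definition operator_norm (R : realType) (X : normedModType R[i])
    (S : X -> X) : R :=
  sup [set rnorm (S x) | x in [set x : X | rnorm x <= 1]].

Definition operator_poly (R : realType) (X : normedModType R[i])
    (f : {poly R[i]}) (S : X -> X) : X -> X :=
  fun x => \sum_(k < size f) f`_k *: iter k S x.

Definition rademacher (R : realType) (k : nat) (t : R) : R :=
  Num.sg (sin (2 ^+ k * pi * t)).

(* The norm of r_1 x_1 + ... + r_n x_n in L^p([0,1]; X); the indices in ['I_n]
   start at 0, hence the shift. *)
Definition rademacher_norm (R : realType) (X : normedModType R[i]) (p : R)
    (n : nat) (x : 'I_n -> X) : \bar R :=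
  ((\int[lebesgue_measure]_(t in `[0%R, 1%R])
      (rnorm (\sum_(k < n) (rademacher k.+1 t)%:C *: x k) `^ p)%:E)
   `^ p^-1)%E.

(* The infimum of the empty set is +oo. *)
Definition rbound (R : realType) (X : normedModType R[i]) (p : R)
    (TT : set (X -> X)) : \bar R :=
  ereal_inf [set C%:E | C in [set C : R | 0 <= C /\
    forall (n : nat) (S : 'I_n -> X -> X) (x : 'I_n -> X),
      (forall k, TT (S k)) ->
      (rademacher_norm p (fun k => S k (x k)) <=
        C%:E * rademacher_norm p x)%E]].

(* A family (T(t))_{t >= 0} is encoded by a function on [R] of which only the
   values at t >= 0 matter. *)
Definition c0_semigroup (R : realType) (X : normedModType R[i])
    (T : R -> X -> X) : Prop :=
  [/\ forall t, 0 <= t -> bounded_operator (T t),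
      T 0 = id,
      forall s t, 0 <= s -> 0 <= t -> T (s + t) = T s \o T t &
      forall x, T t x @[t --> 0^'+] --> x].

Definition is_arg (R : realType) (z : R[i]) (theta : R) : Prop :=
  - pi < theta <= pi /\ z = `|z| * (cos theta +i* sin theta).

Definition sector (R : realType) (delta : R) : set R[i] :=
  [set z | z != 0 /\ exists2 theta, is_arg z theta & `|theta| < delta].

Definition holomorphic_operators (R : realType) (X : normedModType R[i])
    (D : set R[i]) (S : R[i] -> X -> X) : Prop :=
  forall z, D z -> bounded_operator (S z) /\
    exists2 S' : X -> X, bounded_operator S' &
      operator_norm (fun x => (w - z)^-1 *: (S w x - S z x) - S' x)
        @[w --> (z : R[i]^o)^'] --> (0 : R).

Definition R_analytic (R : realType) (X : normedModType R[i]) (p : R)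
    (T : R -> X -> X) : Prop :=
  exists theta : R, exists S : R[i] -> X -> X,
    [/\ 0 < theta,
        holomorphic_operators (sector theta) S,
        forall t : R, 0 < t -> S t%:C = T t &
        exists2 delta : R, 0 < delta <= theta &
          (rbound p [set S z | z in sector delta `&` [set z | (`|z| <= 1)%R]]
            < +oo)%E].

(* Main.v *)
Require Import Defs.
From mathcomp Require Import all_boot all_order all_algebra.
From mathcomp Require Import all_classical all_reals all_analysis measurable_realfun.
From mathcomp Require Import ring lra zify.
Set Implicit Arguments.
Unset Strict Implicit.
Unset Printing Implicit Defensive.
Import Order.TTheory GRing.Theory Num.Theory.
Import numFieldNormedType.Exports.

Local Open Scope classical_set_scope.
Local Open Scope ring_scope.

(* (a) If [f(T(t))] has an R-bound below [|f(zeta)|] for small [t], with [|zeta| = 1], then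
   [f(zeta) - f(T(t))], hence [zeta - T(t)], is bounded below for the Rademacher norms,
   uniformly in small [t]. Raising [e^(ib) T(h)] to the power that brings it near [zeta]
   shows that [1 - e^(ib) T(h)] is bounded below by a multiple of [|b|] when [b] is small and
   [h/|b|] is small. Geometric sums of [e^(ib) T(h)] at the frequencies [b] of a discrete
   Fourier transform are therefore R-bounded with the right decay in [b], and combining
   them with the coefficients of a Fejer kernel gives an R-bound, of order [h/t], for
   averages of [T(jh) - T((j+1)h)] that concentrate at [jh = t]. Summing such averages and
   letting [h] tend to [0] R-bounds [(t/s) (T(t) - T(t+s))] for [0 < s <= t] small. So
   [T] is differentiable, [t T'(t)] is R-bounded, and the Taylor series of [T(x + iy)] in
   [iy] converges and is R-bounded on a sector.

   (b) Cauchy's estimate in [X^n] with the Rademacher norm R-bounds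
   [(t/s) (T(t+s) - T(t))], so that for large [K] the R-bound of [f^N(T(t)) T(Kt)] is close
   to that of [f(1)^N T(Kt)], and [|f(1)|^N] is much smaller than the [N]-th power of the
   norm of [f]. *)

(** The hypothesis on [f] gives a lower bound near one point of the circle and nothing at frequency
    0, so [1 - e^(ib) T(h)] is only bounded below by a multiple of [|b|]. No inverse is formed: the
    lower bounds are applied to geometric sums, on which [1 - e^(ib) T(h)] telescopes. The third
    power of the geometric sums is forced by summability. With [1 - T(h)] in front, one sum has no
    decay in [b], two decay like [1/|b|], which is not summable uniformly in the number of
    frequencies, and three decay like [1/b^2]. Frequency 0 is treated apart, by telescoping. The
    Fejer kernel is nonnegative, so its mass can be bounded below by summing over a window. Its
    order [q] is fixed by the accuracy wanted, and only then is the mesh refined, which pushes all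
    frequencies below the threshold [beta] where the lower bound holds. The R-bounds obtained are
    free of [q] and of the mesh. No vector-valued integral occurs: Rademacher norms are means over
    signs, Cauchy's estimate uses trapezoidal sums, and the mean value inequality is proved by
    bisection. *)

Definition cabs (R : realType) (c : R[i]) : R := complex.Re `|c|.

(** * Moduli and norms as real numbers *)

Section modulus.
Variable R : realType.
Implicit Types (a b : R) (c d z w : R[i]).

Lemma normc_cabs c : `|c| = (cabs c)%:C%C.
Proof. by rewrite /cabs normc_def. Qed.

Lemma cabs_ge0 c : 0 <= cabs c.
Proof. by rewrite -lecR -normc_cabs normr_ge0. Qed.

Lemma cabsM c d : cabs (c * d) = cabs c * cabs d.
Proof. by apply: complexI; rewrite rmorphM /= -!normc_cabs normrM. Qed.

Lemma cabsD c d : cabs (c + d) <= cabs c + cabs d.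
Proof. by rewrite -lecR rmorphD /= -!normc_cabs ler_normD. Qed.

Lemma cabsN c : cabs (- c) = cabs c.
Proof. by rewrite /cabs normrN. Qed.

Lemma cabs_distC c d : cabs (c - d) = cabs (d - c).
Proof. by rewrite -cabsN opprB. Qed.

Lemma cabs0 : cabs (0 : R[i]) = 0.
Proof. by rewrite /cabs normr0. Qed.

Lemma cabs1 : cabs (1 : R[i]) = 1.
Proof. by rewrite /cabs normr1. Qed.

Lemma cabs_eq0 c : (cabs c == 0) = (c == 0).
Proof. by rewrite -(inj_eq (@complexI R)) /= -normc_cabs normr_eq0. Qed.

Lemma cabs_gt0 c : (0 < cabs c) = (c != 0).
Proof. by rewrite lt_neqAle cabs_ge0 andbT eq_sym cabs_eq0. Qed.

Lemma cabsX c n : cabs (c ^+ n) = cabs c ^+ n.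
Proof. by elim: n => [|n IH]; rewrite ?expr0 ?cabs1// !exprS cabsM IH. Qed.

Lemma cabsV c : cabs c^-1 = (cabs c)^-1.
Proof. by apply: complexI; rewrite fmorphV /= -!normc_cabs normfV. Qed.

Lemma cabs_real a : cabs a%:C%C = `|a|.
Proof. by rewrite /cabs normc_def /= expr0n addr0 sqrtr_sqr. Qed.

Lemma cabsE a b : cabs (a +i* b)%C = Num.sqrt (a ^+ 2 + b ^+ 2).
Proof. by rewrite /cabs normc_def. Qed.

Lemma cabs_sqr a b : cabs (a +i* b)%C ^+ 2 = a ^+ 2 + b ^+ 2.
Proof. by rewrite cabsE sqr_sqrtr // addr_ge0 // sqr_ge0. Qed.

Lemma cabs_i : cabs 'i%C = 1 :> R.
Proof. by rewrite cabsE expr0n add0r expr1n sqrtr1. Qed.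

Lemma cabs_nat n : cabs (n%:R : R[i]) = n%:R.
Proof. by rewrite -(rmorph_nat (real_complex R)) /= cabs_real ger0_norm. Qed.

Lemma Re_le_cabs c : `|complex.Re c| <= cabs c.
Proof. by rewrite -lecR -normc_cabs normc_ge_Re. Qed.

Lemma Im_le_cabs c : `|complex.Im c| <= cabs c.
Proof.
case: c => a b; rewrite cabsE /= -(sqrtr_sqr b) ler_sqrt ?lerDr ?sqr_ge0//.
by rewrite addr_ge0 ?sqr_ge0.
Qed.

Lemma cabs_sum (I : Type) (s : seq I) (P : pred I) (F : I -> R[i]) :
  cabs (\sum_(i <- s | P i) F i) <= \sum_(i <- s | P i) cabs (F i).
Proof.
apply: (big_ind2 (fun (x : R[i]) y => cabs x <= y)) => // [|x a y b xa yb]; first by rewrite cabs0.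
by apply: le_trans (cabsD _ _) _; exact: lerD.
Qed.

End modulus.

Section rnorm.
Variables (R : realType) (X : normedModType R[i]).
Implicit Types x y : X.

Lemma norm_rnorm x : `|x| = (rnorm x)%:C%C.
Proof.
by rewrite /rnorm RRe_real// ger0_real. Qed.

Lemma rnorm_ge0 x : 0 <= rnorm x.
Proof. by rewrite -lecR -norm_rnorm normr_ge0. Qed.

Lemma rnormD x y : rnorm (x + y) <= rnorm x + rnorm y.
Proof. by rewrite -lecR rmorphD /= -!norm_rnorm ler_normD. Qed.

Lemma rnormN x : rnorm (- x) = rnorm x.
Proof. by rewrite /rnorm normrN. Qed.

Lemma rnormB x y : rnorm (x - y) <= rnorm x + rnorm y.
Proof. by rewrite -(rnormN y) rnormD. Qed.

Lemma rnorm_distC x y : rnorm (x - y) = rnorm (y - x).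
Proof. by rewrite -rnormN opprB. Qed.

Lemma rnormZ (c : R[i]) x : rnorm (c *: x) = cabs c * rnorm x.
Proof. by apply: complexI; rewrite rmorphM /= -norm_rnorm normrZ normc_cabs norm_rnorm. Qed.

Lemma rnorm0 : rnorm (0 : X) = 0.
Proof. by rewrite /rnorm normr0. Qed.

Lemma rnorm_eq0 x : (rnorm x == 0) = (x == 0).
Proof. by rewrite -(inj_eq (@complexI R)) /= -norm_rnorm normr_eq0. Qed.

Lemma rnorm_sum (I : Type) (s : seq I) (P : pred I) (F : I -> X) :
  rnorm (\sum_(i <- s | P i) F i) <= \sum_(i <- s | P i) rnorm (F i).
Proof.
elim: s => [|i s IH]; first by rewrite !big_nil rnorm0.
rewrite !big_cons; case: ifP => // _.
by apply: le_trans (rnormD _ _) _; rewrite lerD2l.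
Qed.

Lemma rnorm_eq_of_close x y :
  (forall e : R, 0 < e -> rnorm (x - y) <= e) -> x = y.
Proof.
move=> h; apply/eqP; rewrite -subr_eq0 -rnorm_eq0 eq_le rnorm_ge0 andbT.
by apply/ler_addgt0Pr => e /h; rewrite add0r.
Qed.

End rnorm.

(** * Rademacher averages as finite averages over signs *)

(* Each successive coordinate of the argument of [G] is [1] or [-1] with
   probability one half. *)
Fixpoint sign_mean (R : realType) (n : nat) (G : seq R -> R) : R :=
  if n is n'.+1 then
    (sign_mean n' (fun s => G (1 :: s)) + sign_mean n' (fun s => G (-1 :: s))) / 2
  else G [::].

Section sign_mean.
Variable R : realType.
Implicit Types (G H : seq R -> R) (n : nat).

Lemma sign_meanD n G H :
  sign_mean n (fun s => G s + H s) = sign_mean n G + sign_mean n H.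
Proof. by elim: n G H => [|n IH] G H //=; rewrite !IH; field. Qed.

Lemma sign_meanZ n (a : R) G :
  sign_mean n (fun s => a * G s) = a * sign_mean n G.
Proof. by elim: n G => [|n IH] G //=; rewrite !IH; field. Qed.

Definition sign_seq n (s : seq R) :=
  size s = n /\ forall k, (k < n)%N -> `|nth 0 s k| = 1.

Lemma sign_seq_cons n s (b : R) : `|b| = 1 -> sign_seq n s -> sign_seq n.+1 (b :: s).
Proof.
move=> b1 [hs h]; split; first by rewrite /= hs.
by case=> //= k; rewrite ltnS => /h.
Qed.

Lemma sign_mean_le n G H : (forall s, sign_seq n s -> G s <= H s) ->
  sign_mean n G <= sign_mean n H.
Proof.
elim: n G H => [|n IH] G H h /=; first by apply: h; split.
rewrite ler_pM2r ?invr_gt0// lerD// IH// => s hs; apply: h.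
  by apply: sign_seq_cons; rewrite ?normr1.
by apply: sign_seq_cons; rewrite ?normrN ?normr1.
Qed.

Lemma eq_sign_mean n G H : (forall s, sign_seq n s -> G s = H s) ->
  sign_mean n G = sign_mean n H.
Proof.
by move=> h; apply/le_anti/andP; split; apply: sign_mean_le => s /h ->.
Qed.

Lemma sign_mean_cst n (a : R) : sign_mean n (fun=> a) = a.
Proof. by elim: n => [|n IH] //=; rewrite !IH; field. Qed.

Lemma sign_mean_ge0 n G : (forall s, sign_seq n s -> 0 <= G s) -> 0 <= sign_mean n G.
Proof. by move=> h; rewrite -(sign_mean_cst n 0); apply: sign_mean_le. Qed.

Lemma sign_mean_flip n G k : (k < n)%N ->
  sign_mean n (fun s => G (set_nth 0 s k (- nth 0 s k))) = sign_mean n G.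
Proof.
elim: n G k => [|n IH] G [|k] //= kn; first by rewrite opprK addrC.
by rewrite (IH (fun s => G (1 :: s)))// (IH (fun s => G (-1 :: s))).
Qed.

Lemma sin2piDn (j : nat) (x : R) : sin (2 * pi * j%:R + x) = sin x.
Proof.
rewrite addrC (_ : 2 * pi * j%:R = (pi *+ 2) *+ j) ?(periodicn (@sinD2pi R))//.
by rewrite -mulr_natr -(mulr_natr pi); ring.
Qed.

(** At a multiple of [2^-m] the argument [2^(m+1) pi t] of the sine is a multiple of [2 pi], so the
    sine is positive on the first half of the dyadic interval and negative on the second. It
    vanishes at the endpoints and at the midpoint, hence the strict inequalities. *)
Lemma rademacher_dyadic (m j : nat) (a t : R) : a * 2 ^+ m = j%:R ->
  (a < t < a + 2 ^- m.+1 -> rademacher m.+1 t = 1) /\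
  (a + 2 ^- m.+1 < t < a + 2 ^- m -> rademacher m.+1 t = -1).
Proof.
move=> aj; have p0 := @pi_gt0 R.
have q0 : 0 < 2 ^+ m :> R by rewrite exprn_gt0.
have e1 : 2 ^- m.+1 = (2 ^+ m)^-1 / 2 :> R.
  by rewrite exprS invfM mulrC.
have eqt u : 2 ^+ m.+1 * pi * (a + u) = 2 * pi * j%:R + 2 ^+ m.+1 * pi * u.
  by rewrite -aj exprS; ring.
have es : 2 ^+ m * (2 ^+ m)^-1 = 1 :> R by rewrite divff ?gt_eqF.
have q1 : 0 < 2 ^+ m.+1 * pi :> R by rewrite mulr_gt0 ?exprn_gt0.
have q2 : 2 ^+ m.+1 * pi * ((2 ^+ m)^-1 / 2) = pi :> R.
  by rewrite exprS; field; rewrite gt_eqF.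
split=> /andP[h1 h2]; rewrite /rademacher.
- rewrite -(subrKC a t) eqt sin2piDn gtr0_sg// sin_gt0_pi//; apply/andP; split.
    by rewrite !mulr_gt0 ?exprn_gt0// subr_gt0.
  have : t - a < (2 ^+ m)^-1 / 2 by rewrite -e1; lra.
  by rewrite -(ltr_pM2l q1) q2.
- rewrite -(subrKC a t) eqt sin2piDn.
  rewrite (_ : 2 ^+ m.+1 * pi * (t - a) =
     2 ^+ m.+1 * pi * (t - a - 2 ^- m.+1) + pi); last first.
    by field; rewrite gt_eqF ?exprn_gt0.
  rewrite sinDpi ltr0_sg// oppr_lt0 sin_gt0_pi//; apply/andP; split.
    by rewrite !mulr_gt0 ?exprn_gt0//; lra.
  have : t - a - 2 ^- m.+1 < (2 ^+ m)^-1 / 2 by rewrite e1; lra.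
  by rewrite -(ltr_pM2l q1) q2.
Qed.

(** The first of the functions is constant on each half of the dyadic interval, and the others are
    treated on the halves by induction, which is the recursion of [sign_mean]. Measurability is
    proved along the way because splitting the integral requires it. *)
Lemma integral_rademacher n (m j : nat) (a : R) G : a * 2 ^+ m = j%:R ->
  (forall s, 0 <= G s) ->
  measurable_fun `]a, (a + 2 ^- m)[
    (EFin \o (fun t : R => G [seq rademacher k.+1 t | k <- iota m n])) /\
  (\int[lebesgue_measure]_(t in `]a, (a + 2 ^- m)%R[)
    (G [seq rademacher k.+1 t | k <- iota m n])%:E =
    (2 ^- m * sign_mean n G)%:E)%E.
Proof.
elim: n m j a G => [|n IH] m j a G aj G0 /=.
  split; first exact: measurable_cst.
  rewrite integral_cst//=.
  rewrite lebesgue_measure_itv/= lte_fin ltrDl invr_gt0 exprn_gt0//.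
  by rewrite -EFinD -EFinM mulrC addrC addKr.
have q0 : 0 < (2 ^+ m)^-1 :> R by rewrite invr_gt0 exprn_gt0.
have e1 : 2 ^- m.+1 = (2 ^+ m)^-1 / 2 :> R by rewrite exprS invfM mulrC.
set b := a + 2 ^- m.+1.
have be : b + 2 ^- m.+1 = a + 2 ^- m by rewrite /b e1; field; rewrite gt_eqF ?exprn_gt0.
have jD : (j.*2)%:R = 2 * j%:R :> R by rewrite -mul2n natrM.
have aL : a * 2 ^+ m.+1 = (j.*2)%:R by rewrite jD exprS mulrCA aj.
have aR : b * 2 ^+ m.+1 = (j.*2.+1)%:R.
  by rewrite /b mulrDl mulVf ?gt_eqF ?exprn_gt0// aL -natr1.
have [mL iL] := IH m.+1 _ a (fun s => G (1 :: s)) aL (fun s => G0 _).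
have [mR iR] := IH m.+1 _ b (fun s => G (-1 :: s)) aR (fun s => G0 _).
rewrite be in mR iR.
pose f t := (G (1 :: [seq rademacher k.+1 t | k <- iota m.+1 n]))%:E.
pose g t := (G (-1 :: [seq rademacher k.+1 t | k <- iota m.+1 n]))%:E.
pose F t := (G (rademacher m.+1 t :: [seq rademacher k.+1 t | k <- iota m.+1 n]))%:E.
rewrite -/F.
have FL t : t \in `]a, b[ -> F t = f t.
  rewrite in_itv/= => tab; rewrite /F /f.
  by rewrite ((rademacher_dyadic t aj).1 tab).
have FR t : t \in `]b, (a + 2 ^- m)[ -> F t = g t.
  rewrite in_itv/= => tab; rewrite /F /g.
  by rewrite ((rademacher_dyadic t aj).2 tab).
(* The midpoint, where the Rademacher function is 0, is split off as a null set. *)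
have split3 : `]a, (a + 2 ^- m)[%classic = `]a, b[ `|` (b |` `]b, (a + 2 ^- m)[).
  apply/seteqP; split => t /=; rewrite !in_itv/=.
    move=> /andP[h1 h2]; case: (ltgtP t b) => h; last by right; left.
      by left; rewrite h1.
    by right; right; rewrite h2.
  have hb : a < b < a + 2 ^- m by rewrite /b e1; lra.
  by case=> [/andP[h1 h2]|[->//|/andP[h1 h2]]]; lra.
have mL' : measurable_fun `]a, b[ F.
  apply: eq_measurable_fun mL => u; rewrite inE/= => hu; by rewrite (FL _ hu).
have mR' : measurable_fun `]b, (a + 2 ^- m)[ F.
  apply: eq_measurable_fun mR => u; rewrite inE/= => hu; by rewrite (FR _ hu).
have mF2 : measurable_fun (b |` `]b, (a + 2 ^- m)[) F.
  by apply/measurable_funU => //; split => //; exact: measurable_fun_set1.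
have mF : measurable_fun `]a, (a + 2 ^- m)[ F.
  by rewrite split3; apply/measurable_funU => //; exact: measurableU.
split=> //; rewrite split3 ge0_integral_setU//=; first last.
- apply/disj_setPS => t [/=]; rewrite in_itv/= => /andP[h1 h2] [tb|].
    by rewrite tb ltxx in h2.
  by rewrite in_itv/= => /andP[h3 _]; have := lt_trans h2 h3; rewrite ltxx.
- by move=> t _; rewrite lee_fin.
- by rewrite -split3.
- exact: measurableU.
rewrite ge0_integral_setU//=; first last.
- by apply/disj_setPS => t [/= ->]; rewrite in_itv/= ltxx.
- by move=> t _; rewrite lee_fin.
rewrite integral_set1 add0e.
transitivity ((2 ^- m.+1 * sign_mean n (fun s => G (1 :: s)))%:E +
              (2 ^- m.+1 * sign_mean n (fun s => G (-1 :: s)))%:E)%E.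
  congr (_ + _)%E.
    by rewrite -iL; apply: eq_integral => t; rewrite inE => /FL.
  by rewrite -iR; apply: eq_integral => t; rewrite inE => /FR.
by rewrite -EFinD; congr EFin; rewrite e1; field; rewrite gt_eqF ?exprn_gt0.
Qed.

End sign_mean.

(** Normalization for Minkowski's inequality: dividing by a number strictly above the norm avoids
    the case of a zero norm. *)
Lemma sign_mean_powR_le1 (R : realType) (p : R) n (G : seq R -> R) (g' : R) :
  0 < p -> (forall s, 0 <= G s) -> 0 < g' ->
  sign_mean n (fun s => G s `^ p) `^ p^-1 < g' ->
  sign_mean n (fun s => (G s / g') `^ p) <= 1.
Proof.
move=> p0 G0 g'0 gg'.
have -> : sign_mean n (fun s => (G s / g') `^ p) =
    g'^-1 `^ p * sign_mean n (fun s => G s `^ p).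
  rewrite -sign_meanZ; apply: eq_sign_mean => s _.
  by rewrite powRM ?G0 ?invr_ge0 ?(ltW g'0)// mulrC.
have : 0 <= sign_mean n (fun s => G s `^ p).
  by apply: sign_mean_ge0 => s _; exact: powR_ge0.
move: (sign_mean n _) gg' => M gg' M0.
rewrite -powR_inv1 ?(ltW g'0)// -powRrM mulN1r powRN mulrC.
rewrite ler_pdivrMr ?powR_gt0// mul1r.
rewrite -[leLHS](powRr1 M0) -(mulVf (_ : p != 0)) ?gt_eqF// powRrM.
by apply: ge0_ler_powR; rewrite ?nnegrE ?powR_ge0// ltW.
Qed.

(** Convexity of [x^p]: [(F + H) / (a + b)] is the convex combination of [F / a] and [H / b] with
    weights [a / (a + b)] and [b / (a + b)]. *)
Lemma sign_mean_powR_add (R : realType) (p : R) n (F H : seq R -> R) (a b : R) :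
  1 <= p -> (forall s, 0 <= F s) -> (forall s, 0 <= H s) -> 0 < a -> 0 < b ->
  sign_mean n (fun s => (F s / a) `^ p) <= 1 ->
  sign_mean n (fun s => (H s / b) `^ p) <= 1 ->
  sign_mean n (fun s => (F s + H s) `^ p) `^ p^-1 <= a + b.
Proof.
move=> p1 F0 H0 a0 b0 hF hH; have p0 : 0 < p by rewrite (lt_le_trans _ p1).
have c0 : 0 < a + b by rewrite addr_gt0.
pose t := a / (a + b).
have t0 : 0 <= t by rewrite divr_ge0 ?ltW.
have t1 : t <= 1 by rewrite ler_pdivrMr// mul1r lerDl ltW.
have sumt : 1 = t * 1 + (1 - t) * 1 by rewrite -mulrDl subrKC mul1r.
have key : sign_mean n (fun s => ((F s + H s) / (a + b)) `^ p) <= 1.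
  apply: (@le_trans _ _ (t * sign_mean n (fun s => (F s / a) `^ p) +
                         (1 - t) * sign_mean n (fun s => (H s / b) `^ p))).
    rewrite -!sign_meanZ -sign_meanD; apply: sign_mean_le => s _.
    have mem0 (z : R) : 0 <= z -> z \in `[0, +oo[%classic.
      by move=> z0; rewrite inE/= in_itv/= andbT.
    have hx : 0 <= F s / a by rewrite divr_ge0 ?F0 ?(ltW a0).
    have hy : 0 <= H s / b by rewrite divr_ge0 ?H0 ?(ltW b0).
    have := @convex_powR R p p1 (Itv01 t0 t1) _ _ (mem0 _ hx) (mem0 _ hy).
    rewrite convRE/= [X in X `^ _ <= _]convRE/= /unstable.onem => /(le_trans _); apply.
    suff -> : t * (F s / a) + (1 - t) * (H s / b) = (F s + H s) / (a + b) by [].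
    rewrite /t; move: (F s) (H s) => u v.
    by field; rewrite !gt_eqF.
  rewrite [leRHS]sumt; apply: lerD; apply: ler_wpM2l => //.
  by rewrite subr_ge0.
rewrite -[leRHS](@powRr1 _ (a + b)) ?(ltW c0)// -(divff (_ : p != 0)) ?gt_eqF//.
rewrite powRrM; apply: ge0_ler_powR => //; rewrite ?nnegrE ?powR_ge0//.
- by rewrite invr_ge0 ltW.
- by apply: sign_mean_ge0 => s _; exact: powR_ge0.
have cp0 : 0 < (a + b) `^ p by rewrite powR_gt0.
rewrite -[leRHS]mul1r -ler_pdivrMr// mulrC -sign_meanZ; apply: le_trans key.
apply: sign_mean_le => s _; rewrite powRM ?addr_ge0 ?invr_ge0 ?(ltW c0)// mulrC.
by rewrite -[(a + b)^-1]powR_inv1 ?(ltW c0)// -powRrM mulN1r powRN.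
Qed.

Lemma sign_mean_minkowski (R : realType) (p : R) n (F H : seq R -> R) : 1 <= p ->
  (forall s, 0 <= F s) -> (forall s, 0 <= H s) ->
  sign_mean n (fun s => (F s + H s) `^ p) `^ p^-1 <=
  sign_mean n (fun s => F s `^ p) `^ p^-1 + sign_mean n (fun s => H s `^ p) `^ p^-1.
Proof.
move=> p1 F0 H0; have p0 : 0 < p by rewrite (lt_le_trans _ p1).
apply/ler_addgt0Pr => e e0; rewrite [e]splitr addrACA.
have h (G : seq R -> R) :
    0 < sign_mean n (fun s => G s `^ p) `^ p^-1 + e / 2 /\
    sign_mean n (fun s => G s `^ p) `^ p^-1 < sign_mean n (fun s => G s `^ p) `^ p^-1 + e / 2.
  by rewrite ltrDl divr_gt0// ltr_wpDl ?powR_ge0 ?divr_gt0.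
have [h1 h2] := h F; have [h3 h4] := h H.
exact: (sign_mean_powR_add p1 F0 H0 h1 h3 (sign_mean_powR_le1 p0 F0 h1 h2)
  (sign_mean_powR_le1 p0 H0 h3 h4)).
Qed.

Definition rad_norm (R : realType) (X : normedModType R[i]) (p : R)
    (n : nat) (x : 'I_n -> X) : R :=
  sign_mean n (fun s => rnorm (\sum_(k < n) ((nth 0 s k)%:C)%C *: x k) `^ p) `^ p^-1.

Section rad_norm.
Variables (R : realType) (X : normedModType R[i]) (p : R).
Hypothesis p1 : 1 <= p.

Let p0 : 0 < p. Proof. by rewrite (lt_le_trans _ p1). Qed.

(** The integrand depends on [t] only through the first [n] Rademacher functions, so its integral is
    a mean over [2^n] signs. Through this identity all later estimates concern finite means. *)
Lemma rademacher_normE n (x : 'I_n -> X) : rademacher_norm p x = (rad_norm p x)%:E.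
Proof.
rewrite /rademacher_norm /rad_norm.
set G := fun s : seq R => rnorm _ `^ p.
have [mG iG] := @integral_rademacher R n 0 0 0 G
  ltac:(by rewrite mul0r) (fun s => powR_ge0 _ _).
have GE t : (G [seq rademacher k.+1 t | k <- iota 0 n])%:E =
    (rnorm (\sum_(k < n) (rademacher k.+1 t)%:C%C *: x k) `^ p)%:E.
  congr (_ `^ _)%:E; congr rnorm; apply: eq_bigr => k _.
  by rewrite (nth_map 0%N) ?size_iota// nth_iota.
rewrite expr0 invr1 mul1r add0r in iG mG.
suff -> : (\int[lebesgue_measure]_(t in `[0%R, 1%R])
    (rnorm (\sum_(k < n) (rademacher k.+1 t)%:C%C *: x k) `^ p)%:E)%E =
    (sign_mean n G)%:E by rewrite poweR_EFin.
have -> : (fun t => (rnorm (\sum_(k < n) (rademacher k.+1 t)%:C%C *: x k) `^ p)%:E) =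
   (EFin \o (fun t : R => G [seq rademacher k.+1 t | k <- iota 0 n])).
  by apply/funext => t; rewrite -GE.
exact: etrans (integral_itv_bndoo _ _ _) iG.
Qed.

Lemma rad_norm_ge0 n (x : 'I_n -> X) : 0 <= rad_norm p x.
Proof. exact: powR_ge0. Qed.

Lemma rad_normD n (x y : 'I_n -> X) :
  rad_norm p (fun k => x k + y k) <= rad_norm p x + rad_norm p y.
Proof.
apply: le_trans (sign_mean_minkowski n p1 (fun s => rnorm_ge0 _) (fun s => rnorm_ge0 _)).
apply: ge0_ler_powR; rewrite ?invr_ge0 ?nnegrE ?(ltW p0)//.
- by apply: sign_mean_ge0 => s _; exact: powR_ge0.
- by apply: sign_mean_ge0 => s _; exact: powR_ge0.
apply: sign_mean_le => s _; apply: ge0_ler_powR; rewrite ?nnegrE ?(ltW p0)//.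
- exact: rnorm_ge0.
- by rewrite addr_ge0// rnorm_ge0.
by rewrite (eq_bigr _ (fun k _ => scalerDr _ _ _)) big_split/= rnormD.
Qed.

Lemma rad_normZ n (c : R[i]) (x : 'I_n -> X) :
  rad_norm p (fun k => c *: x k) = cabs c * rad_norm p x.
Proof.
rewrite /rad_norm.
rewrite (eq_sign_mean (H := fun s => cabs c `^ p *
   rnorm (\sum_(k < n) (nth 0 s k)%:C%C *: x k) `^ p)); last first.
  move=> s _; rewrite -powRM ?cabs_ge0 ?rnorm_ge0//; congr (_ `^ _).
  rewrite -rnormZ scaler_sumr; congr rnorm; apply: eq_bigr => k _.
  by rewrite !scalerA mulrC.
rewrite sign_meanZ powRM ?powR_ge0//; last first.
  by apply: sign_mean_ge0 => s _; exact: powR_ge0.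
by rewrite -powRrM divff ?gt_eqF// powRr1// cabs_ge0.
Qed.

Lemma rad_normN n (x : 'I_n -> X) : rad_norm p (fun k => - x k) = rad_norm p x.
Proof.
rewrite -[RHS]mul1r -(cabs1 R) -cabsN -rad_normZ; congr rad_norm.
by apply/funext => k; rewrite scaleN1r.
Qed.

Lemma rad_normB n (x y : 'I_n -> X) :
  rad_norm p (fun k => x k - y k) <= rad_norm p x + rad_norm p y.
Proof. by rewrite -(rad_normN y) rad_normD. Qed.

Lemma rad_norm0 n : rad_norm p (fun _ : 'I_n => 0 : X) = 0.
Proof.
rewrite -[RHS](mul0r (rad_norm p (fun _ : 'I_n => 0 : X))) -(cabs0 R) -rad_normZ.
by congr rad_norm; apply/funext => k; rewrite scale0r.
Qed.

Lemma rad_norm_sum n (I : Type) (s : seq I) (P : pred I) (y : I -> 'I_n -> X) :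
  rad_norm p (fun k => \sum_(i <- s | P i) y i k) <= \sum_(i <- s | P i) rad_norm p (y i).
Proof.
elim: s => [|i s IH].
  rewrite big_nil (_ : (fun _ => _) = (fun=> 0)) ?rad_norm0//.
  by apply/funext => k; rewrite big_nil.
rewrite big_cons (_ : (fun _ => _) = (fun k => if P i
    then y i k + \sum_(i <- s | P i) y i k else \sum_(i <- s | P i) y i k)); last first.
  by apply/funext => k; rewrite big_cons.
by case: ifP => // _; apply: le_trans (rad_normD _ _) _; rewrite lerD2l.
Qed.

(** A crude bound that grows with the number of vectors; it serves for errors that can be made small
    once the tuple is fixed. *)
Lemma rad_norm_le_sum n (x : 'I_n -> X) : rad_norm p x <= \sum_(k < n) rnorm (x k).
Proof.
have A0 : 0 <= \sum_(k < n) rnorm (x k) by apply: sumr_ge0 => k _; exact: rnorm_ge0.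
rewrite -[leRHS]powRr1// -(divff (_ : p != 0)) ?gt_eqF// powRrM.
apply: ge0_ler_powR; rewrite ?invr_ge0 ?nnegrE ?powR_ge0 ?(ltW p0)//.
  by apply: sign_mean_ge0 => s _; exact: powR_ge0.
rewrite -(sign_mean_cst n (_ `^ p)); apply: sign_mean_le => s [_ hs].
apply: ge0_ler_powR; rewrite ?nnegrE ?rnorm_ge0 ?(ltW p0)//.
apply: le_trans (rnorm_sum _ _ _) _; apply: ler_sum => k _.
by rewrite rnormZ cabs_real hs// mul1r.
Qed.

Lemma rad_norm1 (x : 'I_1 -> X) : rad_norm p x = rnorm (x ord0).
Proof.
rewrite /rad_norm /= !big_ord1 /= !rnormZ !cabs_real normrN normr1 !mul1r.
have -> : (rnorm (x ord0) `^ p + rnorm (x ord0) `^ p) / 2 = rnorm (x ord0) `^ p by field.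
by rewrite -powRrM divff ?gt_eqF// powRr1// rnorm_ge0.
Qed.

Lemma rad_norm_flip n (x : 'I_n -> X) (j : 'I_n) :
  rad_norm p (fun k => if k == j then - x k else x k) = rad_norm p x.
Proof.
rewrite /rad_norm; congr (_ `^ _).
rewrite -[RHS](sign_mean_flip _ (ltn_ord j)); apply: eq_sign_mean => s _.
congr (_ `^ _); congr rnorm; apply: eq_bigr => k _; rewrite nth_set_nth/=.
have [->|kj] := eqVneq k j; first by rewrite eqxx rmorphN/= scaleNr scalerN.
by rewrite (_ : (k == j :> nat) = false)//; apply/negbTE; exact: kj.
Qed.

(* The set of coordinates already treated grows one at a time: the norm is
   convex in each coordinate. *)
Lemma rad_norm_convex n (V : 'I_n -> set X) (B : R) :
  (forall y, (forall k, V k (y k)) -> rad_norm p y <= B) ->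
  forall y, (forall k, exists (m : nat) (l : 'I_m -> R) (v : 'I_m -> X),
     [/\ forall i, 0 <= l i, \sum_i l i = 1, forall i, V k (v i) &
         y k = \sum_i (l i)%:C%C *: v i]) ->
  rad_norm p y <= B.
Proof.
move=> hB.
suff H j : (j <= n)%N -> forall y : 'I_n -> X,
    (forall k : 'I_n, (k < j)%N -> exists (m : nat) (l : 'I_m -> R) (v : 'I_m -> X),
     [/\ forall i, 0 <= l i, \sum_i l i = 1, forall i, V k (v i) &
         y k = \sum_i (l i)%:C%C *: v i]) ->
    (forall k : 'I_n, (j <= k)%N -> V k (y k)) -> rad_norm p y <= B.
  by move=> y hy; apply: (H n) => // k; rewrite leqNgt ltn_ord.
elim: j => [|j IH] jn y hlt hge; first by apply: hB => k; exact: hge.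
have [m [l [v [l0 l1 hv yE]]]] := hlt (Ordinal jn) (leqnn _).
pose z i k := if k == Ordinal jn then v i else y k.
have -> : y = (fun k => \sum_i (l i)%:C%C *: z i k).
  apply/funext => k; rewrite /z; case: eqVneq => [->//|_].
  by rewrite -scaler_suml -(rmorph_sum (real_complex R)) l1 /= scale1r.
apply: le_trans (rad_norm_sum _ _ _) _.
rewrite -[B]mul1r -l1 mulr_suml; apply: ler_sum => i _.
rewrite rad_normZ cabs_real ger0_norm//; apply: ler_wpM2l => //.
apply: IH; first exact: ltnW.
  move=> k kj; have [m' [l' [v' [h1 h2 h3 h4]]]] := hlt k (ltnW kj).
  exists m', l', v'; split=> //.
  by rewrite /z ifF// -val_eqE/= ltn_eqF.
move=> k kj; rewrite /z; case: eqVneq => [->//|kj'].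
by apply: hge; rewrite ltn_neqAle eq_sym kj andbT; exact: kj'.
Qed.

(** Kahane's contraction principle for real scalars: [[-1, 1]] is the convex hull of the two signs,
    and changes of sign leave the norm unchanged. *)
Lemma rad_norm_contraction n (x : 'I_n -> X) (a : 'I_n -> R) :
  (forall k, `|a k| <= 1) -> rad_norm p (fun k => (a k)%:C%C *: x k) <= rad_norm p x.
Proof.
move=> ha; apply: (@rad_norm_convex n (fun k => [set x k; - x k])); last first.
  move=> k; exists 2%N, (fun i => if i == ord0 then (1 + a k) / 2 else (1 - a k) / 2).
  exists (fun i => if i == ord0 then x k else - x k).
  have := ha k; rewrite ler_norml => /andP[a1 a2]; split.
  - by move=> i; case: ifP => _; lra.
  - by rewrite !big_ord_recl big_ord0/=; lra.
  - by move=> i; case: ifP => _; [left|right].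
  - rewrite !big_ord_recl big_ord0/= addr0 scalerN -scalerBl -rmorphB/=.
    by congr (_%:C%C *: _); field.
move=> y hy.
(* The signs are changed one coordinate at a time, by [rad_norm_flip]. *)
suff H j : (j <= n)%N -> rad_norm p (fun k : 'I_n => if (k < j)%N then y k else x k)
    = rad_norm p x.
  rewrite -(H n (leqnn _)) (_ : (fun k : 'I_n => _) = y)//.
  by apply/funext => k; rewrite ltn_ord.
elim: j => [_|j IH jn]; first by [].
rewrite -(IH (ltnW jn)); have [yj|yj] := hy (Ordinal jn).
  congr rad_norm; apply/funext => k; rewrite ltnS leq_eqVlt.
  have [kj|//] := eqVneq (k : nat) j; rewrite kj ltnn/=.
  by have -> : k = Ordinal jn by exact: val_inj.
rewrite -(rad_norm_flip _ (Ordinal jn)); congr rad_norm; apply/funext => k.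
rewrite ltnS leq_eqVlt -val_eqE/=; have [kj|//] := eqVneq (k : nat) j.
rewrite kj ltnn/=; have -> : k = Ordinal jn by exact: val_inj.
by rewrite yj opprK.
Qed.

(** Real and imaginary parts are contracted separately, which costs the factor 2. *)
Lemma rad_norm_complex_contraction n (x : 'I_n -> X) (c : 'I_n -> R[i]) (B : R) :
  (forall k, cabs (c k) <= B) -> rad_norm p (fun k => c k *: x k) <= 2 * B * rad_norm p x.
Proof.
move=> hc; case: n x c hc => [|n] x c hc.
  (* Without coordinates nothing forces [B] to be nonnegative, so this case is settled first. *)
  have zero (z : 'I_0 -> X) : rad_norm p z = 0.
    by rewrite -(rad_norm0 0); congr rad_norm; apply/funext => -[].
  by rewrite !zero mulr0.
have B0 : 0 <= B by apply: le_trans (hc ord0); exact: cabs_ge0.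
have real_part (f : R[i] -> R) : (forall z, `|f z| <= cabs z) ->
    rad_norm p (fun k => (f (c k))%:C%C *: x k) <= B * rad_norm p x.
  move=> hf; have [B00|Bn0] := eqVneq B 0.
    rewrite (_ : (fun k => _) = (fun=> 0)) ?rad_norm0 ?B00 ?mul0r//.
    apply/funext => k; have := le_trans (hf (c k)) (hc k).
    by rewrite B00 normr_le0 => /eqP ->; rewrite scale0r.
  have Bgt0 : 0 < B by rewrite lt_neqAle eq_sym Bn0.
  rewrite (_ : (fun k => _) = (fun k => B%:C%C *: ((f (c k) / B)%:C%C *: x k))).
    rewrite rad_normZ.
    rewrite cabs_real.
    rewrite (ger0_norm B0).
    apply: (ler_wpM2l B0).
    apply: rad_norm_contraction => k.
    rewrite normrM normfV (ger0_norm B0) ler_pdivrMr// mul1r.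
    exact: le_trans (hf _) (hc k).
  by apply/funext => k; rewrite scalerA -rmorphM/= mulrC divfK.
rewrite (_ : (fun k => _) = (fun k => (complex.Re (c k))%:C%C *: x k +
    'i%C *: ((complex.Im (c k))%:C%C *: x k))); last first.
  by apply/funext => k; rewrite scalerA -scalerDl -complexE.
apply: le_trans (rad_normD _ _) _; rewrite rad_normZ cabs_i mul1r.
rewrite -mulrA mulr_natl mulr2n.
exact: lerD (real_part _ (@Re_le_cabs R)) (real_part _ (@Im_le_cabs R)).
Qed.

End rad_norm.

Opaque rad_norm.

(** * Calculus of R-bounds *)

(* R-bounds of indexed families: [rbounded p P F C] says that the operators
   [F i], [P i], have R-bound at most [C]; [rbounded_below] is the reverse
   inequality, which replaces R-bounds of inverses. *)
Definition rbounded (R : realType) (X : normedModType R[i]) (p : R) (I : Type)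
    (P : set I) (F : I -> X -> X) (C : R) : Prop :=
  forall n (i : 'I_n -> I) (x : 'I_n -> X), (forall k, P (i k)) ->
    rad_norm p (fun k => F (i k) (x k)) <= C * rad_norm p x.

Definition rbounded_below (R : realType) (X : normedModType R[i]) (p : R) (I : Type)
    (P : set I) (F : I -> X -> X) (C : R) : Prop :=
  forall n (i : 'I_n -> I) (x : 'I_n -> X), (forall k, P (i k)) ->
    rad_norm p x <= C * rad_norm p (fun k => F (i k) (x k)).

Section rbounded.
Variables (R : realType) (X : normedModType R[i]) (p : R).
Hypothesis p1 : 1 <= p.
Implicit Types (I J : Type).

Lemma rad_norm_real_contraction n (x : 'I_n -> X) (a : 'I_n -> R) (B : R) :
  0 <= B -> (forall k, `|a k| <= B) ->
  rad_norm p (fun k => (a k)%:C%C *: x k) <= B * rad_norm p x.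
Proof.
move=> B0 ha; have [B00|Bn0] := eqVneq B 0.
  rewrite (_ : (fun k => _) = (fun=> 0)) ?(rad_norm0 _ p1) ?B00 ?mul0r//.
  apply/funext => k; have := ha k.
  by rewrite B00 normr_le0 => /eqP ->; rewrite scale0r.
have Bgt0 : 0 < B by rewrite lt_neqAle eq_sym Bn0.
rewrite (_ : (fun k => _) = (fun k => B%:C%C *: ((a k / B)%:C%C *: x k))).
  rewrite (rad_normZ p1) cabs_real (ger0_norm B0); apply: (ler_wpM2l B0).
  apply: (rad_norm_contraction p1) => k.
  rewrite normrM normfV (ger0_norm B0) ler_pdivrMr// mul1r; exact: ha.
by apply/funext => k; rewrite scalerA -rmorphM/= mulrC divfK.
Qed.

Lemma rbounded_weaken I (P : set I) (F : I -> X -> X) C C' :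
  C <= C' -> rbounded p P F C -> rbounded p P F C'.
Proof.
move=> CC' h n i x hi; apply: le_trans (h n i x hi) _.
by apply: ler_wpM2r => //; exact: rad_norm_ge0.
Qed.

Lemma rbounded_reindex I J (P : set I) (Q : set J) (g : J -> I) (F : I -> X -> X)
    (G : J -> X -> X) C :
  (forall j, Q j -> P (g j)) -> (forall j x, Q j -> G j x = F (g j) x) ->
  rbounded p P F C -> rbounded p Q G C.
Proof.
move=> hg hG h n j x hj.
rewrite (_ : (fun k => _) = (fun k => F (g (j k)) (x k))).
  by apply: (h n (fun k => g (j k))) => k; exact: hg.
by apply/funext => k; apply: hG.
Qed.

Lemma rbounded_comp I (P : set I) (F G : I -> X -> X) C D : 0 <= C ->
  rbounded p P F C -> rbounded p P G D ->
  rbounded p P (fun i x => F i (G i x)) (C * D).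
Proof.
move=> C0 hF hG n i x hi; apply: le_trans (hF n i _ hi) _.
by rewrite -mulrA; apply: (ler_wpM2l C0); exact: hG.
Qed.

Lemma rbounded_add I (P : set I) (F G : I -> X -> X) C D :
  rbounded p P F C -> rbounded p P G D ->
  rbounded p P (fun i x => F i x + G i x) (C + D).
Proof.
move=> hF hG n i x hi; apply: le_trans (rad_normD p1 _ _) _.
by rewrite mulrDl; apply: lerD; [exact: hF|exact: hG].
Qed.

Lemma rbounded_id I (P : set I) : rbounded p P (fun _ (x : X) => x) 1.
Proof. by move=> n i x _; rewrite mul1r. Qed.

Lemma rbounded_scale I (P : set I) (F : I -> X -> X) (c : R[i]) C :
  rbounded p P F C -> rbounded p P (fun i x => c *: F i x) (cabs c * C).
Proof.
move=> hF n i x hi; rewrite (rad_normZ p1) -mulrA.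
by apply: ler_wpM2l; [exact: cabs_ge0|exact: hF].
Qed.

Lemma rbounded_sub I (P : set I) (F G : I -> X -> X) C D :
  rbounded p P F C -> rbounded p P G D ->
  rbounded p P (fun i x => F i x - G i x) (C + D).
Proof.
move=> hF hG n i x hi; apply: le_trans (rad_normB p1 _ _) _.
by rewrite mulrDl; apply: lerD; [exact: hF|exact: hG].
Qed.

Lemma rbounded_real I (P : set I) (F : I -> X -> X) (a : I -> R) B C : 0 <= B ->
  (forall i, P i -> `|a i| <= B) -> rbounded p P F C ->
  rbounded p P (fun i x => (a i)%:C%C *: F i x) (B * C).
Proof.
move=> B0 ha hF n i x hi.
apply: le_trans (rad_norm_real_contraction _ B0 _) _; first by move=> k; exact: ha.
by rewrite -mulrA; apply: (ler_wpM2l B0); exact: hF.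
Qed.

Lemma rbounded_complex I (P : set I) (F : I -> X -> X) (c : I -> R[i]) B C : 0 <= B ->
  (forall i, P i -> cabs (c i) <= B) -> rbounded p P F C ->
  rbounded p P (fun i x => c i *: F i x) (2 * B * C).
Proof.
move=> B0 hc hF n i x hi.
apply: le_trans (rad_norm_complex_contraction p1 _ _) _; first by move=> k; exact: hc.
by rewrite -[leRHS]mulrA; apply: ler_wpM2l; [rewrite mulr_ge0|exact: hF].
Qed.

Lemma rbounded_sum I (P : set I) (m : nat) (F : nat -> I -> X -> X) (C : nat -> R) :
  (forall j, (j < m)%N -> rbounded p P (F j) (C j)) ->
  rbounded p P (fun i x => \sum_(j < m) F j i x) (\sum_(j < m) C j).
Proof.
move=> h n i x hi; apply: le_trans (rad_norm_sum p1 _ _ _) _.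
rewrite mulr_suml; apply: ler_sum => j _; exact: h.
Qed.

(** R-bounds pass to strong limits. The approximant may depend on the vector and on the accuracy: a
    fixed tuple requires finitely many choices, whose errors add up to at most [e]. *)
Lemma rbounded_lim I J (P : set I) (Q : set J) (F : I -> X -> X) (G : J -> X -> X) C :
  (forall i x e, P i -> 0 < e -> exists2 j, Q j & rnorm (F i x - G j x) <= e) ->
  rbounded p Q G C -> rbounded p P F C.
Proof.
move=> happ hG n i x hi; apply/ler_addgt0Pr => e e0.
(* Divided by [n + 1] and not by [n], since the tuple may be empty. *)
have e'0 : 0 < e / n.+1%:R by rewrite divr_gt0.
pose j k := s2val (cid2 (happ (i k) (x k) _ (hi k) e'0)).
have Qj k : Q (j k) by exact: (s2valP (cid2 (happ (i k) (x k) _ (hi k) e'0))).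
have hj k : rnorm (F (i k) (x k) - G (j k) (x k)) <= e / n.+1%:R.
  exact: (s2valP' (cid2 (happ (i k) (x k) _ (hi k) e'0))).
rewrite (_ : (fun k => _) =
    (fun k => G (j k) (x k) + (F (i k) (x k) - G (j k) (x k)))); last first.
  by apply/funext => k; rewrite subrKC.
apply: le_trans (rad_normD p1 _ _) _; apply: lerD; first exact: hG.
apply: le_trans (rad_norm_le_sum p1 _) _.
apply: (@le_trans _ _ (\sum_(k < n) (e / n.+1%:R))); first exact: ler_sum.
rewrite sumr_const card_ord -[leLHS]mulr_natr -mulrA ger_pMr// mulrC.
by rewrite ler_pdivrMr ?ltr0n// mul1r ler_nat.
Qed.

Lemma rbounded_norm I (P : set I) (F : I -> X -> X) C i (x : X) :
  rbounded p P F C -> P i -> rnorm (F i x) <= C * rnorm x.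
Proof.
by move=> h Pi; have := h 1%N (fun=> i) (fun=> x) (fun=> Pi); rewrite !rad_norm1.
Qed.

(** Absolutely convex combinations cost only a factor 2, whatever the number of terms: each
    coordinate is [B] times a convex combination of vectors [d *: F j x] with [|d| <= 1], to which
    [rad_norm_convex] applies. *)
Lemma rbounded_hull I J (P : set I) (Q : set J) (j0 : J) (F : J -> X -> X)
    (m : I -> nat) (c : I -> nat -> R[i]) (g : I -> nat -> J) (B C : R) :
  0 < B -> 0 <= C -> Q j0 ->
  (forall i j, P i -> (j < m i)%N -> Q (g i j)) ->
  (forall i, P i -> \sum_(j < m i) cabs (c i j) <= B) ->
  rbounded p Q F C ->
  rbounded p P (fun i x => \sum_(j < m i) c i j *: F (g i j) x) (2 * B * C).
Proof.
move=> B0 C0 Qj0 hg hc hF n i x hi.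
pose V k := [set z | exists j d, [/\ Q j, cabs d <= 1 & z = d *: F j (x k)]].
have -> : 2 * B * C * rad_norm p x = B * (2 * 1 * (C * rad_norm p x)).
  by rewrite mulr1 !mulrA [B * 2]mulrC.
rewrite (_ : (fun k => _) = (fun k => B%:C%C *: \sum_(j < m (i k))
    (B^-1%:C%C * c (i k) j) *: F (g (i k) j) (x k))); last first.
  apply/funext => k; rewrite scaler_sumr; apply: eq_bigr => j _.
  rewrite !scalerA mulrA -rmorphM/= divff ?gt_eqF// rmorph1 mul1r//.
rewrite (rad_normZ p1) cabs_real gtr0_norm//; apply: (ler_wpM2l (ltW B0)).
apply: (@rad_norm_convex _ _ _ p1 n V).
  move=> y hy; pose j k := projT1 (cid (hy k)).
  pose d k := projT1 (cid (projT2 (cid (hy k)))).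
  have hjd k : [/\ Q (j k), cabs (d k) <= 1 & y k = d k *: F (j k) (x k)].
    exact: (projT2 (cid (projT2 (cid (hy k))))).
  rewrite (_ : y = (fun k => d k *: F (j k) (x k))); last first.
    by apply/funext => k; have [] := hjd k.
  apply: le_trans (rad_norm_complex_contraction p1 _ (B := 1) _) _.
    by move=> k; have [] := hjd k.
  by apply: ler_wpM2l; [rewrite mulr_ge0|apply: hF => k; have [] := hjd k].
move=> k; set M := m (i k).
(* The coefficients may sum to less than 1; one more term, the zero multiple of [F j0], completes
   them to a convex combination. *)
pose l (j : 'I_M.+1) := if (j < M)%N then cabs (c (i k) j) / B
  else 1 - \sum_(j < M) cabs (c (i k) j) / B.
pose v (j : 'I_M.+1) := if (j < M)%N
  then (c (i k) j / (cabs (c (i k) j))%:C%C) *: F (g (i k) j) (x k)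
  else 0 *: F j0 (x k).
have sumle : \sum_(j < M) cabs (c (i k) j) / B <= 1.
  by rewrite -mulr_suml ler_pdivrMr// mul1r; exact: hc.
exists M.+1, l, v; split.
- move=> j; rewrite /l; case: ifP => _; last by rewrite subr_ge0.
  by rewrite divr_ge0 ?cabs_ge0// ltW.
- rewrite big_ord_recr/= /l /= ltnn.
  rewrite (eq_bigr (fun j : 'I_M => cabs (c (i k) j) / B)) ?subrKC//.
  by move=> j _ /=; rewrite ltn_ord.
- move=> j; rewrite /v; case: ifP => jM.
    exists (g (i k) j), (c (i k) j / (cabs (c (i k) j))%:C%C); split=> //.
      by apply: hg; [exact: hi|exact: jM].
    rewrite cabsM cabsV cabs_real ger0_norm ?cabs_ge0//.
    have [->|c0] := eqVneq (cabs (c (i k) j)) 0; first by rewrite mul0r.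
    by rewrite divff.
  by exists j0, 0; split=> //; rewrite cabs0.
- rewrite big_ord_recr/= {2}/v/= ltnn !scale0r scaler0 addr0.
  apply: eq_bigr => j _; rewrite /l /v /= ltn_ord scalerA; congr (_ *: _).
  have [c0|c0] := eqVneq (c (i k) j) 0; first by rewrite c0 !mul0r !mulr0.
  have c1 : (cabs (c (i k) j))%:C%C != 0.
    by rewrite -(rmorph0 (real_complex R)) (inj_eq (@complexI R)) cabs_eq0.
  rewrite rmorphM/=; move: c1; move: ((cabs (c (i k) j))%:C%C) => w w0.
  by move: (B^-1%:C%C) (c (i k) j) => b u; field.
Qed.

End rbounded.

Section rbound.
Variables (R : realType) (X : normedModType R[i]) (p : R).
Hypothesis p1 : 1 <= p.

Lemma rbound_le I (P : set I) (F : I -> X -> X) C : 0 <= C ->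
  rbounded p P F C -> (rbound p [set F i | i in P] <= C%:E)%E.
Proof.
move=> C0 h; apply: ereal_inf_lbound; exists C => //; split=> // n S x hS.
rewrite !rademacher_normE// lee_fin.
rewrite (_ : (fun k => S k (x k)) = (fun k => F (s2val (cid2 (hS k))) (x k))).
  by apply: h => k; exact: (s2valP (cid2 (hS k))).
by apply/funext => k; rewrite (s2valP' (cid2 (hS k))).
Qed.

Lemma rbound_lt I (P : set I) (F : I -> X -> X) c :
  (rbound p [set F i | i in P] < c)%E ->
  exists2 C : R, 0 <= C /\ (C%:E < c)%E & rbounded p P F C.
Proof.
move=> /ereal_inf_lt[_ /= [C [C0 hC] <-] Cc]; exists C => // n i x hi.
have := hC n (fun k => F (i k)) x (fun k => ex_intro2 _ _ (i k) (hi k) erefl).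
by rewrite !rademacher_normE.
Qed.

Lemma rbound_le_subset (A B : set (X -> X)) :
  A `<=` B -> (rbound p A <= rbound p B)%E.
Proof.
move=> AB; apply: le_ereal_inf => _ /= [C [C0 hC] <-]; exists C => //; split=> //.
by move=> n S x hS; apply: hC => k; exact: AB.
Qed.

(** The R-bound is monotone in [e], so the limit exists and is an infimum; a strict bound on the
    limit is then a bound for some [e]. *)
Lemma lim_rbound_inf (F : R -> X -> X) :
  lim (rbound p [set F t | t in [set t : R | (0 < t < e)%R]] @[e --> 0^'+]) =
  ereal_inf [set rbound p [set F t | t in [set t : R | (0 < t < e)%R]] | e in `]0%R, +oo[].
Proof.
apply: cvg_lim => //.
apply: (@nondecreasing_at_right_cvge R
  (fun e => rbound p [set F t | t in [set t : R | (0 < t < e)%R]]) 0 (BInfty R false)).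
  by rewrite bnd_simp.
move=> e e' _ _ ee'; apply: rbound_le_subset => _ /= [t /andP[t0 te] <-].
by exists t => //; rewrite t0 (lt_le_trans te).
Qed.

Lemma lim_rbound_lt (F : R -> X -> X) c :
  (lim (rbound p [set F t | t in [set t : R | (0 < t < e)%R]] @[e --> 0^'+]) < c%:E)%E ->
  exists e C : R, [/\ 0 < e, 0 <= C < c & rbounded p [set t | 0 < t < e] F C].
Proof.
rewrite lim_rbound_inf => /ereal_inf_lt[_ /= [e e0 <-]] /rbound_lt[C [C0 Cc] hC].
by exists e, C; split=> //; [move: e0; rewrite in_itv/= andbT|rewrite C0 -lte_fin].
Qed.

Lemma lim_rbound_le (F : R -> X -> X) e C : 0 < e -> 0 <= C ->
  rbounded p [set t | 0 < t < e] F C ->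
  (lim (rbound p [set F t | t in [set t : R | (0 < t < e)%R]] @[e --> 0^'+]) <= C%:E)%E.
Proof.
move=> e0 C0 h; rewrite lim_rbound_inf; apply: le_trans (rbound_le C0 h).
by apply: ereal_inf_lbound; exists e => //=; rewrite in_itv/= e0.
Qed.

End rbound.

(** * The unit circle *)

Definition expi (R : realType) (b : R) : R[i] := (cos b +i* sin b)%C.

Section expi.
Variable R : realType.
Implicit Types (a b : R) (n m : nat).

Lemma expiD a b : expi (a + b) = expi a * expi b.
Proof. by rewrite /expi cosD sinD [sin a * _ + _]addrC. Qed.

Lemma expi0 : expi (0 : R) = 1.
Proof. by rewrite /expi cos0 sin0. Qed.

Lemma cabs_expi b : cabs (expi b) = 1.
Proof. by rewrite cabsE cos2Dsin2 sqrtr1. Qed.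

Lemma expi_neq0 b : expi b != 0.
Proof. by rewrite -cabs_gt0 cabs_expi. Qed.

Lemma expiMn b n : expi (b *+ n) = expi b ^+ n.
Proof. by elim: n => [|n IH]; rewrite ?mulr0n ?expi0// mulrS expiD IH exprS. Qed.

Lemma expiN b : expi (- b) = (expi b)^-1.
Proof.
by apply: (mulIf (expi_neq0 b)); rewrite -expiD addNr expi0 mulVf ?expi_neq0.
Qed.

Lemma expi2pi : expi (pi *+ 2 : R) = 1.
Proof. by rewrite /expi cos2pi sin2pi. Qed.

Lemma expiD2pi b : expi (b + pi *+ 2) = expi b.
Proof. by rewrite expiD expi2pi mulr1. Qed.

Lemma cabs_expi_sub1_sqr b : cabs (expi b - 1) ^+ 2 = 2 * (1 - cos b).
Proof.
rewrite (_ : expi b - 1 = ((cos b - 1) +i* sin b)%C); last first.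
  by apply/eqP; rewrite eq_complex /= subr0 !eqxx.
rewrite cabs_sqr; have := cos2Dsin2 b; rewrite !expr2; lra.
Qed.

Lemma sin_le_id b : 0 <= b -> sin b <= b.
Proof.
rewrite le_eqVlt => /predU1P[<-|b0]; first by rewrite sin0.
have [c _] := MVT b0 (fun x _ => is_derive_sin x)
  (continuous_subspaceT (@continuous_sin R)).
rewrite sin0 !subr0 => ->; rewrite -[leRHS]mul1r.
by apply: (ler_wpM2r (ltW b0)); exact: cos_le1.
Qed.

Lemma sin_norm_le b : `|sin b| <= `|b|.
Proof.
have H (c : R) : 0 <= c -> `|sin c| <= c.
  move=> c0; rewrite ler_norml sin_le_id// andbT.
  have [c1|c1] := leP c 1.
    suff : 0 <= sin c by lra.
    by apply: sin_ge0_pi; rewrite c0 (le_trans c1)// (le_trans _ (@pi_ge2 R))// ler1n.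
  by apply: le_trans (sin_geN1 _); rewrite lerN2 ltW.
have [b0|b0] := leP 0 b; first by rewrite (ger0_norm b0); exact: H.
by rewrite -normrN -sinN (ltr0_norm b0); apply: H; lra.
Qed.

Lemma cabs_expi_sub1_sin b : cabs (expi b - 1) = 2 * `|sin (b / 2)|.
Proof.
apply/eqP; rewrite -(@eqrXn2 _ 2)// ?cabs_ge0 ?mulr_ge0//; apply/eqP.
rewrite cabs_expi_sub1_sqr exprMn real_normK ?num_real// sin2cos2.
have := cos_mulr2n (b / 2); rewrite (_ : b / 2 *+ 2 = b); last first.
  by rewrite -mulr_natr divfK.
by move=> ->; rewrite -mulr_natr; ring.
Qed.

Lemma cabs_expi_sub1_le b : cabs (expi b - 1) <= `|b|.
Proof.
rewrite cabs_expi_sub1_sin; have := sin_norm_le (b / 2).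
by rewrite normrM (ger0_norm (_ : 0 <= 2^-1)) ?invr_ge0//; lra.
Qed.

Lemma cabs_expi_sub a b : cabs (expi a - expi b) <= `|a - b|.
Proof.
apply: le_trans (cabs_expi_sub1_le _).
rewrite -[leRHS]mul1r -(cabs_expi b) -cabsM mulrBr mulr1 -expiD.
by rewrite subrKC.
Qed.

End expi.

(** * Cauchy estimates in a seminormed space *)

(* Decides equalities of signed sums in an abelian group. *)
Ltac abel_step :=
  match goal with
  | |- ?s - ?x = 0 => progress (repeat match goal with
      | |- context [?u + x + ?w] =>
          lazymatch w with
          | x => fail | - x => rewrite (addrK x u) | _ => rewrite (addrAC u x w) end
      end)
  | |- ?s + ?x = 0 => progress (repeat match goal with
      | |- context [?u - x + ?w] =>
          lazymatch w with
          | - x => fail | x => rewrite (subrK x u) | _ => rewrite (addrAC u (- x) w) end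
      end)
  end.
Ltac abel :=
  apply: subr0_eq; refine (etrans (esym (add0r _)) _);
  rewrite ?(opprD, opprK, oppr0, addr0, addrA); repeat abel_step; try reflexivity.


(** The norm is a plain function [N] on a bare module. The notion thus serves both [X] and the space
    of [n]-tuples with [rad_norm], for which no normed structure is declared. *)
Definition differentiable_for (R : realType) (V : lmodType R[i]) (N : V -> R)
    (H : R[i] -> V) (z : R[i]) (H' : V) : Prop :=
  forall e : R, 0 < e -> exists2 d : R, 0 < d & forall w, cabs (w - z) < d ->
    N (H w - H z - (w - z) *: H') <= e * cabs (w - z).

(* Trapezoidal sums with [2 ^ n] steps for the integral of [H] along the curve
   [c] restricted to [a, a + v].  Goursat's argument only needs that they split
   exactly when an edge is halved and that they are exact on affine functions,
   so that no limit, hence no integral, has to be formed. *)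
Fixpoint edge_sum (R : realType) (V : lmodType R[i]) (H : R[i] -> V) (n : nat)
    (c : R -> R[i]) (a v : R) : V :=
  if n is n'.+1 then edge_sum H n' c a (v / 2) + edge_sum H n' c (a + v / 2) (v / 2)
  else ((c (a + v) - c a) / 2) *: (H (c a) + H (c (a + v))).

Definition polar (R : realType) (r t : R) : R[i] := r%:C%C * expi t.

(** The positively oriented boundary of a rectangle in polar coordinates, with sides [[r, r + a]]
    and [[t, t + b]]. For [b = 2 pi] the radial edges cancel, and what remains compares two
    circles. *)
Definition rect_sum (R : realType) (V : lmodType R[i]) (H : R[i] -> V) (n : nat)
    (r t a b : R) : V :=
  edge_sum H n (fun u => polar u t) r a + edge_sum H n (polar (r + a)) t b
  - edge_sum H n (fun u => polar u (t + b)) r a - edge_sum H n (polar r) t b.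

Section edge_sum.
Variables (R : realType) (V : lmodType R[i]) (N : V -> R).
Hypothesis ND : forall u v, N (u + v) <= N u + N v.
Hypothesis NZ : forall c v, N (c *: v) = cabs c * N v.
Implicit Types (H K : R[i] -> V) (c : R -> R[i]) (z w : R[i]).

Lemma semi0 : N 0 = 0.
Proof. by rewrite -(scale0r (0 : V)) NZ cabs0 mul0r. Qed.

Lemma semiN v : N (- v) = N v.
Proof. by rewrite -scaleN1r NZ cabsN cabs1 mul1r. Qed.

Lemma semi_ge0 v : 0 <= N v.
Proof. by have := ND v (- v); rewrite subrr semi0 semiN; lra. Qed.

Lemma semiB u v : N (u - v) <= N u + N v.
Proof. by rewrite -(semiN v); exact: ND. Qed.

Lemma semi_distC u v : N (u - v) = N (v - u).
Proof. by rewrite -semiN opprB. Qed.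

Lemma edge_sumD H K n c a v :
  edge_sum (fun z => H z + K z) n c a v = edge_sum H n c a v + edge_sum K n c a v.
Proof.
elim: n a v => [|n IH] a v /=; last by rewrite !IH addrACA.
by rewrite -scalerDr addrACA.
Qed.

Lemma edge_sum_affine (A B : V) z0 n c a v :
  edge_sum (fun z => A + (z - z0) *: B) n c a v =
  ((c (a + v) - z0) *: A + ((c (a + v) - z0) ^+ 2 / 2) *: B) -
  ((c a - z0) *: A + ((c a - z0) ^+ 2 / 2) *: B).
Proof.
elim: n a v => [|n IH] a v /=.
  rewrite [in RHS]opprD [in RHS]addrACA -!scalerBl (addrACA A) -scalerDl -mulr2n.
  rewrite -[A *+ 2]scaler_nat scalerDr !scalerA; congr (_ + _); congr (_ *: _); first by field.
  by rewrite {1}/GRing.scale/=; field.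
have av : a + v / 2 + v / 2 = a + v by rewrite -addrA -splitr.
by rewrite !IH av addrC subrKA.
Qed.

Lemma edge_sum_le H n c a v (M K : R) : 0 <= v -> 0 <= K -> 0 <= M ->
  (forall s t, a <= s -> s <= t -> t <= a + v -> cabs (c t - c s) <= K * (t - s)) ->
  (forall t, a <= t <= a + v -> N (H (c t)) <= M) ->
  N (edge_sum H n c a v) <= M * K * v.
Proof.
move=> v0 K0 M0; elim: n a v v0 => [|n IH] a v v0 hc hM /=.
  rewrite NZ cabsM cabsV cabs_nat.
  have h1 := hc a (a + v) (lexx _) ltac:(by rewrite lerDl) (lexx _).
  have h2 : N (H (c a) + H (c (a + v))) <= 2 * M.
    apply: le_trans (ND _ _) _.
    have := hM a ltac:(by rewrite lexx lerDl).
    have := hM (a + v) ltac:(by rewrite lexx lerDl v0).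
    by move: (N _) (N _) => x y ? ?; lra.
  have -> : M * K * v = (K * (a + v - a)) / 2 * (2 * M) by field.
  apply: ler_pM => //; rewrite ?divr_ge0 ?cabs_ge0 ?semi_ge0//.
  by rewrite ler_pM2r ?invr_gt0.
have -> : M * K * v = M * K * (v / 2) + M * K * (v / 2) by field.
have v20 : 0 <= v / 2 by rewrite divr_ge0.
have av : a + v / 2 + v / 2 = a + v by field.
apply: le_trans (ND _ _) _; apply: lerD; apply: IH => //.
- by move=> s t h1 h2 h3; apply: hc => //; lra.
- by move=> t /andP[h1 h2]; apply: hM; lra.
- by rewrite av => s t h1 h2 h3; apply: hc => //; lra.
- by rewrite av => t /andP[h1 h2]; apply: hM; lra.
Qed.

Lemma rect_sumD H K n r t a b :
  rect_sum (fun z => H z + K z) n r t a b = rect_sum H n r t a b + rect_sum K n r t a b.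
Proof.
have rearr (e1 e2 e3 e4 f1 f2 f3 f4 : V) :
    (e1 + f1) + (e2 + f2) - (e3 + f3) - (e4 + f4) =
    (e1 + e2 - e3 - e4) + (f1 + f2 - f3 - f4).
  by abel.
by rewrite /rect_sum !edge_sumD rearr.
Qed.

Lemma rect_sum_affine (A B : V) z0 n r t a b :
  rect_sum (fun z => A + (z - z0) *: B) n r t a b = 0.
Proof.
have rearr (e1 e2 e3 e4 : V) : (e2 - e1) + (e3 - e2) - (e3 - e4) - (e4 - e1) = 0.
  by abel.
by rewrite /rect_sum !edge_sum_affine rearr.
Qed.

Lemma rect_sumS H n r t a b :
  rect_sum H n.+1 r t a b =
  (rect_sum H n r t (a / 2) (b / 2) + rect_sum H n (r + a / 2) t (a / 2) (b / 2)) +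
  (rect_sum H n r (t + b / 2) (a / 2) (b / 2) +
   rect_sum H n (r + a / 2) (t + b / 2) (a / 2) (b / 2)).
Proof.
(* The four inner edges [m1], [m2], [k1], [k2] each occur twice with opposite signs. *)
have rearr (b1 b2 r1 r2 t1 t2 l1 l2 m1 m2 k1 k2 : V) :
    (b1 + b2) + (r1 + r2) - (t1 + t2) - (l1 + l2) =
    ((b1 + m1 - k1 - l1) + (b2 + r1 - k2 - m1)) +
    ((k1 + m2 - t1 - l2) + (k2 + r2 - t2 - m2)).
  by abel.
rewrite /rect_sum /= !(rearr _ _ _ _ _ _ _ _ (edge_sum H n (polar (r + a / 2)) t (b / 2))
  (edge_sum H n (polar (r + a / 2)) (t + b / 2) (b / 2))
  (edge_sum H n (fun u => polar u (t + b / 2)) r (a / 2))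
  (edge_sum H n (fun u => polar u (t + b / 2)) (r + a / 2) (a / 2))).
by rewrite -![_ + a / 2 + a / 2]addrA -![_ + b / 2 + b / 2]addrA -!splitr.
Qed.


End edge_sum.

Section cauchy.
Variables (R : realType) (V : lmodType R[i]) (N : V -> R).
Hypothesis ND : forall u v, N (u + v) <= N u + N v.
Hypothesis NZ : forall c v, N (c *: v) = cabs c * N v.
Implicit Types (H K F : R[i] -> V) (z w : R[i]).

Lemma cabs_polar (r t : R) : cabs (polar r t) = `|r|.
Proof. by rewrite /polar cabsM cabs_expi mulr1 cabs_real. Qed.

Lemma polar_sub (r r' t t' : R) :
  cabs (polar r t - polar r' t') <= `|r - r'| + `|r'| * `|t - t'|.
Proof.
rewrite /polar (_ : _ - _ = (r - r')%:C%C * expi t + r'%:C%C * (expi t - expi t')); last first.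
  by rewrite rmorphB/=; ring.
apply: le_trans (cabsD _ _) _; rewrite !cabsM !cabs_real cabs_expi mulr1 lerD2l.
by apply: ler_wpM2l => //; exact: cabs_expi_sub.
Qed.

Lemma rect_sum_le H n (r t a b M r1 : R) : 0 <= r -> 0 <= a -> 0 <= b -> 0 <= M ->
  r + a <= r1 ->
  (forall u s, r <= u <= r + a -> t <= s <= t + b -> N (H (polar u s)) <= M) ->
  N (rect_sum H n r t a b) <= 2 * M * (a + r1 * b).
Proof.
move=> r0 a0 b0 M0 ra hM; have r10 : 0 <= r1 by lra.
have radial s : t <= s <= t + b -> N (edge_sum H n (fun u => polar u s) r a) <= M * 1 * a.
  move=> hs; apply: (edge_sum_le ND NZ) => //.
  - move=> u u' h1 h2 h3; apply: le_trans (polar_sub _ _ _ _) _.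
    by rewrite subrr normr0 mulr0 addr0 mul1r ger0_norm ?subr_ge0.
  - by move=> u hu; exact: hM.
have circ u : r <= u <= r + a -> N (edge_sum H n (polar u) t b) <= M * r1 * b.
  move=> hu; apply: (edge_sum_le ND NZ) => //.
  - move=> s s' h1 h2 h3; apply: le_trans (polar_sub _ _ _ _) _.
    rewrite subrr normr0 add0r; have u0 : 0 <= u by lra.
    rewrite (ger0_norm u0) (ger0_norm (_ : 0 <= s' - s)) ?subr_ge0//.
    by apply: ler_wpM2r; [rewrite subr_ge0|lra].
  - by move=> s hs; exact: hM.
have -> : 2 * M * (a + r1 * b) = M * 1 * a + M * r1 * b + M * 1 * a + M * r1 * b by ring.
rewrite /rect_sum.
apply: le_trans (semiB ND NZ _ _) _; apply: lerD; last by apply: circ; rewrite lexx lerDl.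
apply: le_trans (semiB ND NZ _ _) _; apply: lerD; last by apply: radial; rewrite lexx lerDl b0.
apply: le_trans (ND _ _) _; apply: lerD; first by apply: radial; rewrite lexx lerDl.
by apply: circ; rewrite lexx lerDl a0.
Qed.

Lemma nested_intervals (x w : nat -> R) : (forall m, 0 <= w m) ->
  (forall m, x m <= x m.+1) -> (forall m, x m.+1 + w m.+1 <= x m + w m) ->
  exists y, forall m, x m <= y <= x m + w m.
Proof.
move=> w0 up down.
have up' m k : x m <= x (m + k)%N.
  by elim: k => [|k IH]; rewrite ?addn0// addnS; exact: le_trans IH (up _).
have down' m k : x (m + k)%N + w (m + k)%N <= x m + w m.
  by elim: k => [|k IH]; rewrite ?addn0// addnS; exact: le_trans (down _) IH.
have cross m k : x k <= x m + w m.
  have [mk|/ltnW km] := leqP m k.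
    rewrite -(subnKC mk); apply: le_trans (down' m (k - m)%N).
    by rewrite lerDl.
  by apply: le_trans (_ : x m <= _); [rewrite -(subnKC km)|rewrite lerDl].
have ub m : ubound (range x) (x m + w m) by move=> _ [k _ <-].
exists (sup (range x)) => m; apply/andP; split.
  by apply: ub_le_sup; [exists (x 0%N + w 0%N); exact: ub|exists m].
by apply: ge_sup; [exists (x 0%N), 0%N|exact: ub].
Qed.

Lemma norm_le_interval (x y a d : R) :
  a <= x <= a + d -> a <= y <= a + d -> `|x - y| <= d.
Proof. by move=> /andP[? ?] /andP[? ?]; rewrite ler_norml; apply/andP; split; lra. Qed.

Lemma exists_pow2_gt (x : R) : exists m : nat, x < 2 ^+ m.
Proof.
exists (Num.bound `|x|); apply: le_lt_trans (ler_norm x) _.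
apply: lt_trans (archi_boundP (normr_ge0 x)) _.
by rewrite -natrX ltr_nat ltn_expl.
Qed.

(* Goursat's lemma: bisect, and use the affine approximation at the common point of the
   rectangles. *)
Lemma rect_sum_small H (H' : R[i] -> V) (r0 a0 : R) : 0 < r0 -> 0 < a0 ->
  (forall z, r0 <= cabs z <= r0 + a0 -> differentiable_for N H z (H' z)) ->
  forall e, 0 < e -> exists n0, forall n, (n0 <= n)%N ->
    N (rect_sum H n r0 0 a0 (pi *+ 2)) <= e.
Proof.
move=> r00 a00 dH e e0; have pi0 := @pi_gt0 R.
have b00 : 0 < pi *+ 2 :> R by rewrite mulrn_wgt0.
move: (pi *+ 2) b00 => b0 b00.
(* Smallness is relative to the area, by the factor [4^-m], and is asked only of fine enough
   trapezoidal sums, because each bisection uses up one level of refinement. *)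
pose small m (q : R * R) := exists n0, forall n, (n0 <= n)%N ->
  N (rect_sum H n q.1 q.2 (a0 / 2 ^+ m) (b0 / 2 ^+ m)) <= e / 4 ^+ m.
suff : small 0%N (r0, 0) by rewrite /small /= !expr0 !divr1.
apply: contrapT => big0.
pose sub m (q : R * R) (i : bool * bool) :=
  (q.1 + (if i.1 then a0 / 2 ^+ m.+1 else 0), q.2 + (if i.2 then b0 / 2 ^+ m.+1 else 0)).
have halve m (x : R) : x / 2 ^+ m / 2 = x / 2 ^+ m.+1.
  by rewrite exprSr invfM mulrA.
have step m q : exists i, ~ small m q -> ~ small m.+1 (sub m q i).
  apply: contrapT => /forallNP h.
  have h' i : ~ small m q /\ small m.+1 (sub m q i).
    by have /not_implyP [? /contrapT ?] := h i.
  have [bq _] := h' (true, true); apply: bq.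
  have [_ [n1 h1]] := h' (false, false); have [_ [n2 h2]] := h' (true, false).
  have [_ [n3 h3]] := h' (false, true); have [_ [n4 h4]] := h' (true, true).
  rewrite /sub /= in h1 h2 h3 h4.
  exists (n1 + n2 + n3 + n4).+1 => -[//|n]; rewrite ltnS => hn.
  rewrite rect_sumS !halve.
  have -> : e / 4 ^+ m = (e / 4 ^+ m.+1 + e / 4 ^+ m.+1) + (e / 4 ^+ m.+1 + e / 4 ^+ m.+1).
    by rewrite exprS; field; rewrite expf_neq0.
  have := h1 n ltac:(lia); have := h2 n ltac:(lia); have := h3 n ltac:(lia).
  have := h4 n ltac:(lia); rewrite !addr0 => k4 k3 k2 k1.
  apply: le_trans (ND _ _) _; apply: lerD; apply: le_trans (ND _ _) _; exact: lerD.
pose nxt m q := sub m q (projT1 (cid (step m q))).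
pose fix Q m := if m is m'.+1 then nxt m' (Q m') else (r0, 0 : R).
have bigQ m : ~ small m (Q m).
  by elim: m => [|m IH] //=; exact: (projT2 (cid (step m (Q m))) IH).
have pw (x : R) m : 0 < x -> 0 < x / 2 ^+ m by move=> x0; rewrite divr_gt0 ?exprn_gt0.
have nest m : [/\ (Q m).1 <= (Q m.+1).1, (Q m.+1).1 + a0 / 2 ^+ m.+1 <= (Q m).1 + a0 / 2 ^+ m,
    (Q m).2 <= (Q m.+1).2 & (Q m.+1).2 + b0 / 2 ^+ m.+1 <= (Q m).2 + b0 / 2 ^+ m].
  have := pw _ m.+1 a00; have := pw _ m.+1 b00; rewrite -!halve /= /nxt /sub.
  move: (sval _) => [i1 i2]; rewrite -!halve /=.
  move: (a0 / _) (b0 / _) => x y hx hy.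
  by case: i1; case: i2 => /=; split; lra.
have [r hr] : exists y, forall m, (Q m).1 <= y <= (Q m).1 + a0 / 2 ^+ m.
  apply: (nested_intervals (x := fun m => (Q m).1) (w := fun m => a0 / 2 ^+ m)) => m.
  - exact: ltW (pw _ _ _).
  - by have [] := nest m.
  - by have [] := nest m.
have [t ht] : exists y, forall m, (Q m).2 <= y <= (Q m).2 + b0 / 2 ^+ m.
  apply: (nested_intervals (x := fun m => (Q m).2) (w := fun m => b0 / 2 ^+ m)) => m.
  - exact: ltW (pw _ _ _).
  - by have [] := nest m.
  - by have [] := nest m.
pose r1 := r0 + a0; pose L := a0 + r1 * b0.
have r10 : 0 < r1 by rewrite addr_gt0.
have L0 : 0 < L by rewrite addr_gt0// mulr_gt0.
have rr : r0 <= r <= r1 by have := hr 0%N; rewrite /= expr0 divr1.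
have rpos : 0 <= r by case/andP: rr => h _; exact: le_trans (ltW r00) h.
have hz : r0 <= cabs (polar r t) <= r0 + a0 by rewrite cabs_polar ger0_norm.
(* Points of the [m]-th rectangle are within [L / 2^m] of the limit point, and its perimeter is at
   most [2 L / 2^m]. The product of both with this tolerance is [e / 4^m]. *)
have he : 0 < e / (2 * L ^+ 2) by rewrite divr_gt0// mulr_gt0// exprn_gt0.
have [d d0 hd] := dH _ hz _ he.
have [m hm] := exists_pow2_gt (L / d).
have m20 : 0 < 2 ^+ m :> R by rewrite exprn_gt0.
have Lm : L / 2 ^+ m < d by rewrite ltr_pdivrMr// mulrC -ltr_pdivrMr.
apply: (bigQ m); exists 0%N => n _.
pose A := H (polar r t); pose B := H' (polar r t).
pose rem z := H z - (A + (z - polar r t) *: B).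
have -> : H = (fun z => (A + (z - polar r t) *: B) + rem z).
  by apply/funext => z; rewrite subrKC.
rewrite rect_sumD rect_sum_affine add0r.
have am0 : 0 <= a0 / 2 ^+ m by exact: ltW (pw _ _ _).
have bm0 : 0 <= b0 / 2 ^+ m by exact: ltW (pw _ _ _).
have Qm m' : r0 <= (Q m').1 /\ (Q m').1 + a0 / 2 ^+ m' <= r1.
  elim: m' => [|m' [IH1 IH2]]; first by rewrite /= expr0 divr1.
  have [h1 h2 _ _] := nest m'.
  by split; [exact: le_trans IH1 h1|exact: le_trans h2 IH2].
have [Q1 Q2] := Qm m.
have e'0 := ltW he.
apply: le_trans (rect_sum_le (M := e / (2 * L ^+ 2) * (L / 2 ^+ m)) (r1 := r1) _ _ am0 bm0 _ Q2 _) _.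
- exact: le_trans (ltW r00) Q1.
- by apply: mulr_ge0 => //; rewrite divr_ge0// ltW.
- move=> u s hu hs'.
  have near : cabs (polar u s - polar r t) <= L / 2 ^+ m.
    apply: le_trans (polar_sub _ _ _ _) _.
    rewrite /L mulrDl -mulrA; apply: lerD.
      exact: norm_le_interval hu (hr m).
    apply: ler_pM => //; first by rewrite ger0_norm//; case/andP: rr.
    exact: norm_le_interval hs' (ht m).
  rewrite /rem opprD addrA; apply: le_trans (hd _ (le_lt_trans near Lm)) _.
  exact: ler_wpM2l.
rewrite mulrA -mulrDl -/L le_eqVlt; apply/orP; left; apply/eqP.
have -> : 4 ^+ m = 2 ^+ m * 2 ^+ m :> R by rewrite -exprMn -natrM.
by field; rewrite !gt_eqF.
Qed.


(** Cauchy's estimate divides twice by [z], hence this quotient rule. The remainder splits into that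
    of [H] and two terms of second order in [w - z]; [|w - z| < |z| / 2] keeps [w] away from 0. *)
Lemma differentiable_for_divz H z (H' : V) : z != 0 -> differentiable_for N H z H' ->
  differentiable_for N (fun w => w^-1 *: H w) z (z^-1 *: H' - z^-2 *: H z).
Proof.
move=> z0 dH e e0; have cz : 0 < cabs z by rewrite cabs_gt0.
pose A := N H'; pose B := N (H z).
have A0 : 0 <= A by exact: (semi_ge0 ND NZ).
have B0 : 0 <= B by exact: (semi_ge0 ND NZ).
pose k := (cabs z)^-1; have k0 : 0 < k by rewrite invr_gt0.
have e10 : 0 < e / (4 * k) by rewrite divr_gt0// mulr_gt0.
have [d d0 hd] := dH _ e10.
pose C := 2 * k ^+ 2 * A + 2 * k ^+ 3 * B.
have C0 : 0 <= C by rewrite addr_ge0// !mulr_ge0// ?exprn_ge0// ltW.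
have C10 : 0 < C + 1 by lra.
exists (Num.min d (Num.min (cabs z / 2) (e / (2 * (C + 1))))).
  by rewrite !lt_min d0 !divr_gt0// mulr_gt0.
move=> w; rewrite !lt_min => /and3P[wd wz we].
have wlow : cabs z / 2 <= cabs w.
  have := cabsD w (z - w); rewrite addrC subrK cabs_distC; lra.
have w0 : w != 0 by rewrite -cabs_gt0; lra.
have iw : cabs w^-1 <= 2 * k.
  rewrite cabsV /k -[2]invrK -invfM lef_pV2 ?posrE; lra.
rewrite (_ : _ - _ - _ = w^-1 *: (H w - H z - (w - z) *: H') +
    (- (w - z) ^+ 2 * w^-1 * z^-1) *: H' + ((w - z) ^+ 2 * w^-1 * z^-2) *: H z); last first.
  have -> : - (w - z) ^+ 2 * w^-1 * z^-1 = w^-1 * (w - z) - (w - z) * z^-1.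
    by field; rewrite w0 z0.
  have -> : (w - z) ^+ 2 * w^-1 * z^-2 = w^-1 - z^-1 + (w - z) * z^-2.
    by field; rewrite w0 z0.
  rewrite !scalerBr !scalerA; move: (w^-1 * (w - z)) ((w - z) * z^-1) ((w - z) * z^-2).
  move=> c1 c2 c3; rewrite !scalerDl !scaleNr.
  move: (w^-1 *: H w) (z^-1 *: H z) (c2 *: H') (c3 *: H z) (w^-1 *: H z) (c1 *: H').
  by move=> x1 x2 x3 x4 x5 x6; abel.
set x := cabs (w - z) in wd wz we *.
have x0 : 0 <= x by exact: cabs_ge0.
have t1 : N (w^-1 *: (H w - H z - (w - z) *: H')) <= e / 2 * x.
  rewrite NZ (_ : e / 2 * x = (2 * k) * (e / (4 * k) * x)); last by field; rewrite gt_eqF.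
  by apply: ler_pM => //; [exact: cabs_ge0|exact: (semi_ge0 ND NZ)|exact: hd].
have t2 : N ((- (w - z) ^+ 2 * w^-1 * z^-1) *: H') <= x * (2 * k ^+ 2 * A) * x.
  rewrite NZ !cabsM cabsN cabsX -/x (_ : _ * x = x ^+ 2 * (2 * k) * k * A); last by ring.
  apply: ler_wpM2r => //; apply: ler_pM; rewrite ?mulr_ge0 ?cabs_ge0 ?exprn_ge0//.
    by apply: ler_wpM2l; rewrite ?exprn_ge0.
  by rewrite cabsV.
have t3 : N (((w - z) ^+ 2 * w^-1 * z^-2) *: H z) <= x * (2 * k ^+ 3 * B) * x.
  rewrite NZ (cabsM _ (z^-2)) (cabsM _ w^-1) cabsX -/x (_ : _ * x = x ^+ 2 * (2 * k) * k ^+ 2 * B); last by ring.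
  apply: ler_wpM2r => //; apply: ler_pM; rewrite ?mulr_ge0 ?cabs_ge0 ?exprn_ge0//.
    by apply: ler_wpM2l; rewrite ?exprn_ge0.
  by rewrite cabsV cabsX /k exprVn.
apply: le_trans (ND _ _) _; apply: le_trans (lerD (le_trans (ND _ _) (lerD t1 t2)) t3) _.
have xC : x * C <= e / 2.
  apply: (@le_trans _ _ (e / (2 * (C + 1)) * (C + 1))).
    by apply: ler_pM => //; [rewrite ltW|lra].
  by rewrite le_eqVlt; apply/orP; left; apply/eqP; field; rewrite gt_eqF.
have := ler_wpM2r x0 xC; rewrite /C mulrDr mulrDl; lra.
Qed.

End cauchy.

Section cauchy_estimate.
Variables (R : realType) (V : lmodType R[i]) (N : V -> R).
Hypothesis ND : forall u v, N (u + v) <= N u + N v.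
Hypothesis NZ : forall c v, N (c *: v) = cabs c * N v.

(** A chord from [z] to [w] on the circle contributes [(w - z) (1/z + 1/w) / 2 = (w/z - z/w) / 2],
    which is [i] times the sine of the angle between them. For a full turn this exact value takes
    the place of [2 pi i]. *)
Lemma edge_sum_inv (A : V) n (r a v : R) : 0 < r ->
  edge_sum (fun z => z^-1 *: A) n (polar r) a v =
  ('i%C * (2 ^+ n * sin (v / 2 ^+ n))%:C%C) *: A.
Proof.
move=> r0; elim: n a v => [|n IH] a v /=.
  rewrite -scalerDl scalerA expr0 divr1 mul1r; congr (_ *: A).
  have rc : r%:C%C != 0 by rewrite -cabs_gt0 cabs_real gtr0_norm.
  rewrite /polar expiD.
  have -> : 'i%C * (sin v)%:C%C = (expi v - (expi v)^-1) / 2.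
    apply: (canRL (mulfK _)); first by rewrite pnatr_eq0.
    rewrite mulr_natr mulr2n -expiN /expi cosN sinN; apply/eqP; rewrite eq_complex /=.
    by apply/andP; split; apply/eqP; ring.
  have e1 := expi_neq0 a; have e2 := expi_neq0 v.
  move: (expi a) (expi v) (r%:C%C) e1 e2 rc => x y s x0 y0 s0.
  by field; rewrite x0 y0 s0.
rewrite !IH -scalerDl -mulrDr -rmorphD; congr (('i%C * _%:C%C) *: A).
have -> : v / 2 / 2 ^+ n = v / 2 ^+ n.+1 by rewrite exprS invfM mulrA.
by rewrite exprS; ring.
Qed.

(** By the duplication formula the left multiples of the sine increase with [n] from the value 4 at
    [n = 0]; so 4 stands in for their limit [2 pi]. *)
Lemma sin_dyadic_ge n : 4 <= 2 ^+ n.+2 * sin (pi *+ 2 / 2 ^+ n.+2) :> R.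
Proof.
elim: n => [|n IH].
  have -> : pi *+ 2 / 2 ^+ 2 = pi / 2 :> R by rewrite expr2 -mulr_natr; field.
  by rewrite sin_pihalf mulr1 expr2; lra.
apply: (le_trans IH); set y := pi *+ 2 / 2 ^+ n.+3.
have -> : pi *+ 2 / 2 ^+ n.+2 = y *+ 2.
  rewrite -[RHS]mulr_natr /y (exprS _ n.+2); move: (pi *+ 2) => b.
  by field; rewrite expf_neq0.
have p0 := @pi_gt0 R.
have y0 : 0 <= y by rewrite divr_ge0 ?exprn_ge0// mulrn_wge0// ltW.
have ypi : y <= pi.
  rewrite ler_pdivrMr ?exprn_gt0// -[leLHS]mulr_natr; apply: ler_wpM2l; first exact: ltW.
  by rewrite exprS ler_pMr// exprn_ege1// ler1n.
have s0 : 0 <= sin y by apply: sin_ge0_pi; rewrite y0.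
rewrite sin_mulr2n [in leRHS]exprS -(mulr_natr (cos y * sin y)).
have c1 := cos_le1 y; have q0 : 0 <= 2 ^+ n.+2 :> R by rewrite exprn_ge0.
have -> : 2 ^+ n.+2 * (cos y * sin y * 2) = (2 * 2 ^+ n.+2 * sin y) * cos y by ring.
by apply: ler_piMr => //; apply: mulr_ge0.
Qed.

(** [H = (F - F 0) / z^2] has the same sums over a small and over the large circle, up to a small
    error. Near 0 it is close to [F' 0 / z], so the small circle yields at least [4 N (F' 0)]; the
    large one yields at most [2 pi rho] times [2 M / rho^2]. With [pi <= 4] the quotient gives the
    constant 4. *)
Lemma cauchy_estimate (F : R[i] -> V) (F' : R[i] -> V) (rho M : R) : 0 < rho ->
  (forall z, cabs z <= rho -> differentiable_for N F z (F' z)) ->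
  (forall z, cabs z <= rho -> N (F z) <= M) ->
  N (F' 0) <= 4 * M / rho.
Proof.
move=> rho0 dF hM.
have M0 : 0 <= M.
  by apply: le_trans (semi_ge0 ND NZ (F 0)) (hM _ _); rewrite cabs0 ltW.
pose G z := F z - F 0.
have dG z : cabs z <= rho -> differentiable_for N G z (F' z).
  move=> hz e e0; have [d d0 hd] := dF z hz e e0; exists d => // w hw.
  rewrite (_ : G w - G z = F w - F z); first exact: hd.
  by rewrite /G opprB addrA subrK.
pose H z := z^-1 *: (z^-1 *: G z).
have dH z : z != 0 -> cabs z <= rho -> exists H', differentiable_for N H z H'.
  move=> z0 hz; eexists; apply: (differentiable_for_divz ND NZ z0).
  exact: (differentiable_for_divz ND NZ z0 (dG z hz)).
(* One [e] is the Goursat error; [2 pi e <= 8 e] is the error of the linear approximation on the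
   small circle. *)
suff key e : 0 < e -> 4 * N (F' 0) <= 4 * (4 * M / rho) + 9 * e.
  apply/ler_addgt0Pr => e e0; have := key (4 / 9 * e) ltac:(lra).
  by move: (4 * M / rho) (N _) => a b; lra.
move=> e0; have p0 := @pi_gt0 R; have p2 := @pihalf_lt2 R.
have pi4 : (pi : R) <= 4 by lra.
have c00 : cabs (0 : R[i]) <= rho by rewrite cabs0 ltW.
have [d d0 hd] := dF 0 c00 e e0.
pose r0 := Num.min (d / 2) (rho / 2).
have r00 : 0 < r0 by rewrite lt_min !divr_gt0.
have r0d : r0 < d by rewrite gt_min; apply/orP; left; lra.
have r0rho : r0 < rho by rewrite gt_min; apply/orP; right; lra.
have a00 : 0 < rho - r0 by lra.
pose H' z := if pselect (exists h, differentiable_for N H z h) is left h then projT1 (cid h) else 0.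
have dH' z : r0 <= cabs z <= r0 + (rho - r0) -> differentiable_for N H z (H' z).
  rewrite subrKC => /andP[h1 h2]; rewrite /H'; case: pselect => [h|[]].
    exact: projT2 (cid h).
  by apply: dH => //; rewrite -cabs_gt0; exact: lt_le_trans r00 h1.
have [n0 hn0] := rect_sum_small ND NZ r00 a00 dH' e0.
(* The two added levels are those that [sin_dyadic_ge] requires. *)
have := hn0 (n0 + 2)%N (leq_addr _ _).
rewrite addn2; set n := n0.+2; rewrite /rect_sum add0r subrKC.
(* After a full turn both radial edges are the same, and they cancel. *)
rewrite (_ : (fun u => polar u (pi *+ 2)) = (fun u => polar u 0)); last first.
  by apply/funext => u; rewrite /polar -[pi *+ 2]add0r expiD2pi.
set E0 := edge_sum H n (fun u => polar u 0) _ _; set E1 := edge_sum H n (polar rho) _ _.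
rewrite (_ : E0 + E1 - E0 - _ = E1 - edge_sum H n (polar r0) 0 (pi *+ 2)); last first.
  by rewrite [E0 + E1]addrC addrK.
move=> hE.
have pi20 : 0 <= pi *+ 2 :> R by rewrite mulrn_wge0// ltW.
have nz r t : 0 < r -> polar r t != 0 :> R[i].
  by move=> hr; rewrite -cabs_gt0 cabs_polar gtr0_norm.
have lip r (s t : R) : 0 < r -> s <= t -> cabs (polar r t - polar r s) <= r * (t - s).
  move=> hr st; apply: le_trans (polar_sub _ _ _ _) _.
  by rewrite subrr normr0 add0r gtr0_norm// ger0_norm// subr_ge0.
have hE1 : N E1 <= 2 * M / rho ^+ 2 * rho * (pi *+ 2).
  apply: (edge_sum_le ND NZ) => //; first exact: ltW.
  - by apply: divr_ge0; [exact: mulr_ge0|exact: sqr_ge0].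
  - by move=> s t _ st _; exact: lip.
  - move=> t _; rewrite /H !NZ cabsV cabs_polar gtr0_norm// mulrA -invfM -expr2 mulrC.
    rewrite ler_pM2r ?invr_gt0 ?exprn_gt0//; apply: le_trans (semiB ND NZ _ _) _.
    rewrite mulr_natl mulr2n; apply: lerD; apply: hM => //.
    by rewrite cabs_polar gtr0_norm.
pose A := F' 0; pose rem z := H z - z^-1 *: A.
have hrem : N (edge_sum rem n (polar r0) 0 (pi *+ 2)) <= e / r0 * r0 * (pi *+ 2).
  apply: (edge_sum_le ND NZ) => //; first exact: ltW.
  - by rewrite divr_ge0 ?ltW.
  - by move=> s t _ st _; exact: lip.
  - move=> t _; set z := polar r0 t; have z0 : z != 0 by exact: nz.
    have cz : cabs z = r0 by rewrite cabs_polar gtr0_norm.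
    rewrite /rem /H (_ : _ - _ = z^-1 *: (z^-1 *: (F z - F 0 - (z - 0) *: A))); last first.
      rewrite subr0 -scalerBr; congr (_ *: _).
      by rewrite [RHS]scalerBr scalerA mulVf// scale1r.
    rewrite !NZ cabsV cz mulrA.
    apply: (@le_trans _ _ (r0^-1 * r0^-1 * (e * r0))).
      apply: ler_wpM2l; first by rewrite mulr_ge0// invr_ge0 ltW.
      by have := hd z; rewrite subr0 cz; apply.
    by rewrite le_eqVlt; apply/orP; left; apply/eqP; field; rewrite gt_eqF.
have hsum : edge_sum H n (polar r0) 0 (pi *+ 2) =
    ('i%C * (2 ^+ n * sin (pi *+ 2 / 2 ^+ n))%:C%C) *: A +
    edge_sum rem n (polar r0) 0 (pi *+ 2).
  rewrite -(edge_sum_inv A n 0 (pi *+ 2) r00) -edge_sumD; congr edge_sum.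
  by apply/funext => z; rewrite subrKC.
have hlow : 4 * N A <= N (('i%C * (2 ^+ n * sin (pi *+ 2 / 2 ^+ n))%:C%C) *: A).
  rewrite NZ cabsM cabs_i mul1r cabs_real; apply: ler_wpM2r; first exact: (semi_ge0 ND NZ).
  by apply: le_trans (ler_norm _); exact: sin_dyadic_ge.
apply: le_trans hlow _.
rewrite (_ : _ *: A = E1 - (E1 - edge_sum H n (polar r0) 0 (pi *+ 2)) -
    edge_sum rem n (polar r0) 0 (pi *+ 2)); last first.
  by rewrite subKr hsum addrK.
apply: le_trans (semiB ND NZ _ _) _.
apply: le_trans (lerD (le_trans (semiB ND NZ _ _) (lerD hE1 hE)) hrem) _.
have -> : 2 * M / rho ^+ 2 * rho * (pi *+ 2) = 4 * (pi * M / rho).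
  by rewrite -(mulr_natr pi); field; rewrite gt_eqF.
have -> : e / r0 * r0 * (pi *+ 2) = 2 * (pi * e).
  by rewrite -(mulr_natr pi); field; rewrite gt_eqF.
have h1 : pi * M / rho <= 4 * M / rho.
  by rewrite ler_pM2r ?invr_gt0//; exact: ler_wpM2r.
have h2 : pi * e <= 4 * e by apply: ler_wpM2r => //; exact: ltW.
by move: h1 h2; move: (pi * M / rho) (4 * M / rho) (pi * e) => a b c; lra.
Qed.

(** If [f] moved by more than [C + e] times the length of an interval, it would do so on one of the
    halves, and so on down to a point where differentiability contradicts it. *)
Lemma mean_value_inequality (f : R -> V) (C : R) :
  (forall u, 0 <= u <= 1 -> exists2 f', N f' <= C & forall e, 0 < e -> exists2 d, 0 < d &
     forall s, 0 <= s <= 1 -> `|s - u| < d ->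
     N (f s - f u - (s - u)%:C%C *: f') <= e * `|s - u|) ->
  N (f 1 - f 0) <= C.
Proof.
move=> df; apply/ler_addgt0Pr => e e0.
pose w m : R := (2 ^+ m)^-1.
have w0 m : 0 < w m by rewrite invr_gt0 exprn_gt0.
have wS m : w m = w m.+1 + w m.+1 by rewrite /w exprS invfM; field; rewrite expf_neq0.
pose good m x := N (f (x + w m) - f x) <= (C + e) * w m.
suff : good 0%N 0 by rewrite /good /w expr0 invr1 add0r mulr1.
apply: contrapT => bad0.
have step m x : exists i : bool, ~ good m x -> ~ good m.+1 (x + (if i then w m.+1 else 0)).
  apply: contrapT => /forallNP h.
  have h' i : ~ good m x /\ good m.+1 (x + (if i then w m.+1 else 0)).
    by have /not_implyP [? /contrapT ?] := h i.
  have [b _] := h' true; apply: b.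
  have [_] := h' true; have [_] := h' false; rewrite addr0 /good => g1 g2.
  rewrite wS addrA mulrDr.
  rewrite (_ : _ - f x = (f (x + w m.+1 + w m.+1) - f (x + w m.+1)) + (f (x + w m.+1) - f x)).
    by apply: le_trans (ND _ _) _; exact: lerD.
  by rewrite addrA subrK.
have [nb hnb] : exists nb : nat -> R -> bool, forall m x,
    ~ good m x -> ~ good m.+1 (x + (if nb m x then w m.+1 else 0)).
  by exists (fun m x => projT1 (cid (step m x))) => m x; exact: projT2 (cid (step m x)).
pose nxt m x := x + (if nb m x then w m.+1 else 0).
pose fix Q m : R := if m is m'.+1 then nxt m' (Q m') else 0.
have badQ m : ~ good m (Q m).
  by elim: m => [|m IH] //=; exact: hnb IH.
have [y hy] : exists y, forall m, Q m <= y <= Q m + w m.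
  apply: (nested_intervals (fun m => ltW (w0 m))) => m /=; rewrite /nxt.
    by case: ifP => _; rewrite ?addr0// lerDl ltW.
  move: (nb _ _) => b; rewrite (wS m); case: b; rewrite ?addr0 ?addrA//.
  by rewrite lerDl ltW.
have Q01 m : 0 <= Q m /\ Q m + w m <= 1.
  elim: m => [|m [IH1 IH2]] /=; first by rewrite /w expr0 invr1 add0r.
  rewrite /nxt; move: (nb _ _) (w0 m.+1) IH1 IH2 => b; rewrite (wS m).
  by move: (w m.+1) (Q m) => a q ? ? ?; case: b; split; lra.
have y01 : 0 <= y <= 1 by have := hy 0%N; rewrite /w /= expr0 invr1 add0r.
have [f' hf' dy] := df y y01; have [d d0 hd] := dy e e0.
have [m hm] := exists_pow2_gt d^-1.
have wd : w m < d by rewrite /w invf_plt ?posrE ?exprn_gt0.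
have [/andP[yl yr] [q0 q1]] := (hy m, Q01 m).
apply: (badQ m); rewrite /good.
have half s : 0 <= s <= 1 -> `|s - y| < d -> N (f s - f y) <= (C + e) * `|s - y|.
  move=> hs sd; rewrite -[f s - f y](subrK ((s - y)%:C%C *: f')).
  apply: le_trans (ND _ _) _; rewrite mulrDl addrC; apply: lerD; last exact: hd.
  by rewrite NZ cabs_real mulrC; apply: ler_wpM2r.
rewrite -(subrKA (f y)); apply: le_trans (ND _ _) _; rewrite [N (f y - _)](semi_distC NZ).
have e1 : `|Q m + w m - y| = Q m + w m - y by rewrite ger0_norm// subr_ge0.
have e2 : `|Q m - y| = y - Q m by rewrite distrC ger0_norm// subr_ge0.
have h1 : N (f (Q m + w m) - f y) <= (C + e) * (Q m + w m - y).
  rewrite -[X in _ * X]e1; apply: half; last by rewrite e1; lra.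
  by rewrite q1 andbT; have := w0 m; lra.
have h2 : N (f (Q m) - f y) <= (C + e) * (y - Q m).
  rewrite -[X in _ * X]e2; apply: half; last by rewrite e2; lra.
  by rewrite q0/=; have := w0 m; lra.
have -> : (C + e) * w m = (C + e) * (Q m + w m - y) + (C + e) * (y - Q m) by ring.
exact: lerD.
Qed.

End cauchy_estimate.

(** * The necessity of the R-bound condition *)

(** Differentiability in each coordinate gives it for [rad_norm], with a radius that depends on the
    tuple; the constants in Cauchy's estimate and in the mean value inequality do not see this
    radius. The distance is a parameter so as to serve both complex and real variables. *)
Lemma rad_norm_eps (R : realType) (X : normedModType R[i]) (p : R) (U : Type)
    (dist : U -> R) n (g : 'I_n -> U -> X) : 1 <= p -> (forall w, 0 <= dist w) ->
  (forall k e, 0 < e -> exists2 d, 0 < d &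
     forall w, dist w < d -> rnorm (g k w) <= e * dist w) ->
  forall e, 0 < e -> exists2 d, 0 < d &
     forall w, dist w < d -> rad_norm p (fun k => g k w) <= e * dist w.
Proof.
move=> p1 dist0 h e e0.
have e'0 : 0 < e / n.+1%:R by rewrite divr_gt0.
pose d k := s2val (cid2 (h k _ e'0)).
have d0 k : 0 < d k by exact: (s2valP (cid2 (h k _ e'0))).
have hd k : forall w, dist w < d k -> rnorm (g k w) <= e / n.+1%:R * dist w.
  exact: (s2valP' (cid2 (h k _ e'0))).
exists (\big[Num.min/1]_k d k); first by apply: lt_bigmin => // k _; exact: d0.
move=> w /bigmin_gtP[_ hw].
apply: le_trans (rad_norm_le_sum p1 _) _.
apply: (@le_trans _ _ (\sum_(k < n) (e / n.+1%:R * dist w))).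
  by apply: ler_sum => k _; apply: hd; exact: hw.
rewrite sumr_const card_ord -[leLHS]mulr_natr mulrAC; apply: ler_wpM2r => //.
by rewrite -mulrA ger_pMr// mulrC ler_pdivrMr ?ltr0n// mul1r ler_nat.
Qed.

(** * Bounded operators, sectors and holomorphy *)

Section bounded_operators.
Variables (R : realType) (X : normedModType R[i]).
Implicit Types (S L : X -> X) (x y : X).

Lemma bounded_operator_ge0 S : bounded_operator S ->
  exists2 M, 0 <= M & forall x, rnorm (S x) <= M * rnorm x.
Proof.
move=> [_ [M hM]]; exists (Num.max M 0); first by rewrite le_max lexx orbT.
by move=> x; apply: le_trans (hM x) _; apply: ler_wpM2r; rewrite ?rnorm_ge0// le_max lexx.
Qed.

Lemma linear_fun0 S : linear S -> S 0 = 0.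
Proof. by move=> h; have := h (-1) 0 0; rewrite scaler0 addr0 scaleN1r addNr. Qed.

Lemma linear_funD S x y : linear S -> S (x + y) = S x + S y.
Proof. by move=> h; have := h 1 x y; rewrite !scale1r. Qed.

Lemma linear_funZ S (c : R[i]) x : linear S -> S (c *: x) = c *: S x.
Proof. by move=> h; have := h c x 0; rewrite (linear_fun0 h) !addr0. Qed.

Lemma linear_funB S x y : linear S -> S (x - y) = S x - S y.
Proof. by move=> h; rewrite (linear_funD _ _ h) -scaleN1r (linear_funZ _ _ h) scaleN1r. Qed.

Lemma linear_fun_sum S : linear S ->
  forall (I : Type) (s : seq I) (P : pred I) (F : I -> X),
  S (\sum_(i <- s | P i) F i) = \sum_(i <- s | P i) S (F i).
Proof.
move=> h I s P F; elim: s => [|i s IH]; first by rewrite !big_nil (linear_fun0 h).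
by rewrite !big_cons; case: ifP => _; rewrite ?(linear_funD _ _ h) IH.
Qed.

Lemma bounded_operator_comb (a b : R[i]) S L : bounded_operator S -> bounded_operator L ->
  bounded_operator (fun x => a *: S x + b *: L x).
Proof.
move=> bS bL; have [hS _] := bS; have [hL _] := bL; split.
  move=> c u v; rewrite hS hL !scalerDr !scalerA (mulrC c a) (mulrC c b).
  by rewrite addrACA.
have [M1 M10 h1] := bounded_operator_ge0 bS; have [M2 M20 h2] := bounded_operator_ge0 bL.
exists (cabs a * M1 + cabs b * M2) => x; apply: le_trans (rnormD _ _) _.
by rewrite mulrDl -!mulrA !rnormZ; apply: lerD; apply: ler_wpM2l; rewrite ?cabs_ge0.
Qed.

Lemma operator_norm_ub S x : bounded_operator S -> rnorm (S x) <= operator_norm S * rnorm x.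
Proof.
move=> bS; have [hS _] := bS; have [M M0 hM] := bounded_operator_ge0 bS.
have [->|x0] := eqVneq x 0; first by rewrite (linear_fun0 hS) rnorm0 mulr0.
have rx : 0 < rnorm x by rewrite lt_neqAle eq_sym rnorm_eq0 x0 rnorm_ge0.
rewrite -ler_pdivrMr//; apply: ub_le_sup.
  exists M => _ [y /= y1 <-]; apply: le_trans (hM y) _.
  by rewrite -[leRHS]mulr1; exact: ler_wpM2l.
exists ((rnorm x)^-1%:C%C *: x) => /=.
  by rewrite rnormZ cabs_real ger0_norm ?invr_ge0 ?(ltW rx)// mulVf ?gt_eqF.
by rewrite (linear_funZ _ _ hS) rnormZ cabs_real ger0_norm ?invr_ge0 ?(ltW rx)// mulrC.
Qed.

Lemma operator_norm_le S (C : R) : (forall x, rnorm (S x) <= C * rnorm x) ->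
  0 <= C -> 0 <= operator_norm S <= C.
Proof.
move=> hS C0; have ub : ubound [set rnorm (S x) | x in [set x : X | rnorm x <= 1]] C.
  move=> _ [y /= y1 <-]; apply: le_trans (hS y) _.
  by rewrite -[leRHS]mulr1; exact: ler_wpM2l.
have S0 : [set rnorm (S x) | x in [set x : X | rnorm x <= 1]] (rnorm (S 0)).
  by exists 0 => //=; rewrite rnorm0.
apply/andP; split; last by apply: ge_sup => //; exists (rnorm (S 0)).
by apply: le_trans (rnorm_ge0 (S 0)) _; apply: ub_le_sup => //; exists C.
Qed.

End bounded_operators.

Section sector.
Variable R : realType.
Implicit Types (a b x : R).

(** The argument of [a + ib] with [a > 0] is [atan (b / a)], so a slope of at most [tan d] with
    [d < delta] is enough. *)
Lemma sector_cone (delta : R) : 0 < delta -> exists2 kappa : R, 0 < kappa <= 1 &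
  forall a b, 0 < a -> `|b| <= kappa * a -> sector delta (a +i* b)%C.
Proof.
move=> delta0; have p2 := @pihalf_ge1 R; have p0 := @pi_gt0 R.
pose d := Num.min (delta / 2) (1 / 2).
have d0 : 0 < d by rewrite lt_min !divr_gt0.
have d1 : d < pi / 2 by rewrite gt_min; apply/orP; right; lra.
have dd : d < delta by rewrite gt_min; apply/orP; left; lra.
have td0 : 0 < tan d.
  by rewrite -tan0 ltr_tan// in_itv/= ?d1 ?andbT; lra.
exists (Num.min (tan d) 1); first by rewrite lt_min td0 ltr01 ge_min lexx orbT.
move=> a b a0 hb; set x := b / a.
have hx : `|x| <= tan d.
  rewrite normrM normfV (gtr0_norm a0) ler_pdivrMr//; apply: le_trans hb _.
  by rewrite ler_pM2r// ge_min lexx.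
have atand : `|atan x| <= d.
  have tK : atan (tan d) = d by rewrite tanK// in_itv/= d1 andbT; lra.
  have tKN : atan (- tan d) = - d by rewrite atanN tK.
  move: hx; rewrite !ler_norml => /andP[h1 h2]; apply/andP; split.
    by rewrite -tKN; exact: le_atan.
  by rewrite -tK; exact: le_atan.
split.
  by rewrite eq_complex /= negb_and gt_eqF.
exists (atan x); last exact: le_lt_trans atand dd.
split.
  by have := atan_gtNpi2 x; have := atan_ltpi2 x; move: (atan x) => y ? ?; apply/andP; split; lra.
have cp : 0 < cos (atan x) by rewrite cos_gt0_pihalf// atan_gtNpi2 atan_ltpi2.
have sE : sin (atan x) = x * cos (atan x).
  by rewrite -{2}(atanK x) /tan divfK// gt_eqF.
have sq0 : 0 < 1 + x ^+ 2 by rewrite ltr_wpDr// sqr_ge0.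
have nE : `|(a +i* b)%C| = (a * Num.sqrt (1 + x ^+ 2))%:C%C.
  rewrite normc_cabs cabsE; congr (_%:C%C).
  rewrite -{2}(gtr0_norm a0) -sqrtr_sqr -sqrtrM ?sqr_ge0//; congr Num.sqrt.
  by rewrite /x; field; rewrite gt_eqF.
rewrite nE sE cos_atan; set s := Num.sqrt _.
have s0 : s != 0 by rewrite gt_eqF// sqrtr_gt0.
apply/eqP; rewrite eq_complex /= !mul0r subr0 addr0; apply/andP; split; apply/eqP.
  by rewrite -mulrA divff// mulr1.
by rewrite /x; field; rewrite s0 gt_eqF.
Qed.

End sector.

Section holomorphic.
Variables (R : realType) (X : normedModType R[i]).

Lemma near_punctured (z : R[i]) (P : R[i] -> Prop) :
  (\forall w \near (z : R[i]^o)^', P w) <->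
  exists2 d : R, 0 < d & forall w, w != z -> cabs (w - z) < d -> P w.
Proof.
split.
  move=> /nbhs_ballP[e /= e0 he].
  have eE : e = (complex.Re e)%:C%C by rewrite RRe_real// gtr0_real.
  exists (complex.Re e) => [|w wz hw]; first by rewrite -ltcR -eE.
  apply: he => //; rewrite /ball/= /ball_/= eE distrC normc_cabs.
  by rewrite ltcR.
move=> [d d0 hd]; apply/nbhs_ballP; exists d%:C%C; first by rewrite /= ltcR.
move=> w; rewrite /ball/= /ball_/= distrC normc_cabs ltcR => hw wz.
exact: hd.
Qed.

(** Differentiability in norm gives differentiability on each vector. A whole disc inside [D] is
    required because [operator_norm] bounds the difference quotient only when [S w] is a bounded
    operator. *)
Lemma holomorphic_differentiable (D : set R[i]) (S : R[i] -> X -> X) (z : R[i]) (r : R) :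
  holomorphic_operators D S -> 0 < r -> (forall w, cabs (w - z) < r -> D w) ->
  exists2 S' : X -> X, bounded_operator S' &
    forall x, differentiable_for (@rnorm R X) (fun w => S w x) z (S' x).
Proof.
move=> hol r0 hr.
have Dz : D z by apply: hr; rewrite subrr cabs0.
have [bSz [S' bS' hS']] := hol z Dz; exists S' => // x e e0.
pose e' := e / (rnorm x + 1).
have x1 : 0 < rnorm x + 1 by rewrite ltr_wpDl// rnorm_ge0.
have e'0 : 0 < e' by rewrite divr_gt0.
have near0 : \forall w \near (z : R[i]^o)^',
    `|0 - operator_norm (fun x => (w - z)^-1 *: (S w x - S z x) - S' x)| < e'.
  by move/cvgrPdist_lt : hS'; exact.
have [d d0 hd] := (near_punctured _ _).1 near0.
exists (Num.min d r); first by rewrite lt_min d0.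
move=> w; rewrite lt_min => /andP[wd wr].
have [->|wz] := eqVneq w z.
  by rewrite !subrr scale0r subr0 rnorm0 cabs0 mulr0.
have [bSw _] := hol w (hr w wr).
pose L := (fun x => (w - z)^-1 *: (S w x - S z x) - S' x).
have bL : bounded_operator L.
  have b1 := bounded_operator_comb (w - z)^-1 (- (w - z)^-1) bSw bSz.
  have b2 := bounded_operator_comb 1 (-1) b1 bS'.
  rewrite (_ : L = (fun y => 1 *: ((w - z)^-1 *: S w y + - (w - z)^-1 *: S z y) + -1 *: S' y))//.
  by apply/funext => y; rewrite scale1r scaleN1r scaleNr -scalerBr.
have hL := operator_norm_ub x bL.
have := hd w wz wd; rewrite sub0r normrN => /ltW/(le_trans (ler_norm _)) hle.
have -> : S w x - S z x - (w - z) *: S' x = (w - z) *: L x.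
  by rewrite /L scalerBr scalerA divff ?subr_eq0// scale1r.
rewrite rnormZ mulrC; apply: ler_wpM2r; first exact: cabs_ge0.
apply: le_trans hL _; apply: (@le_trans _ _ (e' * rnorm x)).
  by apply: ler_wpM2r => //; exact: rnorm_ge0.
rewrite /e' -mulrA ger_pMr// mulrC ler_pdivrMr// mul1r lerDl//.
Qed.

End holomorphic.

Section necessity.
Variables (R : realType) (X : normedModType R[i]) (p : R).
Hypothesis p1 : 1 <= p.
Implicit Type T : R -> X -> X.

(* In the space of [n]-tuples normed by [rad_norm], the curve
   [z |-> (S (t_k (1 + z)) x_k)_k] is holomorphic and bounded in a disc whose radius
   does not depend on the [t_k]: Cauchy's estimate at [0] bounds [t S'(t)]. *)
Lemma R_analytic_increment T : R_analytic p T ->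
  exists C D : R, [/\ 0 <= C, 0 <= D, rbounded p [set t | 0 < t < 1] T C &
    forall n (s h : 'I_n -> R) (x : 'I_n -> X) eta, 0 <= eta ->
      (forall k, [/\ 0 < s k, 0 <= h k <= eta * s k & s k + h k <= 1 / 2]) ->
      rad_norm p (fun k => T (s k + h k) (x k) - T (s k) (x k)) <= eta * D * rad_norm p x].
Proof.
move=> [theta [S [theta0 hol ST [delta /andP[delta0 dtheta] hR]]]].
have [C [C0 _] hC] := rbound_lt hR.
have [kappa /andP[k0 k1] cone] := sector_cone delta0.
have sub z : sector delta z -> sector theta z.
  by move=> [z0 [a za ad]]; split=> //; exists a => //; exact: lt_le_trans ad dtheta.
have tcone (t : R) : 0 < t -> sector delta t%:C%C.
  by move=> t0; apply: cone => //; rewrite normr0 mulr_ge0// ltW.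
have open_cone (a b : R) : 0 < a -> `|b| < kappa * a -> exists2 r : R, 0 < r &
    forall w, cabs (w - (a +i* b)%C) < r -> sector theta w.
  move=> a0 hb; pose r := Num.min (a / 2) ((kappa * a - `|b|) / 4).
  exists r; first by rewrite lt_min !divr_gt0// subr_gt0.
  move=> [u v]; rewrite lt_min => /andP[h1 h2].
  have := Re_le_cabs ((u +i* v)%C - (a +i* b)%C); have := Im_le_cabs ((u +i* v)%C - (a +i* b)%C).
  move: h1 h2; move: (cabs _) => c h1 h2 /= hv hu.
  have hu1 : `|u - a| < a / 2 by exact: le_lt_trans hu h1.
  have hu2 : `|u - a| < (kappa * a - `|b|) / 4 by exact: le_lt_trans hu h2.
  have hv2 : `|v - b| < (kappa * a - `|b|) / 4 by exact: le_lt_trans hv h2.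
  have u0 : 0 < u by move: hu1; rewrite ltr_norml => /andP[? ?]; lra.
  apply/sub/cone => //.
  have vb : `|v| <= `|v - b| + `|b| by rewrite -{1}(subrK b v) ler_normD.
  have ku : kappa * a - `|u - a| <= kappa * u.
    have -> : kappa * u = kappa * a + kappa * (u - a) by ring.
    rewrite lerD2l lerNl -mulrN; apply: le_trans (ler_norm _) _.
    rewrite normrM normrN (gtr0_norm k0); apply: ler_piMl => //.
  by move: vb ku hu2 hv2 hb; move: (kappa * a) (kappa * u) => ? ? ? ? ? ? ?; lra.
have dS z : exists S' : X -> X, forall r : R, 0 < r ->
    (forall w, cabs (w - z) < r -> sector theta w) ->
    forall x, differentiable_for (@rnorm R X) (fun w => S w x) z (S' x).
  have [[r r0 hr]|hn] := pselect (exists2 r : R, 0 < r & forall w, cabs (w - z) < r -> sector theta w).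
    by have [S' _ h] := holomorphic_differentiable hol r0 hr; exists S'.
  by exists id => r r0 hr; exfalso; apply: hn; exists r.
pose S' z := projT1 (cid (dS z)).
have hS' z : forall r : R, 0 < r -> (forall w, cabs (w - z) < r -> sector theta w) ->
    forall x, differentiable_for (@rnorm R X) (fun w => S w x) z (S' z x).
  exact: projT2 (cid (dS z)).
have hdiff (a b : R) x : 0 < a -> `|b| < kappa * a ->
    differentiable_for (@rnorm R X) (fun w => S w x) (a +i* b)%C (S' (a +i* b)%C x).
  by move=> a0 hb; have [r r0 hr] := open_cone a b a0 hb; apply: hS' hr x.
(* For [|z| <= kappa / 4] the point [t (1 + z)] has real part at least [3 t / 4] and imaginary part
   at most [kappa t / 4], so it stays inside the cone; [t <= 1/2] keeps its modulus at most 1. *)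
pose rho := kappa / 4; have rho0 : 0 < rho by rewrite divr_gt0.
pose D := 4 * C / rho.
have D0 : 0 <= D by rewrite divr_ge0 ?mulr_ge0// ltW.
have derivative n (t : 'I_n -> R) (x : 'I_n -> X) : (forall k, 0 < t k <= 1 / 2) ->
    rad_norm p (fun k => (t k)%:C%C *: S' (t k)%:C%C (x k)) <= D * rad_norm p x.
  move=> ht.
  pose N (v : 'I_n -> X) := rad_norm p v.
  have ND u v : N (u + v) <= N u + N v by exact: (rad_normD p1 u v).
  have NZ c v : N (c *: v) = cabs c * N v by exact: (rad_normZ p1 c v).
  pose z_ k z := (t k)%:C%C * (1 + z).
  pose F z : 'I_n -> X := fun k => S (z_ k z) (x k).
  pose F' z : 'I_n -> X := fun k => (t k)%:C%C *: S' (z_ k z) (x k).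
  have hz z k : cabs z <= rho -> exists a b : R, [/\ z_ k z = (a +i* b)%C, 0 < a,
      `|b| < kappa * a & cabs (z_ k z) <= 1].
    move=> hz; have /andP[t0 t2] := ht k; case: z hz => u v hz.
    exists (t k * (1 + u)), (t k * v).
    have := Re_le_cabs (u +i* v)%C; have := Im_le_cabs (u +i* v)%C; rewrite /= => hv hu.
    have hu' : `|u| <= rho by exact: le_trans hu hz.
    have hv' : `|v| <= rho by exact: le_trans hv hz.
    have u4 : - (1 / 4) <= u.
      by move: hu'; rewrite ler_norml /rho => /andP[? ?]; lra.
    split.
    - by rewrite /z_; apply/eqP; rewrite eq_complex /= !(mul0r, subr0, addr0, add0r) !eqxx.
    - by apply: mulr_gt0 => //; lra.
    - rewrite normrM (gtr0_norm t0) mulrCA ltr_pM2l//; apply: le_lt_trans hv' _.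
      by rewrite /rho ltr_pM2l//; lra.
    - rewrite /z_ cabsM cabs_real (gtr0_norm t0).
      apply: (@le_trans _ _ (1 / 2 * (1 + rho))).
        apply: ler_pM => //; rewrite ?cabs_ge0 ?(ltW t0)//.
        by apply: le_trans (cabsD _ _) _; rewrite cabs1 lerD2l.
      by rewrite /rho; lra.
  have dF z : cabs z <= rho -> differentiable_for N F z (F' z).
    move=> hzr e e0.
    have coord k e1 : 0 < e1 -> exists2 d, 0 < d & forall w, cabs (w - z) < d ->
        rnorm (F w k - F z k - (w - z) *: F' z k) <= e1 * cabs (w - z).
      move=> e10; have [a [b [zE a0 hb _]]] := hz z k hzr.
      have /andP[t0 _] := ht k.
      have [d d0 hd] := hdiff a b (x k) a0 hb _ (divr_gt0 e10 t0).
      exists (d / t k) => [|w hw]; first exact: divr_gt0.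
      have := hd (z_ k w); rewrite -zE.
      have -> : z_ k w - z_ k z = (t k)%:C%C * (w - z) by rewrite /z_; ring.
      rewrite cabsM cabs_real (gtr0_norm t0) mulrA divfK ?gt_eqF// => h.
      rewrite /F /F' scalerA [(w - z) * _]mulrC; apply: h.
      by rewrite mulrC -ltr_pdivlMr.
    have [d d0 hd] := rad_norm_eps p1 (fun w => cabs_ge0 (w - z)) coord e0.
    by exists d.
  have hM z : cabs z <= rho -> N (F z) <= C * rad_norm p x.
    move=> hzr; apply: (hC n (fun k => z_ k z) x) => k.
    have [a [b [zE a0 hb z1]]] := hz z k hzr; split.
      by rewrite zE; apply: cone => //; exact: ltW.
    by rewrite /= normc_cabs lecR.
  have hC0 := cauchy_estimate ND NZ rho0 dF hM.
  have e1 : D * rad_norm p x = 4 * (C * rad_norm p x) / rho.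
    by rewrite /D mulrAC !mulrA.
  have e2 : (fun k => (t k)%:C%C *: S' (t k)%:C%C (x k)) = F' 0.
    by apply/funext => k; rewrite /F' /z_ addr0 mulr1.
  by rewrite e1 e2; exact: hC0.
exists C, D; split=> //.
  apply: (rbounded_reindex (g := fun t => t%:C%C)) hC => t.
    move=> /andP[t0 t1]; split; first exact: tcone.
    by rewrite /= normc_cabs cabs_real gtr0_norm// lecR ltW.
  by move=> x /andP[t0 _]; rewrite ST.
move=> n s h x eta eta0 hk.
pose N (v : 'I_n -> X) := rad_norm p v.
have ND u v : N (u + v) <= N u + N v by exact: (rad_normD p1 u v).
have NZ c v : N (c *: v) = cabs c * N v by exact: (rad_normZ p1 c v).
(* All increments are followed along one parameter [u], so that the mean value inequality applies in
   the space of tuples. *)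
pose f (u : R) : 'I_n -> X := fun k => S (s k + u * h k)%:C%C (x k).
have -> : rad_norm p (fun k => T (s k + h k) (x k) - T (s k) (x k)) = N (f 1 - f 0).
  congr rad_norm; apply/funext => k; have [s0 /andP[h0 _] _] := hk k.
  have s1 : 0 < s k + h k by rewrite ltr_wpDr.
  have fE : (f 1 - f 0) k = S (s k + 1 * h k)%:C%C (x k) - S (s k + 0 * h k)%:C%C (x k) by [].
  by rewrite fE mul1r mul0r addr0 !ST.
apply: (mean_value_inequality ND NZ) => u /andP[u0 u1].
pose t k := s k + u * h k.
have tk k : 0 < t k <= 1 / 2.
  have [s0 /andP[h0 _] sh] := hk k; rewrite /t.
  have uh0 : 0 <= u * h k by exact: mulr_ge0.
  have uh1 : u * h k <= h k by exact: ler_piMl.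
  by move: (u * h k) uh0 uh1 => y ? ?; apply/andP; split; lra.
exists (fun k => (h k)%:C%C *: S' (t k)%:C%C (x k)).
  have -> : N (fun k => (h k)%:C%C *: S' (t k)%:C%C (x k)) =
      rad_norm p (fun k => (h k / t k)%:C%C *: ((t k)%:C%C *: S' (t k)%:C%C (x k))).
    congr rad_norm; apply/funext => k; have /andP[t0 _] := tk k.
    by rewrite scalerA -rmorphM/= divfK// gt_eqF.
  (* As [t >= s], one has [h / t <= eta]: the contraction principle turns the bound on [t S'(t)]
     into the gain [eta]. *)
  apply: le_trans (rad_norm_real_contraction p1 _ eta0 _) _.
    move=> k; have /andP[t0 _] := tk k; have [s0 /andP[h0 h1] _] := hk k.
    have hq : 0 <= h k / t k by rewrite divr_ge0// ltW.
    rewrite (ger0_norm hq) ler_pdivrMr//; apply: le_trans h1 _.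
    by apply: ler_wpM2l => //; rewrite /t lerDl mulr_ge0.
  by rewrite -mulrA; apply: ler_wpM2l => //; exact: derivative.
move=> e e0.
have coord k e1 : 0 < e1 -> exists2 d, 0 < d & forall v, `|v - u| < d ->
    rnorm (f v k - f u k - (v - u)%:C%C *: ((h k)%:C%C *: S' (t k)%:C%C (x k)))
    <= e1 * `|v - u|.
  move=> e10; have /andP[t0 _] := tk k; have [s0 /andP[h0 _] _] := hk k.
  have h10 : 0 < h k + 1 by rewrite ltr_wpDl.
  have k0' : `|0 : R| < kappa * t k by rewrite normr0 mulr_gt0.
  have [d d0 hd] := hdiff (t k) 0 (x k) t0 k0' _ (divr_gt0 e10 h10).
  exists (d / (h k + 1)) => [|v hv]; first exact: divr_gt0.
  have := hd (s k + v * h k)%:C%C.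
  have -> : (s k + v * h k)%:C%C - (t k +i* 0)%C = (v - u)%:C%C * (h k)%:C%C :> R[i].
    by rewrite -[(t k +i* 0)%C]/((t k)%:C%C) -rmorphB -rmorphM/=; congr (_%:C%C); rewrite /t; ring.
  rewrite cabsM !cabs_real (ger0_norm h0) scalerA => hh.
  apply: le_trans (hh _) _.
    apply: (@le_lt_trans _ _ (`|v - u| * (h k + 1))).
      by apply: ler_wpM2l => //; rewrite lerDl.
    by rewrite -ltr_pdivlMr.
  rewrite mulrAC ler_pdivrMr// mulrA; apply: ler_wpM2l.
    by rewrite mulr_ge0// ltW.
  by rewrite lerDl.
have [d d0 hd] := rad_norm_eps p1 (fun w => normr_ge0 (w - u)) coord e0.
by exists d => // v _ hv; exact: hd.
Qed.

End necessity.

(** * Polynomials of the semigroup and the disk norm *)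

Section semigroup.
Variables (R : realType) (X : normedModType R[i]) (T : R -> X -> X).
Hypothesis hT : c0_semigroup T.

Lemma semigroup_linear t : 0 <= t -> linear (T t).
Proof. by case: hT => h _ _ _ /h[]. Qed.

Lemma semigroup0 x : T 0 x = x.
Proof. by case: hT => _ -> _ _. Qed.

Lemma semigroupD s t x : 0 <= s -> 0 <= t -> T (s + t) x = T s (T t x).
Proof. by case: hT => _ _ h _ s0 t0; rewrite h. Qed.

Lemma semigroupC s t x : 0 <= s -> 0 <= t -> T s (T t x) = T t (T s x).
Proof. by move=> s0 t0; rewrite -!semigroupD// addrC. Qed.

Lemma semigroup_iter k t x : 0 <= t -> iter k (T t) x = T (k%:R * t) x.
Proof.
move=> t0; elim: k => [|k IH]; first by rewrite mul0r semigroup0.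
by rewrite iterS IH -semigroupD ?mulr_ge0// -natr1 mulrDl mul1r addrC.
Qed.

Lemma semigroup_polyE (f : {poly R[i]}) t x : 0 <= t ->
  operator_poly f (T t) x = \sum_(k < size f) f`_k *: T (k%:R * t) x.
Proof. by move=> t0; apply: eq_bigr => k _; rewrite semigroup_iter. Qed.

End semigroup.

Section disk_norm.
Variable R : realType.
Implicit Types (f : {poly R[i]}) (z : R[i]).

Lemma cabs_horner_le f z : cabs z <= 1 -> cabs f.[z] <= \sum_(k < size f) cabs f`_k.
Proof.
move=> z1; rewrite horner_coef; apply: le_trans (cabs_sum _ _ _) _.
apply: ler_sum => k _; rewrite cabsM cabsX; apply: ler_piMr; first exact: cabs_ge0.
by rewrite exprn_ile1// cabs_ge0.
Qed.

Lemma disk_norm_ge f z : cabs z <= 1 -> cabs f.[z] <= disk_norm f.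
Proof.
move=> z1; apply: ub_le_sup; last by exists z => //=; rewrite normc_cabs lecR.
exists (\sum_(k < size f) cabs f`_k) => _ [w /= w1 <-].
by apply: cabs_horner_le; rewrite normc_cabs lecR in w1.
Qed.

Lemma disk_norm_gt f (a : R) : a < disk_norm f -> exists2 z, cabs z <= 1 & a < cabs f.[z].
Proof.
have ne : [set complex.Re `|f.[z]| | z in [set z : R[i] | `|z| <= 1]] !=set0.
  by exists (cabs f.[0]), 0 => //=; rewrite normr0 ler01.
move=> /(sup_gt ne)[_ [z /= z1 <-] az]; exists z => //.
by rewrite normc_cabs lecR in z1.
Qed.

Lemma exists_expr_lt (q e : R) : 0 <= q < 1 -> 0 < e ->
  exists N0, forall N, (N0 <= N)%N -> q ^+ N < e.
Proof.
move=> /andP[q0 q1] e0.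
have /cvgrPdist_lt/(_ e e0)[N0 _ hN] : q ^+ n @[n --> \oo] --> 0.
  by apply: cvg_expr; rewrite ger0_norm.
exists N0 => N NN0; have := hN N NN0; rewrite sub0r normrN.
exact: le_lt_trans (ler_norm _).
Qed.

End disk_norm.

(** With [g = f^N] the operator is [g(1) T(Kt)] plus the sum of [g_k (T(Kt + kt) - T(Kt))], whose
    increments have relative length [k / K]. A large [N] leaves a gap [m] between [|g(1)| C] and the
    norm of [g], and a large [K] makes the sum smaller than [m]. *)
Lemma necessity (R : realType) (p : R) (X : normedModType R[i])
    (T : R -> X -> X) : 1 <= p -> c0_semigroup T -> R_analytic p T ->
   forall f : {poly R[i]}, cabs f.[1] < disk_norm f ->
   exists N0 : nat, forall N : nat, (N0 <= N)%N ->
   exists2 K0 : R, 0 <= K0 & forall K : R, K0 <= K ->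
     (lim (rbound p [set operator_poly (f ^+ N) (T t) \o T (K * t)%R |
                       t in [set t : R | (0 < t < e)%R]] @[e --> 0^'+])
      < (disk_norm (f ^+ N))%:E)%E.
Proof.
move=> p1 hT hA f hf.
have [C [D [C0 D0 hC hD]]] := R_analytic_increment p1 hA.
set b := cabs f.[1] in hf; have b0 : 0 <= b by exact: cabs_ge0.
have [z z1 hz] := disk_norm_gt hf; set a := cabs f.[z] in hz.
have a0 : 0 < a by exact: le_lt_trans b0 hz.
have C1 : 0 < C + 1 by rewrite ltr_wpDl.
have q1 : 0 <= b / a < 1 by rewrite divr_ge0 ?(ltW a0)//= ltr_pdivrMr// mul1r.
have i0 : 0 < (C + 1)^-1 by rewrite invr_gt0.
have [N0 hN0] := exists_expr_lt q1 i0.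
exists N0 => N NN0; set g := f ^+ N.
have aN : a ^+ N <= disk_norm g.
  by rewrite /a -cabsX -horner_exp; exact: disk_norm_ge.
have aN0 : 0 < a ^+ N by rewrite exprn_gt0.
have g1 : cabs g.[1] = b ^+ N by rewrite /g horner_exp cabsX.
have bC : b ^+ N * C < a ^+ N.
  have := hN0 N NN0; rewrite expr_div_n ltr_pdivrMr// mulrC ltr_pdivlMr// => h.
  apply: le_lt_trans h; apply: ler_wpM2l; first exact: exprn_ge0.
  by rewrite lerDl.
pose m := a ^+ N - b ^+ N * C; have m0 : 0 < m by rewrite subr_gt0.
pose A := \sum_(k < size g) cabs g`_k * k%:R.
have A0 : 0 <= A by apply: sumr_ge0 => k _; rewrite mulr_ge0// cabs_ge0.
have AD0 : 0 <= A * D / m by rewrite divr_ge0 ?mulr_ge0// ltW.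
(* The increments cost [A D / K], which is below [m] once [K > A D / m]. *)
exists (A * D / m + 1) => [|K hK]; first by rewrite addr_ge0.
have K0 : 0 < K by apply: lt_le_trans hK; rewrite ltr_wpDl.
pose C2 := b ^+ N * C + \sum_(k < size g) cabs g`_k * (k%:R / K * D).
have hC2 : C2 < disk_norm g.
  apply: lt_le_trans aN; rewrite /C2 addrC -ltrBrDr -/m.
  rewrite (_ : \sum_(k < _) _ = A * D / K).
    rewrite ltr_pdivrMr// [m * K]mulrC -ltr_pdivrMr//; apply: lt_le_trans hK.
    by rewrite ltrDl.
  rewrite /A !mulr_suml; apply: eq_bigr => k _; ring.
(* Keeps all times [(K + k) t] at most [1/2], as the increment estimate requires. *)
pose e := 1 / 2 / (K + (size g)%:R + 1).
have den0 : 0 < K + (size g)%:R + 1 by rewrite ltr_wpDl// addr_ge0// ltW.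
have e0 : 0 < e by rewrite divr_gt0.
have tK t (k : nat) : 0 < t < e -> (k <= size g)%N -> K * t + k%:R * t <= 1 / 2.
  move=> /andP[t0 te] kg.
  have h1 : t * (K + (size g)%:R + 1) <= 1 / 2.
    by rewrite -ler_pdivlMr//; exact: ltW.
  apply: le_trans h1; rewrite -mulrDl mulrC; apply: ler_wpM2l; first exact: ltW.
  have : k%:R <= (size g)%:R :> R by rewrite ler_nat.
  by move: (k%:R) ((size g)%:R) => ? ? ?; lra.
have C20 : 0 <= C2.
  rewrite addr_ge0 ?mulr_ge0 ?exprn_ge0//; apply: sumr_ge0 => k _.
  by rewrite mulr_ge0 ?cabs_ge0// mulr_ge0// divr_ge0// ltW.
apply: le_lt_trans (_ : (C2%:E < (disk_norm g)%:E)%E); last by rewrite lte_fin.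
apply: (@lim_rbound_le _ _ p (fun t => operator_poly g (T t) \o T (K * t)) e) => //.
have hb0 : rbounded p [set t : R | 0 < t < e] (fun t x => g.[1] *: T (K * t) x) (b ^+ N * C).
  rewrite -g1; apply: rbounded_scale => //.
  apply: (rbounded_reindex (g := fun t => K * t)) hC => // t te /=.
  have := tK t 0%N te (leq0n _); move/andP: te => [t0 _].
  rewrite mul0r addr0 mulr_gt0//= => h; apply: le_lt_trans h _; lra.
have hbk (k : nat) : (k < size g)%N -> rbounded p [set t : R | 0 < t < e]
    (fun t x => g`_k *: (T (K * t + k%:R * t) x - T (K * t) x)) (cabs g`_k * (k%:R / K * D)).
  move=> kg; apply: rbounded_scale => // n t x ht.
  apply: (hD n (fun j => K * t j) (fun j => k%:R * t j) x); first by rewrite divr_ge0// ltW.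
  move=> j; have /andP[t0 te] := ht j; split.
  - exact: mulr_gt0.
  - rewrite mulr_ge0//= ?(ltW t0)//.
    by rewrite le_eqVlt; apply/orP; left; apply/eqP; field; rewrite gt_eqF.
  - by apply: tK; [rewrite t0|exact: ltnW].
have := rbounded_add p1 hb0 (rbounded_sum p1 hbk).
apply: (rbounded_reindex (g := id)) => // t x /andP[t0 te] /=.
have Kt0 : 0 <= K * t by rewrite mulr_ge0// ltW.
rewrite (semigroup_polyE hT)//; last exact: ltW.
rewrite horner_coef scaler_suml -big_split/=; apply: eq_bigr => k _.
rewrite expr1n mulr1 -scalerDr subrKC -(semigroupD hT)// ?mulr_ge0 ?(ltW t0)//.
by rewrite addrC.
Qed.

(** * The maximum modulus of a polynomial on the circle *)

Section roots_of_unity.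
Variable R : realType.
Implicit Types (f : {poly R[i]}) (u z : R[i]) (L N : nat).

Lemma root_sum0 u L : u ^+ L = 1 -> u != 1 -> \sum_(j < L) u ^+ j = 0.
Proof.
move=> uL u1; have := subrX1 u L; rewrite uL subrr => /esym/eqP.
by rewrite mulf_eq0 subr_eq0 (negbTE u1) => /eqP.
Qed.

Lemma expi_neq1 (x : R) : 0 < x < pi *+ 2 -> expi x != 1.
Proof.
move=> /andP[x0 x2]; rewrite -subr_eq0 -cabs_eq0 cabs_expi_sub1_sin mulf_eq0 negb_or.
rewrite pnatr_eq0/= normr_eq0 gt_eqF//; apply: sin_gt0_pi.
by rewrite divr_gt0//= ltr_pdivrMr// mulr_natr.
Qed.

Lemma expi_natM (n : nat) (x : R) : expi (n%:R * x) = expi x ^+ n.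
Proof. by rewrite mulr_natl expiMn. Qed.

Definition angle (L : nat) : R := pi *+ 2 / L%:R.

Lemma expi_angleX L : (0 < L)%N -> expi (angle L) ^+ L = 1.
Proof.
move=> L0; rewrite -expi_natM /angle mulrC divfK ?expi2pi//.
by rewrite pnatr_eq0 -lt0n.
Qed.

Lemma expi_angle_orth L (i k : nat) : (i < L)%N -> (k < L)%N ->
  \sum_(j < L) (expi (angle L) ^+ i / expi (angle L) ^+ k) ^+ j = (L * (i == k))%:R.
Proof.
have core (d : nat) : (0 < d < L)%N -> expi (angle L) ^+ d != 1.
  move=> /andP[d0 dL]; have L0 : (0 < L)%N by exact: ltn_trans d0 dL.
  rewrite -expi_natM; apply: expi_neq1; have p0 := @pi_gt0 R.
  have Lr : 0 < L%:R :> R by rewrite ltr0n.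
  have pp : 0 < pi *+ 2 :> R by rewrite mulrn_wgt0.
  rewrite /angle mulr_gt0 ?ltr0n ?divr_gt0//= mulrA ltr_pdivrMr// mulrC.
  by rewrite ltr_pM2l// ltr_nat.
have e0 n : expi (angle L) ^+ n != 0 :> R[i] by rewrite expf_neq0// expi_neq0.
move=> iL kL; have L0 : (0 < L)%N by exact: leq_ltn_trans iL.
have [->|ik] := eqVneq i k.
  rewrite divff// muln1 (eq_bigr (fun=> 1)); last by move=> j _; rewrite expr1n.
  by rewrite sumr_const card_ord.
rewrite muln0; apply: root_sum0.
  by rewrite expr_div_n -!exprM ![(_ * L)%N]mulnC !exprM expi_angleX// !expr1n divr1.
have [lt|lt|eqik] := ltngtP i k; last by rewrite eqik eqxx in ik.
  rewrite -(inj_eq invr_inj) invr1 invf_div -expfB//; apply: core.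
  by rewrite subn_gt0 lt/= (leq_ltn_trans (leq_subr _ _)).
rewrite -expfB//; apply: core.
by rewrite subn_gt0 lt/= (leq_ltn_trans (leq_subr _ _)).
Qed.

(** Discrete Fourier inversion: a coefficient is the mean of [f(u) u^-k] over the [L]-th roots of
    unity as soon as [L] exceeds the degree. *)
Lemma coef_le_circle f L (c : R) (k : nat) : (size f <= L)%N -> (k < L)%N ->
  (forall j, (j < L)%N -> cabs f.[expi (angle L) ^+ j] <= c) -> cabs f`_k <= c.
Proof.
move=> fL kL hc; have L0 : (0 < L)%N by exact: leq_ltn_trans kL.
have Lr : 0 < L%:R :> R by rewrite ltr0n.
have Lc : L%:R != 0 :> R[i] by rewrite pnatr_eq0 -lt0n.
have fE : f`_k *+ L = \sum_(j < L) f.[expi (angle L) ^+ j] / (expi (angle L) ^+ k) ^+ j.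
  rewrite (eq_bigr (fun j : 'I_L => \sum_(i < L) f`_i *
      (expi (angle L) ^+ i / expi (angle L) ^+ k) ^+ j)); last first.
    move=> j _; rewrite (horner_coef_wide _ fL) mulr_suml; apply: eq_bigr => i _.
    by rewrite expr_div_n -mulrA -!exprM [(j * i)%N]mulnC.
  rewrite exchange_big/= (bigD1 (Ordinal kL))//= [X in _ + X]big1 ?addr0.
    by rewrite -mulr_sumr expi_angle_orth// eqxx muln1 mulr_natr.
  move=> i ik; rewrite -mulr_sumr expi_angle_orth//.
  rewrite (_ : (i == k :> nat) = false) ?muln0 ?mulr0//.
  by apply: negbTE; move: ik; rewrite -val_eqE.
have : cabs (f`_k *+ L) <= c *+ L.
  rewrite fE; apply: le_trans (cabs_sum _ _ _) _.
  rewrite -[in leRHS](card_ord L) -sumr_const; apply: ler_sum => j _.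
  by rewrite cabsM cabsV !cabsX cabs_expi !expr1n invr1 mulr1; exact: hc.
by rewrite -mulr_natr cabsM cabs_nat -[leRHS]mulr_natr ler_pM2r.
Qed.

Lemma bernoulli_ge (x : R) n : 0 <= x -> 1 + n%:R * x <= (1 + x) ^+ n.
Proof.
move=> x0; elim: n => [|n IH]; first by rewrite mul0r addr0 expr0.
rewrite exprS; apply: le_trans (_ : (1 + x) * (1 + n%:R * x) <= _).
  rewrite -natr1 mulrDl mul1r; have : 0 <= n%:R * x * x by rewrite !mulr_ge0.
  by rewrite mulrDl !mulrDr !mul1r mulr1 [x * _]mulrC; lra.
by apply: ler_wpM2l => //; lra.
Qed.

(* Applied to the powers of [f], the crude bound by the sum of the coefficients
   becomes sharp. *)
Lemma max_modulus f (c : R) : 0 <= c ->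
  (forall L j, (j < L)%N -> cabs f.[expi (angle L) ^+ j] <= c) ->
  forall z, cabs z <= 1 -> cabs f.[z] <= c.
Proof.
move=> c0 hc z z1; set d := (size f)%:R : R.
have d0 : 0 <= d by rewrite ler0n.
have power N : cabs f.[z] ^+ N <= (N%:R * d + 1) * c ^+ N.
  rewrite -cabsX -horner_exp; apply: le_trans (cabs_horner_le _ z1) _.
  set S := size (f ^+ N).
  apply: (@le_trans _ _ (\sum_(k < S) c ^+ N)).
    apply: ler_sum => k _; apply: (@coef_le_circle _ S) => //.
    by move=> j jS; rewrite horner_exp cabsX lerXn2r ?nnegrE ?cabs_ge0//; exact: hc.
  rewrite sumr_const card_ord -[leLHS]mulr_natl; apply: ler_wpM2r; first exact: exprn_ge0.
  have : (S <= N * size f + 1)%N.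
    apply: leq_trans (size_poly_exp_leq _ _) _; rewrite mulnC addn1 ltnS.
    by rewrite leq_mul2l leq_pred orbT.
  by rewrite -(ler_nat R) natrD natrM.
move: c0; rewrite le_eqVlt => /predU1P[c00|c0].
  by have := power 1%N; rewrite -c00 !expr1 mulr0.
rewrite leNgt; apply/negP => cf.
pose x := cabs f.[z] / c - 1.
have x0 : 0 < x by rewrite subr_gt0 ltr_pdivlMr// mul1r.
have qE : 1 + x = cabs f.[z] / c by rewrite subrKC.
have grow N : (1 + x) ^+ N <= N%:R * d + 1.
  by rewrite qE expr_div_n ler_pdivrMr ?exprn_gt0//; exact: power.
(* For the power [2 m], the lower bound [(1 + m x)^2] is quadratic in [m] while the upper bound
   [2 m d + 1] is linear; [A] is the threshold from which they contradict each other. *)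
pose A := (2 * d + 1) / x ^+ 2.
have A0 : 0 <= A by rewrite divr_ge0 ?sqr_ge0//; lra.
have := archi_boundP A0; set m := Num.bound A => hm.
have m0 : 0 < m%:R :> R by exact: le_lt_trans A0 hm.
have := grow (m * 2)%N; rewrite exprM natrM.
have := bernoulli_ge m (ltW x0); set y := (1 + x) ^+ m => hy.
have y2 : (m%:R * x) ^+ 2 < y ^+ 2.
  by rewrite ltrXn2r ?nnegrE ?mulr_ge0 ?(ltW x0) ?ltW//; lra.
have m2 : m%:R * (2 * d + 1) < (m%:R * x) ^+ 2.
  rewrite exprMn expr2 -mulrA ltr_pM2l// -ltr_pdivrMr ?exprn_gt0//.
have m1 : 1 <= m%:R :> R by rewrite ler1n -(ltr0n R).
by move: y2 m2; move: (y ^+ 2) ((_ * x) ^+ 2) => a b; lra.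
Qed.

(** By the maximum principle [c] is already exceeded at a root of unity. Its angle is recorded from
    both sides because the powers of [e^(ib)] turn in the direction given by the sign of [b]. A full
    turn replaces the angle 0, so that [t1] and [t2] are positive. *)
Lemma circle_point f (c : R) : 0 <= c -> c < disk_norm f ->
  exists zeta t1 t2 : R, [/\ c < cabs f.[expi zeta], 0 < t1 <= pi *+ 2,
    0 < t2 <= pi *+ 2 & expi zeta = expi (- t1) /\ expi zeta = expi t2].
Proof.
move=> c0 hc; have [z z1 hz] := disk_norm_gt hc.
have [L [j [jL hj]]] : exists L j, (j < L)%N /\ c < cabs f.[expi (angle L) ^+ j].
  apply: contrapT => h; suff : cabs f.[z] <= c by rewrite leNgt hz.
  apply: max_modulus => // L j jL; rewrite leNgt; apply/negP => hlt.
  by apply: h; exists L, j.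
have L0 : 0 < L%:R :> R by rewrite ltr0n (leq_ltn_trans _ jL).
have p0 : 0 < pi *+ 2 :> R by rewrite mulrn_wgt0// pi_gt0.
have jr : j%:R < L%:R :> R by rewrite ltr_nat.
have a0 : 0 < angle L by rewrite divr_gt0.
have aL : L%:R * angle L = pi *+ 2 by rewrite /angle mulrC divfK// gt_eqF.
exists (j%:R * angle L), ((L%:R - j%:R) * angle L),
  (if j == 0%N then pi *+ 2 else j%:R * angle L); split.
- by rewrite expi_natM.
- rewrite mulr_gt0 ?subr_gt0//= -aL ler_pM2r// gerBl ler0n//.
- case: eqVneq => [_|jn0]; first by rewrite p0 lexx.
  by rewrite mulr_gt0 ?ltr0n ?lt0n//= -aL ler_pM2r// ltW.
- split.
    by rewrite mulrBl aL opprB expiD expiN expi2pi invr1 mulr1.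
  by case: eqVneq => [->|//]; rewrite mul0r expi0 expi2pi.
Qed.

End roots_of_unity.

(** * Lower bounds for [1 - e^(ib) T(h)] *)

Lemma absorb_half (R : realFieldType) (g c a b D : R) :
  (g + c) * a <= g / 2 * a + c * a + D * b -> g * a <= 2 * (D * b).
Proof. by rewrite mulrDl => ?; lra. Qed.

Section lower_bounds.
Variables (R : realType) (p : R) (X : normedModType R[i]) (T : R -> X -> X) (M : R).
Hypothesis p1 : 1 <= p.
Hypothesis hT : c0_semigroup T.
Hypothesis M0 : 0 <= M.
Hypothesis hM : rbounded p [set t | 0 < t < 1] T M.

Lemma semigroup_right_cont (x : X) (e : R) : 0 < e ->
  exists2 d, 0 < d & forall s, 0 < s < d -> rnorm (T s x - x) <= e.
Proof.
move=> e0; have [_ _ _ h] := hT.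
have eC : 0 < e%:C%C :> R[i] by rewrite ltcR.
have /cvgrPdist_lt/(_ _ eC)/nbhs_ballP[d /= d0 hd] := h x.
exists d => // s /andP[s0 sd]; have := hd s.
rewrite /ball/= sub0r normrN gtr0_norm// => /(_ sd s0).
by rewrite norm_rnorm ltcR rnorm_distC => /ltW.
Qed.

Lemma rbounded_semigroup : rbounded p [set t | 0 <= t < 1] T M.
Proof.
apply: rbounded_lim hM => // t x e /andP[t0 t1] e0.
have [t00|t0'] := eqVneq t 0; last first.
  exists t; first by rewrite /= t1 andbT lt_neqAle eq_sym t0'.
  by rewrite subrr rnorm0 ltW.
have [d d0 hd] := semigroup_right_cont x e0.
exists (Num.min (d / 2) (1 / 2)).
  rewrite /= lt_min !divr_gt0//= gt_min; apply/orP; right; lra.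
rewrite t00 (semigroup0 hT) rnorm_distC; apply: hd.
rewrite lt_min !divr_gt0//= gt_min; apply/orP; left; lra.
Qed.

(** Combinations of [T] at the points of an arithmetic progression. The index carries the number of
    terms, the coefficients and the step, so one bound covers all lengths. *)
Lemma rbounded_weighted :
  rbounded p [set i : nat * (nat -> R[i]) * R | \sum_(j < i.1.1) cabs (i.1.2 j) <= 1 /\
                forall j, (j < i.1.1)%N -> 0 <= j%:R * i.2 < 1]
    (fun i x => \sum_(j < i.1.1) i.1.2 j *: T (j%:R * i.2) x) (2 * 1 * M).
Proof.
apply: (@rbounded_hull R X p p1 _ _ _ [set t : R | 0 <= t < 1] 0 T (fun i => i.1.1)
  (fun i => i.1.2) (fun i j => j%:R * i.2) 1 M) => //=.
- by rewrite lexx ltr01.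
- by move=> i j [_]; apply.
- by move=> i [].
- exact: rbounded_semigroup.
Qed.

(** With [v = e^(i zeta)], the operator [f(v) - f(T)] is bounded below by the gap [|f(v)| - c];
    replacing [v] by a nearby [e^(ia)] costs half of the gap. Then [f(e^(ia)) - f(T)] is an
    R-bounded operator composed with [e^(ia) - T], so the latter is bounded below as well. Nearby
    points are included because powers of [e^(ib)] only come close to [v]. *)
Lemma rbounded_below_point (f : {poly R[i]}) (c e zeta : R) :
  0 <= c < cabs f.[expi zeta] -> 0 < e ->
  rbounded p [set t | 0 < t < e] (fun t => operator_poly f (T t)) c ->
  exists eta tau C : R, [/\ 0 < eta, 0 < tau, tau <= 1, 0 <= C &
    rbounded_below p [set u : R * R | cabs (expi u.1 - expi zeta) <= eta /\ 0 < u.2 < tau]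
      (fun u x => expi u.1 *: x - T u.2 x) C].
Proof.
move=> /andP[c0 cf] e0 hf; set v := expi zeta in cf *; set w := cabs f.[v] in cf.
pose Lip := \sum_(k < size f) cabs f`_k * k%:R.
have Lip0 : 0 <= Lip by apply: sumr_ge0 => k _; rewrite mulr_ge0 ?cabs_ge0.
have powLip (a : R) k : cabs (expi a ^+ k - v ^+ k) <= k%:R * cabs (expi a - v).
  elim: k => [|k IH]; first by rewrite subrr cabs0 mul0r.
  rewrite !exprS (_ : _ - _ = expi a * (expi a ^+ k - v ^+ k) + (expi a - v) * v ^+ k); last by ring.
  apply: le_trans (cabsD _ _) _; rewrite !cabsM cabsX !cabs_expi expr1n mul1r mulr1.
  by rewrite -natr1 mulrDl mul1r lerD2r.
have hLip (a : R) : cabs (f.[v] - f.[expi a]) <= Lip * cabs (expi a - v).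
  rewrite [leLHS]cabs_distC !horner_coef -sumrB; apply: le_trans (cabs_sum _ _ _) _.
  rewrite mulr_suml; apply: ler_sum => k _; rewrite -mulrBr cabsM -mulrA.
  by apply: ler_wpM2l; [exact: cabs_ge0|exact: powLip].
pose g := w - c; have g0 : 0 < g by rewrite subr_gt0.
(* The complex contraction principle doubles [Lip * eta], so a quarter of the gap is allotted in
   order to lose one half. *)
pose eta := g / (4 * (Lip + 1)).
have Lip1 : 0 < Lip + 1 by rewrite ltr_wpDl.
have eta0 : 0 < eta by rewrite divr_gt0// mulr_gt0.
have etaE : 2 * (Lip * eta) <= g / 2.
  rewrite (_ : 2 * _ = Lip / (Lip + 1) * (g / 2)); last first.
    by rewrite /eta; field; rewrite gt_eqF.
  apply: ler_piMl; first by rewrite divr_ge0// ltW.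
  by rewrite ler_pdivrMr// mul1r lerDl.
pose tau := Num.min (Num.min e 1) (size f).+1%:R^-1.
have tau0 : 0 < tau by rewrite !lt_min e0 ltr01 invr_gt0 ltr0n.
pose CG := \sum_(k < size f) cabs f`_k * \sum_(j < k) (2 * 1 * M).
have CG0 : 0 <= CG.
  apply: sumr_ge0 => k _; rewrite mulr_ge0 ?cabs_ge0//; apply: sumr_ge0 => j _.
  by rewrite !mulr_ge0.
pose Q := [set u : R * R | cabs (expi u.1 - v) <= eta /\ 0 < u.2 < tau].
(* [A u k] is the quotient of [e^(iak) - T(kt)] by [e^(ia) - T(t)], where [u = (a, t)]. *)
pose A (u : R * R) k (y : X) := \sum_(j < k) expi u.1 ^+ (k - j.+1) *: T (j%:R * u.2) y.
have hG : rbounded p Q (fun u y => \sum_(k < size f) f`_k *: A u k y) CG.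
  apply: (@rbounded_sum _ _ _ p1 _ Q (size f) (fun k u y => f`_k *: A u k y)
    (fun k => cabs f`_k * \sum_(j < k) (2 * 1 * M))) => k kf.
  apply: (@rbounded_scale _ _ _ p1 _ Q (fun u y => A u k y)).
  apply: (@rbounded_sum _ _ _ p1 _ Q k
    (fun j (u : R * R) y => expi u.1 ^+ (k - j.+1) *: T (j%:R * u.2) y)
    (fun=> 2 * 1 * M)) => j jk.
  apply: (@rbounded_complex _ _ _ p1 _ Q (fun u => T (j%:R * u.2))
    (fun u => expi u.1 ^+ (k - j.+1)) 1 M) => //.
    by move=> u _; rewrite cabsX cabs_expi expr1n.
  apply: (rbounded_reindex (g := fun u : R * R => j%:R * u.2)) rbounded_semigroup => //.
  move=> [a t] [_ /andP[/= t0]]; rewrite !lt_min => /andP[_ tf].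
  rewrite mulr_ge0 ?(ltW t0)//=; apply: (@le_lt_trans _ _ ((size f).+1%:R * t)).
    by rewrite ler_pM2r// ler_nat; apply: ltnW; apply: ltnW; exact: leq_trans jk (ltnW _).
  by rewrite mulrC -ltr_pdivlMr ?ltr0n// mul1r.
have telescope (u : R * R) (l0 : nat) (x : X) : 0 < u.2 -> A u l0 (expi u.1 *: x - T u.2 x) =
    expi u.1 ^+ l0 *: x - T (l0%:R * u.2) x.
  move=> u0; have u0' := ltW u0; elim: l0 => [|l IH].
    by rewrite /A big_ord0 expr0 scale1r mul0r (semigroup0 hT) subrr.
  rewrite /A big_ord_recr/= subnn expr0 scale1r.
  rewrite (eq_bigr (fun j : 'I_l => expi u.1 *: (expi u.1 ^+ (l - j.+1) *:
      T (j%:R * u.2) (expi u.1 *: x - T u.2 x)))); last first.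
    by move=> [i il] _ /=; rewrite scalerA -exprS subSS subnSK.
  rewrite -scaler_sumr -/(A u l _) IH.
  have ku0 : 0 <= l%:R * u.2 by rewrite mulr_ge0.
  rewrite (linear_funB _ _ (semigroup_linear hT ku0)) (linear_funZ _ _ (semigroup_linear hT ku0)).
  rewrite -(semigroupD hT)// scalerBr scalerA -exprS -natr1 mulrDl mul1r.
  by rewrite addrA subrK.
exists eta, tau, (2 / g * CG); split.
- exact: eta0.
- exact: tau0.
- by rewrite ge_min; apply/orP; left; rewrite ge_min lexx orbT.
- by rewrite mulr_ge0// divr_ge0// ltW.
move=> n u x hu.
pose y k := expi (u k).1 *: x k - T (u k).2 (x k).
have e1 : (fun k => f.[v] *: x k) = (fun k => ((f.[v] - f.[expi (u k).1]) *: x k +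
    operator_poly f (T (u k).2) (x k)) + \sum_(j < size f) f`_j *: A (u k) j (y k)).
  apply/funext => k; have [_ /andP[t0 _]] := hu k.
  rewrite (semigroup_polyE hT); last exact: ltW.
  rewrite -addrA -big_split/= scalerBl -[LHS](subrK (f.[expi (u k).1] *: x k)); congr (_ + _).
  rewrite horner_coef scaler_suml; apply: eq_bigr => j _.
  by rewrite -scalerDr telescope// subrKC scalerA.
have b1 : rad_norm p (fun k => f.[v] *: x k) = w * rad_norm p x by rewrite (rad_normZ p1).
have b2 : rad_norm p (fun k => (f.[v] - f.[expi (u k).1]) *: x k) <= g / 2 * rad_norm p x.
  apply: le_trans (rad_norm_complex_contraction p1 _ (B := Lip * eta) _) _.
    move=> k; have [h _] := hu k; apply: le_trans (hLip _) _.
    by apply: ler_wpM2l.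
  by apply: ler_wpM2r => //; exact: rad_norm_ge0.
have b3 : rad_norm p (fun k => operator_poly f (T (u k).2) (x k)) <= c * rad_norm p x.
  apply: hf => k; have [_ /andP[t0]] := hu k.
  by rewrite !lt_min /= t0 => /andP[/andP[]].
have b4 := hG n u y hu.
have tot : w * rad_norm p x <= g / 2 * rad_norm p x + c * rad_norm p x + CG * rad_norm p y.
  rewrite -b1 e1; apply: le_trans (rad_normD p1 _ _) _.
  apply: (lerD _ b4); apply: le_trans (rad_normD p1 _ _) _; exact: (lerD b2 b3).
change (rad_norm p x <= 2 / g * CG * rad_norm p y).
have wE : w = g + c by rewrite subrK.
move: tot; rewrite wE; move: (rad_norm p x) (rad_norm p y) => a b tot.
have h := absorb_half tot.
rewrite (_ : 2 / g * CG * b = 2 * (CG * b) / g); last by ring.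
by rewrite ler_pdivlMr// mulrC.
Qed.

(** For [i = (b, h, r)], the geometric sum of [e^(ib) T(h)] with [r] terms, a truncated Neumann
    series that stands in for the inverse of [1 - e^(ib) T(h)]. *)
Definition wave (i : R * R * nat) (x : X) : X :=
  \sum_(j < i.2) expi i.1.1 ^+ j *: T (j%:R * i.1.2) x.

Lemma wave_linear i : 0 <= i.1.2 -> linear (wave i).
Proof.
move=> h0 a x y; rewrite /wave scaler_sumr -big_split/=; apply: eq_bigr => j _.
by rewrite (semigroup_linear hT) ?mulr_ge0// scalerDr !scalerA mulrC.
Qed.

Lemma wave_telescope b h r x : 0 <= h ->
  wave (b, h, r) (x - expi b *: T h x) = x - expi b ^+ r *: T (r%:R * h) x.
Proof.
move=> h0; elim: r => [|r IH].
  by rewrite /wave big_ord0 expr0 scale1r mul0r (semigroup0 hT) subrr.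
rewrite /wave big_ord_recr/= -[X in X + _]/(wave (b, h, r) _) IH.
have rh0 : 0 <= r%:R * h by rewrite mulr_ge0.
rewrite (linear_funB _ _ (semigroup_linear hT rh0)) (linear_funZ _ _ (semigroup_linear hT rh0)).
rewrite -(semigroupD hT)// scalerBr scalerA -exprSr -natr1 mulrDl mul1r.
by rewrite addrA subrK.
Qed.

Lemma wave_comm b h r s x : 0 <= h -> 0 <= s ->
  T s (wave (b, h, r) x) = wave (b, h, r) (T s x).
Proof.
move=> h0 s0; rewrite /wave (linear_fun_sum (semigroup_linear hT s0)).
apply: eq_bigr => j _; rewrite (linear_funZ _ _ (semigroup_linear hT s0)).
by rewrite (semigroupC hT)// mulr_ge0.
Qed.

Lemma wave_telescope' b h r x : 0 <= h ->
  wave (b, h, r) x - expi b *: T h (wave (b, h, r) x) = x - expi b ^+ r *: T (r%:R * h) x.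
Proof.
move=> h0; rewrite -wave_telescope// (linear_funB _ _ (wave_linear _)) ?(linear_funZ _ _ (wave_linear _))//.
by rewrite wave_comm.
Qed.

End lower_bounds.

(** For [x >= 1], [1/x^2 <= 2 (1/x - 1/(x+1))], which telescopes on either side of [a]; [G] is the
    resulting antidifference. The bound must not depend on [q], the order of the Fejer kernel. *)
Lemma sum_inv_sqr_le (R : realFieldType) (q a : nat) :
  \sum_(b < q) (if b == a :> nat then 0 else ((a%:R - b%:R) ^+ 2)^-1) <= 4 :> R.
Proof.
pose G b : R := if (b <= a)%N then (a%:R - b%:R + 1)^-1 else 2 - (b%:R - a%:R)^-1.
have aux (x : R) : 1 <= x -> (x ^+ 2)^-1 <= 2 * (x^-1 - (x + 1)^-1).
  move=> x1; rewrite -[_ <= _]subr_ge0 (_ : _ - _ = (x - 1) / (x ^+ 2 * (x + 1))).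
    by rewrite divr_ge0 ?subr_ge0// mulr_ge0 ?sqr_ge0//; lra.
  by field; rewrite !gt_eqF//; lra.
have G2 b : G b <= 2.
  rewrite /G; case: leqP => ba.
    have : 0 <= a%:R - b%:R :> R by rewrite subr_ge0 ler_nat.
    move: (a%:R - b%:R) => x x0; apply: (@le_trans _ _ 1); last by lra.
    by rewrite invf_le1; lra.
  by rewrite gerBl invr_ge0 subr_ge0 ler_nat ltnW.
suff H : \sum_(b < q) (if b == a :> nat then 0 else ((a%:R - b%:R) ^+ 2)^-1) <= 2 * G q.
  by apply: le_trans H _; have := G2 q; lra.
elim: q => [|q IH].
  by rewrite big_ord0 /G leq0n mulr0n subr0; apply: mulr_ge0.
rewrite big_ord_recr/=; apply: (@le_trans _ _ (2 * G q + (2 * (G q.+1 - G q)))); last by lra.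
apply: lerD => //; have [qa|qa|qa] := ltngtP q a.
- rewrite /G qa (ltnW qa) -(natr1 q).
  have x1 : 1 <= a%:R - q%:R :> R by rewrite -natrB 1?ltnW// ler1n subn_gt0.
  have := aux _ x1; rewrite (_ : a%:R - (q%:R + 1) + 1 = a%:R - q%:R :> R)//; ring.
- rewrite /G leqNgt (ltnW qa : (a < q.+1)%N)/= leqNgt qa/= -(natr1 q).
  have x1 : 1 <= q%:R - a%:R :> R by rewrite -natrB 1?ltnW// ler1n subn_gt0.
  have := aux _ x1; rewrite (_ : (a%:R - q%:R) ^+ 2 = (q%:R - a%:R) ^+ 2 :> R); last by ring.
  by rewrite (_ : q%:R + 1 - a%:R = q%:R - a%:R + 1 :> R); [lra|ring].
- rewrite /G qa ltnn leqnn -(natr1 a).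
  have -> : a%:R - a%:R + 1 = 1 :> R by ring.
  have -> : a%:R + 1 - a%:R = 1 :> R by ring.
  by rewrite invr1; lra.
Qed.

Section filtered.
Variables (R : realType) (p : R) (X : normedModType R[i]) (T : R -> X -> X) (M : R).
Hypothesis p1 : 1 <= p.
Hypothesis hT : c0_semigroup T.
Hypothesis M0 : 0 <= M.
Hypothesis hM : rbounded p [set t | 0 < t < 1] T M.

(** Let [m] be the integer part of [th / |b|], where [th] is the angle to [zeta] in the direction of
    rotation. Then [e^(-imb)] is within [|b| <= eta] of [e^(i zeta)], and [e^(-imb) - T(mh)] is
    [1 - e^(ib) T(h)] followed by a geometric sum of length [m], that is, [m] times an R-bounded
    mean. As [m |b| <= 2 pi], the factor [m] costs at most [2 pi / |b|]. *)
Lemma rbounded_below_unit (zeta t1 t2 eta tau C : R) :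
  0 < eta -> tau <= 1 -> 0 <= C -> 0 < t1 <= pi *+ 2 -> 0 < t2 <= pi *+ 2 ->
  expi zeta = expi (- t1) -> expi zeta = expi t2 ->
  rbounded_below p [set u : R * R | cabs (expi u.1 - expi zeta) <= eta /\ 0 < u.2 < tau]
      (fun u x => expi u.1 *: x - T u.2 x) C ->
  rbounded_below p [set u : R * R | [/\ 0 < `|u.1|, `|u.1| <= Num.min eta (Num.min t1 t2),
       0 < u.2 & pi *+ 2 * u.2 < tau * `|u.1|]]
    (fun u x => (`|u.1|^-1)%:C%C *: (x - expi u.1 *: T u.2 x))
    (C * (2 * 1 * M * (pi *+ 2))).
Proof.
move=> eta0 tau1 C0 /andP[t10 t1p] /andP[t20 t2p] z1 z2 hB n u x hu.
have p0 : 0 < pi *+ 2 :> R by rewrite mulrn_wgt0// pi_gt0.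
pose b k := (u k).1; pose h k := (u k).2.
pose th k := if 0 < b k then t1 else t2.
pose m k := Num.truncn (th k / `|b k|).
have hb k : [/\ 0 < `|b k|, `|b k| <= eta, `|b k| <= th k, 0 < h k &
    pi *+ 2 * h k < tau * `|b k|].
  have [h1 h2 h3 h4] := hu k; split=> //; first by move: h2; rewrite le_min => /andP[].
  by move: h2; rewrite !le_min => /and3P[_ ? ?]; rewrite /th; case: ifP.
have th0 k : 0 < th k <= pi *+ 2 by rewrite /th; case: ifP => _; apply/andP.
have hm k : (m k)%:R * `|b k| <= th k < (m k)%:R * `|b k| + `|b k|.
  have [b0 _ _ _ _] := hb k; have /andP[t0 _] := th0 k.
  have /truncn_itv/andP[h1 h2] : 0 <= th k / `|b k| by rewrite divr_ge0// ltW.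
  rewrite -ler_pdivlMr// h1/= -[X in _ < _ + X]mul1r -mulrDl natr1.
  by rewrite -ltr_pdivrMr.
have m0 k : (0 < m k)%N.
  have [b0 _ bt _ _] := hb k; rewrite truncn_gt0 ler_pdivlMr// mul1r//.
have mp k : (m k)%:R * `|b k| <= pi *+ 2.
  by have /andP[h1 _] := hm k; have /andP[_ h2] := th0 k; exact: le_trans h2.
have mr k : 0 < (m k)%:R :> R by rewrite ltr0n.
have mh k : 0 < (m k)%:R * h k < tau.
  have [b0 _ _ h0 ht] := hb k; rewrite mulr_gt0//=.
  rewrite -(ltr_pM2r b0); apply: le_lt_trans ht.
  by rewrite mulrAC; apply: ler_wpM2r; [exact: ltW|exact: mp].
(* Close to [-t1] for [b > 0] and to [t2] for [b < 0]; both represent [zeta]. *)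
pose a k := - ((m k)%:R * b k).
have near k : cabs (expi (a k) - expi zeta) <= eta.
  have [b0 be _ _ _] := hb k; have /andP[m1 m2] := hm k.
  have bound (s : R) : `|s| <= `|b k| -> `|s| <= eta by move=> hs; exact: le_trans be.
  move: m1 m2; rewrite /th /a; case: ltP => bk m1 m2.
    rewrite z1; apply: le_trans (cabs_expi_sub _ _) _; apply: bound.
    move: m1 m2; rewrite (gtr0_norm bk) => m1 m2; rewrite ger0_norm; lra.
  rewrite z2; apply: le_trans (cabs_expi_sub _ _) _; apply: bound.
  move: m1 m2; rewrite (ler0_norm bk) mulrN => m1 m2; rewrite ler0_norm; lra.
have := hB n (fun k => (a k, (m k)%:R * h k)) x (fun k => conj (near k) (mh k)).
rewrite /=; pose y k := x k - expi (b k) *: T (h k) (x k).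
pose c k (j : nat) := expi (a k) * expi (b k) ^+ j / (m k)%:R.
have waveE k : expi (a k) *: x k - T ((m k)%:R * h k) (x k) =
    \sum_(j < m k) c k j *: T (j%:R * h k) ((m k)%:R *: y k).
  have [_ _ _ h0 _] := hb k; have h0' := ltW h0.
  have -> : T ((m k)%:R * h k) (x k) =
      expi (a k) *: (expi (b k) ^+ m k *: T ((m k)%:R * h k) (x k)).
    rewrite scalerA (_ : expi (a k) * _ = 1) ?scale1r//.
    by rewrite -expi_natM -expiD /a addNr expi0.
  rewrite -scalerBr -(wave_telescope hT _ _ _ h0') /wave scaler_sumr.
  apply: eq_bigr => j _ /=.
  have jh : 0 <= j%:R * h k by rewrite mulr_ge0.
  rewrite (linear_funZ _ _ (semigroup_linear hT jh)) !scalerA; congr (_ *: _).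
  by rewrite /c divfK// pnatr_eq0 -lt0n.
rewrite (_ : (fun k => _) = (fun k => \sum_(j < m k) c k j *: T (j%:R * h k) ((m k)%:R *: y k)));
  last by apply/funext => k; exact: waveE.
move=> hx; apply: le_trans hx _; rewrite -mulrA; apply: (ler_wpM2l C0).
have hw := @rbounded_weighted R p X T M p1 hT M0 hM n (fun k => (m k, c k, h k))
  (fun k => (m k)%:R *: y k).
apply: le_trans (hw _) _.
  move=> k; split=> /=.
    rewrite (eq_bigr (fun=> (m k)%:R^-1)); last first.
      by move=> j _; rewrite /c !cabsM cabsV cabsX !cabs_expi expr1n !mul1r cabs_nat.
    by rewrite sumr_const card_ord -[leLHS]mulr_natl divff// gt_eqF.
  move=> j jm; have [_ _ _ h0 _] := hb k; rewrite mulr_ge0 ?(ltW h0)//=.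
  have /andP[_ h1] := mh k; apply: lt_le_trans tau1; apply: le_lt_trans h1.
  by rewrite ler_pM2r// ler_nat ltnW.
rewrite -[leRHS]mulrA; apply: ler_wpM2l; first by rewrite !mulr_ge0.
rewrite (_ : (fun k => (m k)%:R *: y k) =
    (fun k => ((m k)%:R * `|b k|)%:C%C *: (`|b k|^-1%:C%C *: y k))); last first.
  apply/funext => k; have [b0 _ _ _ _] := hb k.
  rewrite scalerA -rmorphM/= mulfK ?gt_eqF//.
  by rewrite (rmorph_nat (real_complex R)).
apply: (rad_norm_real_contraction p1); first exact: ltW.
by move=> k; rewrite ger0_norm ?mulr_ge0.
Qed.

Variables (beta tau C : R).
Hypothesis C0 : 0 <= C.
Hypothesis hB : rbounded_below p [set u : R * R | [/\ 0 < `|u.1|, `|u.1| <= beta,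
       0 < u.2 & pi *+ 2 * u.2 < tau * `|u.1|]]
    (fun u x => (`|u.1|^-1)%:C%C *: (x - expi u.1 *: T u.2 x)) C.

(** Where the lower bound is available; the last condition keeps all times of the sum below 1. *)
Definition wave_range := [set i : R * R * nat | [/\ 0 < `|i.1.1|, `|i.1.1| <= beta,
       0 < i.1.2, pi *+ 2 * i.1.2 < tau * `|i.1.1| & i.2%:R * i.1.2 < 1]].

Lemma rbounded_boundary :
  rbounded p wave_range (fun i x => x - expi i.1.1 ^+ i.2 *: T (i.2%:R * i.1.2) x)
    (1 + 2 * 1 * M).
Proof.
apply: (rbounded_sub p1); first exact: rbounded_id.
apply: (@rbounded_complex _ _ _ p1 _ _ (fun i => T (i.2%:R * i.1.2))
  (fun i : R * R * nat => expi i.1.1 ^+ i.2) 1 M) => //.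
  by move=> i _; rewrite cabsX cabs_expi expr1n.
apply: (rbounded_reindex (g := fun i : R * R * nat => i.2%:R * i.1.2))
  (rbounded_semigroup p1 hT hM) => //.
by move=> i [_ _ h0 _ h1]; rewrite /= h1 andbT mulr_ge0// ltW.
Qed.

(** The lower bound is applied to [|b|] times the geometric sum, on which [1 - e^(ib) T(h)]
    telescopes to an R-bounded operator. A term by term estimate would grow with the length of the
    sum instead. *)
Lemma rbounded_wave :
  rbounded p wave_range (fun i x => `|i.1.1|%:C%C *: wave T i x) (C * (1 + 2 * 1 * M)).
Proof.
move=> n i x hi.
have hi' k : [/\ 0 < `|(i k).1.1|, `|(i k).1.1| <= beta,
   0 < (i k).1.2 & pi *+ 2 * (i k).1.2 < tau * `|(i k).1.1|] by have [] := hi k.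
apply: le_trans (hB (fun k => `|(i k).1.1|%:C%C *: wave T (i k) (x k)) hi') _.
rewrite -[leRHS]mulrA; apply: (ler_wpM2l C0).
apply: le_trans (rbounded_boundary x hi).
rewrite (_ : (fun k => _) = (fun k => x k - expi (i k).1.1 ^+ (i k).2 *:
   T ((i k).2%:R * (i k).1.2) (x k)))//; apply/funext => k.
have [b0 _ h0 _] := hi' k; have h0' := ltW h0.
case: (i k) b0 h0 h0' => [[b h] r] /= b0 h0 h0'.
rewrite (linear_funZ _ _ (semigroup_linear hT h0')) scalerA mulrC -scalerA -scalerBr.
rewrite scalerA -rmorphM/= mulVf ?gt_eqF// scale1r.
by rewrite (wave_telescope' hT).
Qed.

Definition wave_diff_bound := 2 * 1 * ((1 + 2 * 1 * M) + 2 * 1 * (C * (1 + 2 * 1 * M))).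

(** [1 - T(h) = e^(-ib) ((1 - e^(ib) T(h)) + (e^(ib) - 1))]: on a geometric sum the first term
    telescopes, and in the second the factor [|e^(ib) - 1| <= |b|] compensates the growth
    [1 / |b|]. *)
Lemma rbounded_wave_diff :
  rbounded p wave_range (fun i x => wave T i x - T i.1.2 (wave T i x)) wave_diff_bound.
Proof.
have c1 (i : R * R * nat) : wave_range i -> cabs ((expi i.1.1 - 1) / `|i.1.1|%:C%C) <= 1.
  move=> [b0 _ _ _ _]; rewrite cabsM cabsV cabs_real normr_id ler_pdivrMr// mul1r.
  exact: cabs_expi_sub1_le.
have c2 (i : R * R * nat) : wave_range i -> cabs (expi (- i.1.1)) <= 1 by rewrite cabs_expi.
have h2 := rbounded_complex p1 ler01 c2
  (rbounded_add p1 rbounded_boundary (rbounded_complex p1 ler01 c1 rbounded_wave)).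
apply: (rbounded_reindex (g := id) _ _ h2) => //.
move=> [[b h] r] x [/= b0 _ h0 _ _]; have h0' := ltW h0.
have bc : `|b|%:C%C != 0 by rewrite -cabs_gt0 cabs_real gtr0_norm.
rewrite -(wave_telescope' hT)// scalerA divfK// scalerBl scale1r.
rewrite [X in _ = _ *: X]addrC subrKA -scalerBr scalerA -expiD addNr expi0.
by rewrite scale1r.
Qed.

End filtered.

(** * The Fejer kernel *)

(** The Fejer kernel of order [q] with period [L], written as a square so that its sign is visible;
    [fejerE] gives its Fourier expansion. *)
Definition fejer (R : realType) (L q : nat) (x : R) : R :=
  q%:R^-1 * cabs (\sum_(a < q) expi (a%:R * (angle R L * x))) ^+ 2.

Section fejer.
Variable R : realType.
Implicit Types (L q rho : nat) (x c : R).

Lemma fejer_ge0 L q x : 0 <= fejer L q x.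
Proof. by rewrite mulr_ge0 ?invr_ge0// sqr_ge0. Qed.

Lemma fejerE L q x : (fejer L q x)%:C%C =
  \sum_(a < q) \sum_(b < q) q%:R^-1 * expi ((a%:R - b%:R) * (angle R L * x)).
Proof.
rewrite /fejer rmorphM/= fmorphV/= (rmorph_nat (real_complex R)) rmorphXn/=.
rewrite -normc_cabs sqr_normc rmorph_sum/= mulr_suml mulr_sumr; apply: eq_bigr => a _.
rewrite !mulr_sumr; apply: eq_bigr => b _; congr (_ * _).
rewrite mulrBl expiD; congr (_ * _).
by rewrite /expi/= cosN sinN.
Qed.

(** [q <= L] makes the frequencies [a < q] distinct modulo [L], so only the diagonal terms survive,
    and these do not see the shift [c]. *)
Lemma sum_fejer L q c : (0 < q)%N -> (q <= L)%N ->
  \sum_(i < L) fejer L q (i%:R - c) = L%:R.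
Proof.
move=> q0 qL; apply: complexI; rewrite (rmorph_sum (real_complex R))/=.
rewrite (rmorph_nat (real_complex R)).
rewrite (eq_bigr _ (fun (i : 'I_L) _ => fejerE L q (i%:R - c))).
rewrite exchange_big/= (eq_bigr (fun=> q%:R^-1 * L%:R)); last first.
  move=> a _; rewrite exchange_big/=.
  have aL : (a < L)%N by exact: leq_trans (ltn_ord a) qL.
  have step (b : 'I_q) : \sum_(i < L) q%:R^-1 * expi ((a%:R - b%:R) * (angle R L * (i%:R - c))) =
      q%:R^-1 * expi (- ((a%:R - b%:R) * (angle R L * c))) * (L * (a == b :> nat))%:R.
    have bL : (b < L)%N by exact: leq_trans (ltn_ord b) qL.
    rewrite -(expi_angle_orth R aL bL) mulr_sumr; apply: eq_bigr => i _.
    rewrite -mulrA; congr (_ * _); rewrite -!expi_natM -expiN -expiD -expi_natM -expiD.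
    by congr expi; ring.
  rewrite (eq_bigr _ (fun b _ => step b)) (bigD1 a)//= big1 ?addr0.
    by rewrite eqxx muln1 subrr mul0r oppr0 expi0 mulr1.
  move=> b ba; rewrite (_ : (a == b :> nat) = false) ?muln0 ?mulr0//.
  by apply: negbTE; move: ba; rewrite -val_eqE/= eq_sym.
by rewrite sumr_const card_ord -[LHS]mulr_natl mulVKf// pnatr_eq0 -lt0n.
Qed.

(** The geometric sum of [u = e^(i angle x)] is at most [2 / |u - 1|], and
    [|u - 1|^2 = 2 (1 - cos (angle x))]. *)
Lemma fejer_le L q x y : (0 < q)%N -> y < 1 -> cos (angle R L * x) <= y ->
  fejer L q x <= 2 / (q%:R * (1 - y)).
Proof.
move=> q0 y1 hy; set u := expi (angle R L * x).
have qr : 0 < q%:R :> R by rewrite ltr0n.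
have c1 : 0 < 1 - cos (angle R L * x) by lra.
have u2 : cabs (u - 1) ^+ 2 = 2 * (1 - cos (angle R L * x)) by exact: cabs_expi_sub1_sqr.
have u0 : 0 < cabs (u - 1) ^+ 2 by rewrite u2 mulr_gt0.
have -> : fejer L q x = q%:R^-1 * cabs (\sum_(a < q) u ^+ a) ^+ 2.
  by congr (_ * cabs _ ^+ 2); apply: eq_bigr => a _; rewrite expi_natM.
rewrite (_ : 2 / (q%:R * (1 - y)) = q%:R^-1 * (2 / (1 - y))); last first.
  by field; rewrite !gt_eqF// subr_gt0.
apply: ler_wpM2l; first by rewrite invr_ge0 ltW.
apply: (@le_trans _ _ (4 / cabs (u - 1) ^+ 2)).
  rewrite ler_pdivlMr// -exprMn mulrC -cabsM -subrX1.
  have : cabs (u ^+ q - 1) <= 2.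
    apply: le_trans (cabsD _ _) _; rewrite cabsN cabs1 cabsX cabs_expi expr1n; lra.
  have := cabs_ge0 (u ^+ q - 1); move: (cabs _) => v v0 v2.
  by have := ler_pM v0 v0 v2 v2; rewrite -expr2; lra.
rewrite u2 (_ : 4 / _ = 2 / (1 - cos (angle R L * x))); last first.
  by field; rewrite gt_eqF.
by rewrite ler_pM2l// lef_pV2 ?posrE//; lra.
Qed.

Lemma cos_le_of_far (x y : R) : 0 <= y -> y <= x <= pi *+ 2 - y -> cos x <= cos y.
Proof.
move=> y0 /andP[yx xy]; have p0 := @pi_gt0 R.
have pp : pi *+ 2 = 2 * pi :> R by rewrite mulr_natl.
have mono a b : 0 <= a -> a <= b -> b <= pi -> cos b <= cos a.
  move=> a0 ab bp; have [->//|ne] := eqVneq a b.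
  by apply: ltW; rewrite ltr_cos ?in_itv/= ?a0 ?bp ?(le_trans a0 ab) ?(le_trans ab bp)// lt_neqAle ne.
have [xp|xp] := leP x pi; first exact: mono.
rewrite -(cosN x) -(cosD2pi (- x)) pp; apply: mono => //; rewrite pp in xy; lra.
Qed.

Lemma cos_lt1 (y : R) : 0 < y <= pi -> cos y < 1.
Proof.
move=> /andP[y0 yp]; rewrite -cos0 ltr_cos//.
  by rewrite in_itv/= lexx pi_ge0.
by rewrite in_itv/= (ltW y0) yp.
Qed.

Lemma angle_scale rho (x : R) : (0 < rho)%N -> angle R (32 * rho) * (x * rho%:R) = x * pi / 16.
Proof.
move=> r0; rewrite /angle natrM -mulr_natr; field.
by rewrite pnatr_eq0 -lt0n.
Qed.

Lemma sum_window (n m l : nat) (c : R) : (n <= m)%N -> (m <= l)%N ->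
  \sum_(i < l) (if (n <= i < m)%N then c else 0) = c *+ (m - n).
Proof.
move=> nm ml; rewrite -big_mkcond/= -sumr_const_nat.
rewrite (big_nat_widenl _ 0%N)// (big_nat_widen _ _ l)// big_mkord.
by apply: eq_bigl.
Qed.

(* Three factors [e^(ijx)], [j < 8 rho], put the window [12 rho] in the middle of the
   range of [j1 + j2 + j3]; the kernel concentrates there as [q] grows. *)
Lemma fejer_mass rho q : (0 < rho)%N -> (0 < q)%N -> (q <= 32 * rho)%N ->
  3 <= q%:R * (1 - cos (pi / 8)) :> R ->
  rho%:R <= \sum_(j1 < 8 * rho) \sum_(j2 < 8 * rho) \sum_(j3 < 8 * rho)
    fejer (32 * rho) q ((j1 + j2 + j3)%:R - 12 * rho%:R) / (8 * rho%:R) ^+ 2 :> R.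
Proof.
move=> r0 q0 qL hq; have rr : 0 < rho%:R :> R by rewrite ltr0n.
have p0 := @pi_gt0 R.
have y1 : cos (pi / 8) < 1 :> R by apply: cos_lt1; lra.
pose B : R := 2 / (q%:R * (1 - cos (pi / 8))).
have B23 : B <= 2 / 3.
  by rewrite /B ler_pM2l// lef_pV2 ?posrE//; exact: lt_le_trans hq.
(* A whole period has mass [32 rho]. For these [j1], [j2] the indices [8 rho <= i < 32 rho] are at
   least [2 rho] steps from the peak, an angle of [pi / 8]; their [24 rho] terms of size at most
   [2/3] leave a mass of [16 rho]. *)
have inner (j1 j2 : nat) : (3 * rho <= j1 < 5 * rho)%N -> (3 * rho <= j2 < 5 * rho)%N ->
    16 * rho%:R <= \sum_(j3 < 8 * rho) fejer (32 * rho) q ((j1 + j2 + j3)%:R - 12 * rho%:R) :> R.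
  move=> h1 h2; pose c : R := 12 * rho%:R - (j1 + j2)%:R.
  have := sum_fejer c q0 qL; rewrite -(big_mkord xpredT (fun i => fejer (32 * rho) q (i%:R - c))).
  rewrite (@big_cat_nat _ _ _ (8 * rho))//=; last by rewrite leq_mul2r orbT.
  rewrite big_mkord; set S1 := \sum_(i < _) _; set S2 := \sum_(_ <= i < _) _ => hS.
  have -> : \sum_(j3 < 8 * rho) fejer (32 * rho) q ((j1 + j2 + j3)%:R - 12 * rho%:R) = S1.
    by apply: eq_bigr => i _; congr fejer; rewrite /c natrD; ring.
  have hS2 : S2 <= 16 * rho%:R.
    apply: (@le_trans _ _ (\sum_(8 * rho <= i < 32 * rho) B)).
      rewrite /S2 !big_nat; apply: ler_sum => i /andP[i1 i2].
      apply: fejer_le => //; apply: cos_le_of_far; first by rewrite divr_ge0// ltW.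
      have x1 : 2 * rho%:R <= i%:R - c.
        rewrite /c; have : (14 * rho <= i + (j1 + j2))%N by lia.
        by rewrite -(ler_nat R) natrM (natrD _ i); move: (_ + _)%:R => v; lra.
      have x2 : i%:R - c <= 30 * rho%:R.
        rewrite /c; have : (i + (j1 + j2) <= 42 * rho)%N by lia.
        by rewrite -(ler_nat R) natrM (natrD _ i); move: (_ + _)%:R => v; lra.
      have a0 : 0 <= angle R (32 * rho).
        by rewrite divr_ge0// mulrn_wge0// ltW.
      have := ler_wpM2l a0 x1; have := ler_wpM2l a0 x2; rewrite !angle_scale//.
      rewrite -mulr_natl; move: (angle _ _ * _) => v ? ?; apply/andP; split; lra.
    rewrite sumr_const_nat -[leLHS]mulr_natr -mulnBl natrM.
    have := ler_wpM2r (ltW rr) B23; move: (rho%:R) => v.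
    by rewrite (_ : (32 - 8)%:R = 24 :> R)//; lra.
  by move: hS; rewrite natrM; move: (rho%:R) hS2 => v ? ?; lra.
have r2 : 0 < (8 * rho%:R) ^+ 2 :> R by rewrite exprn_gt0// mulr_gt0.
pose W : R := 16 * rho%:R / (8 * rho%:R) ^+ 2.
have W0 : 0 <= W by rewrite divr_ge0 ?mulr_ge0// ltW.
(* [(2 rho)^2] pairs of mass [16 rho] each, divided by [(8 rho)^2], give exactly [rho]. *)
apply: (@le_trans _ _ (\sum_(j1 < 8 * rho) (if (3 * rho <= j1 < 5 * rho)%N then
    (\sum_(j2 < 8 * rho) (if (3 * rho <= j2 < 5 * rho)%N then W else 0)) else 0))).
  rewrite !sum_window ?leq_mul2r ?orbT//.
  rewrite -mulnBl -[leRHS]mulr_natr -[W *+ _]mulr_natr natrM /W le_eqVlt; apply/orP; left; apply/eqP.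
  by rewrite (_ : (5 - 3)%:R = 2 :> R)//; field; rewrite gt_eqF.
apply: ler_sum => j1 _; case: ifP => h1; last first.
  by do 2 (apply: sumr_ge0 => ? _); rewrite divr_ge0 ?fejer_ge0// ltW.
apply: ler_sum => j2 _; case: ifP => h2; last first.
  by apply: sumr_ge0 => ? _; rewrite divr_ge0 ?fejer_ge0// ltW.
by rewrite -mulr_suml /W ler_pM2r ?invr_gt0//; exact: inner.
Qed.

(** Levels up to [24 rho] are within [12 rho] of the peak and the period is [32 rho], so no second
    peak is met. A distance of [12 rho e] is an angle of [3 pi e / 4], more than the [pi e / 2] in
    the bound. *)
Lemma fejer_far rho q (s : nat) (e : R) : (0 < rho)%N -> (0 < q)%N -> 0 < e <= 1 ->
  (s <= 24 * rho)%N -> e * (12 * rho%:R) <= `|s%:R - 12 * rho%:R| ->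
  fejer (32 * rho) q (s%:R - 12 * rho%:R) <= 2 / (q%:R * (1 - cos (e * (pi / 2)))).
Proof.
move=> r0 q0 /andP[e0 e1] hs he; have p0 := @pi_gt0 R.
have rr : 0 < rho%:R :> R by rewrite ltr0n.
have ep0 : 0 < e * (pi / 2) by rewrite mulr_gt0// divr_gt0.
have ep1 : e * (pi / 2) <= pi / 2 by apply: ler_piMl => //; rewrite divr_ge0// ltW.
apply: fejer_le => //; first by apply: cos_lt1; rewrite ep0/=; lra.
rewrite -cos_norm; apply: cos_le_of_far; first exact: ltW.
have a0 : 0 <= angle R (32 * rho) by rewrite divr_ge0// mulrn_wge0// ltW.
rewrite normrM (ger0_norm a0).
have h1 : `|s%:R - 12 * rho%:R| <= 12 * rho%:R :> R.
  have : s%:R <= 24 * rho%:R :> R by rewrite -natrM ler_nat.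
  by have : 0 <= s%:R :> R by []; rewrite ler_norml; move: (s%:R) (rho%:R) => u v ? ?; apply/andP; split; lra.
have := ler_wpM2l a0 he; have := ler_wpM2l a0 h1; rewrite mulrA !angle_scale// -mulr_natl.
move: (angle _ _ * _) => v h2 h3; apply/andP; split.
  by apply: le_trans h3; have := mulr_gt0 e0 p0; lra.
by have := ep1; lra.
Qed.

End fejer.

(** * Filtered differences of the orbit *)

(** An element of [Q] has to be supplied only when there is a coordinate; for the empty tuple both
    norms are 0. *)
Lemma rbounded_hull_of_nonempty (R : realType) (X : normedModType R[i]) (p : R) (I J : Type)
    (P : set I) (Q : set J) (F : J -> X -> X) (m : I -> nat) (c : I -> nat -> R[i])
    (g : I -> nat -> J) (B C : R) : 1 <= p -> 0 < B -> 0 <= C ->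
  (forall i, P i -> exists j, Q j) ->
  (forall i j, P i -> (j < m i)%N -> Q (g i j)) ->
  (forall i, P i -> \sum_(j < m i) cabs (c i j) <= B) ->
  rbounded p Q F C ->
  rbounded p P (fun i x => \sum_(j < m i) c i j *: F (g i j) x) (2 * B * C).
Proof.
move=> p1 B0 C0 hQ hg hc hF [|n] i x hi; last first.
  by have [j0 Qj0] := hQ _ (hi ord0); exact: (rbounded_hull p1 B0 C0 Qj0 hg hc hF).
have zero (z : 'I_0 -> X) : rad_norm p z = 0.
  by rewrite -(@rad_norm0 R X p p1 0); congr rad_norm; apply/funext => -[].
by rewrite !zero mulr0.
Qed.

Section filter.
Variables (R : realType) (p : R) (X : normedModType R[i]) (T : R -> X -> X) (M : R).
Hypothesis p1 : 1 <= p.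
Hypothesis hT : c0_semigroup T.
Hypothesis M0 : 0 <= M.
Hypothesis hM : rbounded p [set t | 0 < t < 1] T M.
Variables (beta tau C : R).
Hypothesis tau0 : 0 < tau.
Hypothesis tau1 : tau <= 1.
Hypothesis C0 : 0 <= C.
Hypothesis hB : rbounded_below p [set u : R * R | [/\ 0 < `|u.1|, `|u.1| <= beta,
       0 < u.2 & pi *+ 2 * u.2 < tau * `|u.1|]]
    (fun u x => (`|u.1|^-1)%:C%C *: (x - expi u.1 *: T u.2 x)) C.

(** Behind [1 - T(h)], one of the three sums is merely bounded, by [rbounded_wave_diff], and the
    other two contribute [1 / |b|] each; the resulting [1 / b^2] is summable over the
    frequencies. *)
Definition cube (i : R * R * nat) (x : X) : X := wave T i (wave T i (wave T i x)).

Lemma cubeE b h r x : 0 <= h -> cube (b, h, r) x =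
  \sum_(j : 'I_r * 'I_r * 'I_r) expi b ^+ (j.1.1 + j.1.2 + j.2) *:
    T ((j.1.1 + j.1.2 + j.2)%:R * h) x.
Proof.
move=> h0; have nh (n : nat) : 0 <= n%:R * h by rewrite mulr_ge0.
rewrite -(pair_bigA _ (fun (j : 'I_r * 'I_r) (k : 'I_r) => expi b ^+ (j.1 + j.2 + k) *:
    T ((j.1 + j.2 + k)%:R * h) x))/=.
rewrite -(pair_bigA _ (fun (j l : 'I_r) => \sum_(k < r) expi b ^+ (j + l + k) *:
    T ((j + l + k)%:R * h) x))/=.
rewrite /cube {1}/wave; apply: eq_bigr => j _ /=.
rewrite {1}/wave (linear_fun_sum (semigroup_linear hT (nh j))) scaler_sumr.
apply: eq_bigr => l _ /=.
rewrite (linear_funZ _ _ (semigroup_linear hT (nh j))) -(semigroupD hT)// -mulrDl -natrD.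
rewrite scalerA -exprD /wave (linear_fun_sum (semigroup_linear hT (nh (j + l)%N))) scaler_sumr.
apply: eq_bigr => k _ /=.
rewrite (linear_funZ _ _ (semigroup_linear hT (nh (j + l)%N))) -(semigroupD hT)// -mulrDl -natrD.
by rewrite scalerA -exprD.
Qed.

(** For [i = (t, rho, q)], the target time [t] is [12 rho] mesh steps, [32 rho] is the period of the
    Fejer kernel and [q] its order. The last condition keeps all its frequencies below [beta]. *)
Definition filter_range := [set i : R * nat * nat | [/\ 0 < i.1.1 <= tau / 4, (0 < i.1.2)%N,
  (0 < i.2)%N, (i.2 <= 32 * i.1.2)%N & i.2%:R * angle R (32 * i.1.2) <= beta]].

Definition mesh (i : R * nat * nat) : R := i.1.1 / (12 * i.1.2%:R).

(** The constants are matched here: [|d| >= 1] gives a frequency of at least [2 pi / (32 rho)],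
    while [t <= tau / 4] gives [2 pi h <= 2 pi tau / (48 rho)]; and [8 rho h = 2 t / 3 < 1]. *)
Lemma filter_wave_range i d : filter_range i -> 1 <= `|d| <= i.2%:R ->
  wave_range beta tau (d * angle R (32 * i.1.2), mesh i, (8 * i.1.2)%N).
Proof.
case: i => [[t rho] q] [/= /andP[t0 tt] r0 q0 qL hq] /andP[d1 dq].
have rr : 0 < rho%:R :> R by rewrite ltr0n.
have p0 : 0 < pi *+ 2 :> R by rewrite mulrn_wgt0// pi_gt0.
have rL : (32 * rho)%:R = 32 * rho%:R :> R by rewrite natrM.
have a0 : 0 < angle R (32 * rho) by rewrite divr_gt0// ltr0n muln_gt0.
have h0 : 0 < mesh (t, rho, q) by rewrite divr_gt0// mulr_gt0.
rewrite /wave_range/= normrM (gtr0_norm a0); split=> //.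
- by rewrite mulr_gt0//; lra.
- by apply: le_trans hq; rewrite ler_pM2r.
- apply: (@lt_le_trans _ _ (tau * angle R (32 * rho))).
    rewrite /angle /mesh rL mulrCA; apply: (@le_lt_trans _ _ (pi *+ 2 * (tau / 4 / (12 * rho%:R)))).
      by rewrite mulrCA; apply: ler_wpM2l; [exact: ltW|rewrite ler_pM2r ?invr_gt0 ?mulr_gt0].
    rewrite -subr_gt0 (_ : _ - _ = pi *+ 2 * tau / rho%:R / 96); last by field; rewrite gt_eqF.
    by rewrite !divr_gt0// mulr_gt0.
  by rewrite ler_pM2l// ler_peMl// ltW.
- rewrite /mesh/= natrM [X in X < 1](_ : _ = t * (2 / 3)); last by field; rewrite gt_eqF.
  by move: tau1 tt; lra.
Qed.

Let D4 := C * (1 + 2 * 1 * M).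
Let D5 := wave_diff_bound M C.
Let DA := (1 + M) * ((2 * 1 * M) * (2 * 1 * M)).
(** [DA] comes from the diagonal and 4 bounds the sum of the inverse squares; the leading 2 and the
    2 before the 4 are the prices of two complex convex hulls. *)
Definition filter_bound := 2 * 1 * (DA + 2 * 4 * (D5 * (D4 * D4))).

Lemma D4_ge0 : 0 <= D4.
Proof. by rewrite mulr_ge0// addr_ge0// !mulr_ge0. Qed.

Lemma D5_ge0 : 0 <= D5.
Proof. by have := D4_ge0; rewrite /D5 /wave_diff_bound /D4; move: M0; nra. Qed.

Lemma filter_bound_ge0 : 0 <= filter_bound.
Proof.
have h4 := D4_ge0; have h5 := D5_ge0.
have a0 : 0 <= DA by rewrite /DA !mulr_ge0// addr_ge0.
have b0 := mulr_ge0 h5 (mulr_ge0 h4 h4).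
by rewrite /filter_bound; apply: mulr_ge0 => //; apply: addr_ge0 => //; apply: mulr_ge0.
Qed.

Definition cube_diff (i : R * nat * nat) (d : R) (x : X) : X :=
  cube (d * angle R (32 * i.1.2), mesh i, (8 * i.1.2)%N) x -
  T (mesh i) (cube (d * angle R (32 * i.1.2), mesh i, (8 * i.1.2)%N) x).

Lemma rbounded_cube_diff :
  rbounded p [set k : R * nat * nat * R | filter_range k.1 /\ 1 <= `|k.2| <= k.1.2%:R]
    (fun k x => ((k.2 * angle R (32 * k.1.1.2)) ^+ 2)%:C%C *: cube_diff k.1 k.2 x)
    (D5 * (D4 * D4)).
Proof.
have h1 := rbounded_wave_diff p1 hT hM C0 hB; rewrite -/D5 in h1.
have h2 := rbounded_wave p1 hT hM C0 hB; rewrite -/D4 in h2.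
have h3 := rbounded_comp D5_ge0 h1 (rbounded_comp D4_ge0 h2 h2).
apply: (rbounded_reindex (g := fun k : R * nat * nat * R =>
  (k.2 * angle R (32 * k.1.1.2), mesh k.1, (8 * k.1.1.2)%N)) _ _ h3).
  by move=> k [hk hd]; exact: filter_wave_range.
move=> [i d] x [/= hi hd] /=.
have [/= _ _ h0 _ _] := filter_wave_range hi hd; have h0' := ltW h0.
rewrite /cube_diff /cube; set b := d * _; set h := mesh i in h0 h0' *.
have wl r : linear (wave T (b, h, r)) by apply: (wave_linear hT).
rewrite -(real_normK (num_real b)) expr2 rmorphM/=.
move: (`|b|%:C%C) => c.
by rewrite !(linear_funZ _ _ (wl _)) !(linear_funZ _ _ (semigroup_linear hT h0')) !scalerA -scalerBr.
Qed.

(** Frequency 0 has no lower bound. One sum telescopes with [1 - T(h)] to [1 - T(8 rho h)], and the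
    other two are [8 rho] times means of [T], whence the normalization. *)
Lemma rbounded_cube_diff0 :
  rbounded p filter_range (fun i x => ((8 * i.1.2%:R) ^- 2)%:C%C *: cube_diff i 0 x) DA.
Proof.
have meshP i : filter_range i -> 0 < mesh i /\ forall j : nat, (j <= 8 * i.1.2)%N ->
    0 <= j%:R * mesh i < 1.
  case: i => [[t rho] q] [/= /andP[t0 tt] r0 _ _ _].
  have rr : 0 < rho%:R :> R by rewrite ltr0n.
  have h0 : 0 < mesh (t, rho, q) by rewrite divr_gt0// mulr_gt0.
  split=> // j; rewrite -(ler_nat R) natrM => hj; rewrite mulr_ge0 ?(ltW h0)//=.
  apply: (@le_lt_trans _ _ (8 * rho%:R * mesh (t, rho, q))); first by rewrite ler_pM2r.
  rewrite /mesh/= [X in X < 1](_ : _ = t * (2 / 3)); last by field; rewrite gt_eqF.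
  by move: tau1 tt; lra.
have h1 : rbounded p filter_range (fun i x => x - T ((8 * i.1.2)%:R * mesh i) x) (1 + M).
  apply: (rbounded_sub p1); first exact: rbounded_id.
  apply: (rbounded_reindex (g := fun i : R * nat * nat => (8 * i.1.2)%:R * mesh i) _ _
    (rbounded_semigroup p1 hT hM)) => // i hi.
  by have [_ h] := meshP i hi; exact: h.
have h2 : rbounded p filter_range (fun i x => \sum_(j < 8 * i.1.2)
    (8 * i.1.2)%:R^-1 *: T (j%:R * mesh i) x) (2 * 1 * M).
  apply: (rbounded_reindex (g := fun i : R * nat * nat =>
    ((8 * i.1.2)%N, (fun=> (8 * i.1.2)%:R^-1), mesh i)) _ _ (rbounded_weighted p1 hT M0 hM)) => //.
  move=> i hi; have [_ h] := meshP i hi; split=> /= [|j jr]; last by apply: h; exact: ltnW.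
  rewrite sumr_const card_ord cabsV cabs_nat -[leLHS]mulr_natl.
  have [->|n0] := eqVneq (8 * i.1.2)%:R (0 : R); first by rewrite mul0r.
  by rewrite divff.
have M10 : 0 <= 1 + M by rewrite addr_ge0.
have M20 : 0 <= 2 * 1 * M by rewrite !mulr_ge0.
have h3 := rbounded_comp M10 h1 (rbounded_comp M20 h2 h2).
apply: (rbounded_reindex (g := id) _ _ h3) => // i x hi.
have [h0 _] := meshP i hi; have h0' := ltW h0.
rewrite /cube_diff /cube mul0r.
have wE (y : X) : \sum_(j < 8 * i.1.2) (8 * i.1.2)%:R^-1 *: T (j%:R * mesh i) y =
    (8 * i.1.2)%:R^-1 *: wave T (0, mesh i, (8 * i.1.2)%N) y.
  by rewrite /wave scaler_sumr; apply: eq_bigr => j _; rewrite expi0 expr1n scale1r.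
have wl : linear (wave T (0, mesh i, (8 * i.1.2)%N)) by apply: (wave_linear hT).
rewrite !wE !(linear_funZ _ _ wl) !scalerA.
have rl : 0 <= (8 * i.1.2)%:R * mesh i by rewrite mulr_ge0.
have := wave_telescope' hT 0 (8 * i.1.2) (wave T (0, mesh i, (8 * i.1.2)%N)
  (wave T (0, mesh i, (8 * i.1.2)%N) x)) h0'.
rewrite expi0 expr1n !scale1r => ->.
rewrite (linear_funZ _ _ (semigroup_linear hT rl)) -scalerBr; congr (_ *: _).
by rewrite -expr2 exprVn fmorphV rmorphXn rmorphM/= !(rmorph_nat (real_complex R)) natrM.
Qed.

Lemma angle_neq0 L : (0 < L)%N -> angle R L != 0.
Proof. by move=> L0; rewrite gt_eqF// divr_gt0 ?ltr0n// mulrn_wgt0// pi_gt0. Qed.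

(* Splitting off the diagonal, the remaining coefficients are [4 / (pi (a - b)) ^ 2]
   times unimodular numbers. *)
Lemma rbounded_filter_row :
  rbounded p [set k : R * nat * nat * nat | filter_range k.1 /\ (k.2 < k.1.2)%N]
    (fun k x => \sum_(b < k.1.2) (expi (- ((k.2%:R - b%:R) * (3 * pi / 4))) /
       ((8 * k.1.1.2%:R) ^+ 2)%:C%C) *: cube_diff k.1 (k.2%:R - b%:R) x)
    (DA + 2 * 4 * (D5 * (D4 * D4))).
Proof.
have D0 : 0 <= D5 * (D4 * D4).
  by exact: mulr_ge0 D5_ge0 (mulr_ge0 D4_ge0 D4_ge0).
pose P := [set k : R * nat * nat * nat | filter_range k.1 /\ (k.2 < k.1.2)%N].
pose Q := [set k : R * nat * nat * R | filter_range k.1 /\ 1 <= `|k.2| <= k.1.2%:R].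
pose c (k : R * nat * nat * nat) (b : nat) : R[i] := if b == k.2 then 0 else
  expi (- ((k.2%:R - b%:R) * (3 * pi / 4))) * (4 / pi ^+ 2 * ((k.2%:R - b%:R) ^+ 2)^-1)%:C%C.
(* On the diagonal the coefficient [c] is 0, and the frequency 1 is a placeholder that lies in
   [Q]. *)
pose g (k : R * nat * nat * nat) (b : nat) : R * nat * nat * R :=
  (k.1, if b == k.2 then 1 else k.2%:R - b%:R).
have hQ k : P k -> exists j, Q j.
  move=> [hk _]; exists (k.1, 1); split=> //=; have [_ _ q0 _ _] := hk.
  by rewrite normr1 lexx ler1n.
have hg k b : P k -> (b < k.1.2)%N -> Q (g k b).
  move=> [hk ka] bq; split=> //=; case: eqVneq => [_|bk].
      by have [_ _ q0 _ _] := hk; rewrite normr1 lexx ler1n.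
    have [kb|kb|kb] := ltngtP k.2 b; last by rewrite kb eqxx in bk.
    + rewrite distrC -natrB ?(ltnW kb)// normr_nat ler1n subn_gt0 kb ler_nat.
      by apply: leq_trans (leq_subr _ _) (ltnW bq).
    + rewrite -natrB ?(ltnW kb)// normr_nat ler1n subn_gt0 kb ler_nat.
      by apply: leq_trans (leq_subr _ _) (ltnW ka).
have hc k : P k -> \sum_(b < k.1.2) cabs (c k b) <= 4.
  move=> [hk ka]; apply: (le_trans _ (sum_inv_sqr_le R k.1.2 k.2)).
    apply: ler_sum => b _; rewrite /c; case: eqVneq => _; first by rewrite cabs0.
    have i0 : 0 <= ((k.2%:R - b%:R) ^+ 2)^-1 :> R by rewrite invr_ge0 sqr_ge0.
    rewrite cabsM cabs_expi mul1r cabs_real ger0_norm; last first.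
      by rewrite mulr_ge0// divr_ge0// sqr_ge0.
    apply: ler_piMl => //; have p2 := @pi_ge2 R; have p0 := @pi_gt0 R.
    rewrite ler_pdivrMr ?exprn_gt0// mul1r.
    by have := ler_pM (ler0n R 2) (ler0n R 2) p2 p2; rewrite -expr2; lra.
have hoff := rbounded_hull_of_nonempty p1 (ltr0n R 4) D0 hQ hg hc rbounded_cube_diff.
have hdiag := @rbounded_reindex R X p _ _ filter_range P (fun k => k.1) _ _ _
  (fun k (h : P k) => h.1) (fun k x _ => erefl) rbounded_cube_diff0.
have := rbounded_add p1 hdiag hoff.
apply: (rbounded_reindex (g := id)) => // -[i a] x [/= hi aq].
have [_ r0 q0 _ _] := hi; have rr : 0 < i.1.2%:R :> R by rewrite ltr0n.
have an0 : angle R (32 * i.1.2) != 0 by apply: angle_neq0; rewrite muln_gt0.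
(* Turns the scale [(8 rho)^-2] into [4 b^2 / (pi d)^2] for the frequency [b = d angle]; this is
   where the coefficients [c] come from. *)
have anE : angle R (32 * i.1.2) * (8 * i.1.2%:R) = pi / 2.
  by rewrite angle_scale//; field.
rewrite (bigD1 (Ordinal aq))//= subrr mul0r oppr0 expi0 div1r; congr (_ + _).
  by congr (_ *: _); rewrite fmorphV.
rewrite [RHS](bigD1 (Ordinal aq))//= {1}/c /= eqxx scale0r add0r.
apply: eq_bigr => b ba; have ba' : (b == a :> nat) = false.
  by apply: negbTE; move: ba; rewrite -val_eqE.
rewrite /c /g /= ba' scalerA; congr (_ *: _).
rewrite -[RHS]mulrA; congr (_ * _); rewrite -(rmorphM (real_complex R)) -(fmorphV (real_complex R)); congr (_%:C%C).
have d0 : a%:R - b%:R != 0 :> R by rewrite subr_eq0 eqr_nat eq_sym ba'.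
have -> : ((a%:R - b%:R) * angle R (32 * i.1.2)) ^+ 2 =
   (a%:R - b%:R) ^+ 2 * ((pi / 2) ^+ 2 / (8 * i.1.2%:R) ^+ 2).
  by rewrite -anE; field; rewrite gt_eqF.
have pr := @pi_gt0 R; move: pr rr d0.
move: (pi : R) (i.1.2%:R : R) (a%:R - b%:R : R) => u v d u0 v0 d0.
by field; rewrite d0 !gt_eqF.
Qed.

(* A mean of [T(jh) - T((j+1)h)] concentrated at [jh = t], where [h = mesh i] is
   [t / (12 rho)]. *)
Definition filtered (i : R * nat * nat) (x : X) : X :=
  \sum_(j : 'I_(8 * i.1.2) * 'I_(8 * i.1.2) * 'I_(8 * i.1.2))
    (fejer (32 * i.1.2) i.2 ((j.1.1 + j.1.2 + j.2)%:R - 12 * i.1.2%:R) /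
       (8 * i.1.2%:R) ^+ 2)%:C%C *:
    (T ((j.1.1 + j.1.2 + j.2)%:R * mesh i) x -
     T (((j.1.1 + j.1.2 + j.2)%:R + 1) * mesh i) x).

(** The Fejer kernel is expanded in characters and the sums are exchanged, so that each frequency
    carries a full third power of a geometric sum. The phase [3 pi / 4] is [12 rho] times the angle,
    the position of the peak. *)
Lemma filteredE i x : filter_range i -> filtered i x =
  \sum_(a < i.2) (i.2%:R^-1) *: \sum_(b < i.2)
    (expi (- ((a%:R - b%:R) * (3 * pi / 4))) / ((8 * i.1.2%:R) ^+ 2)%:C%C) *:
      cube_diff i (a%:R - b%:R) x.
Proof.
move=> hi; have [/andP[t0 _] r0 q0 _ _] := hi.
have rr : 0 < i.1.2%:R :> R by rewrite ltr0n.
have h0 : 0 <= mesh i by rewrite divr_ge0 ?mulr_ge0// ltW.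
pose th := angle R (32 * i.1.2); pose s (j : 'I_(8 * i.1.2) * 'I_(8 * i.1.2) * 'I_(8 * i.1.2)) :=
  (j.1.1 + j.1.2 + j.2)%N.
have thE : th * (12 * i.1.2%:R) = 3 * pi / 4.
  by rewrite /th angle_scale//; field.
have cdE d : cube_diff i d x = \sum_j expi (d * th) ^+ s j *:
    (T ((s j)%:R * mesh i) x - T (((s j)%:R + 1) * mesh i) x).
  rewrite /cube_diff !cubeE// (linear_fun_sum (semigroup_linear hT h0)) -sumrB.
  apply: eq_bigr => j _; rewrite (linear_funZ _ _ (semigroup_linear hT h0)) -scalerBr.
  have sh0 : 0 <= (s j)%:R * mesh i by exact: mulr_ge0.
  by rewrite -/(s j) -(semigroupD hT x h0 sh0) mulrDl mul1r [mesh i + _]addrC.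
rewrite /filtered; under eq_bigr => j _ do rewrite rmorphM/= fejerE mulr_suml scaler_suml.
rewrite exchange_big/=; apply: eq_bigr => a _; rewrite scaler_sumr.
under eq_bigr => j _ do rewrite mulr_suml scaler_suml.
rewrite exchange_big/=; apply: eq_bigr => b _; rewrite cdE !scaler_sumr.
apply: eq_bigr => j _; rewrite !scalerA; congr (_ *: _).
have E : expi ((a%:R - b%:R) * (th * ((s j)%:R - 12 * i.1.2%:R))) =
    expi (- ((a%:R - b%:R) * (3 * pi / 4))) * expi ((a%:R - b%:R) * th) ^+ s j.
  by rewrite -expi_natM -expiD -thE; congr expi; ring.
rewrite -/th -/(s j).
rewrite E (fmorphV (real_complex R)).
move: (expi _) (expi _ ^+ _) (i.2%:R^-1) => u v w; move: (_^-1) => D.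
by rewrite -!mulrA; congr (_ * (_ * _)); rewrite mulrC.
Qed.

(** The rows enter with weights [1 / q], so the bound is free of [q] and of [rho]. *)
Lemma rbounded_filtered : rbounded p filter_range filtered filter_bound.
Proof.
have D0 : 0 <= DA + 2 * 4 * (D5 * (D4 * D4)).
  have h := mulr_ge0 D5_ge0 (mulr_ge0 D4_ge0 D4_ge0).
  have a0 : 0 <= DA by rewrite /DA !mulr_ge0// addr_ge0.
  by apply: addr_ge0 => //; apply: mulr_ge0.
have := @rbounded_hull_of_nonempty R X p _ _ filter_range
  [set k : R * nat * nat * nat | filter_range k.1 /\ (k.2 < k.1.2)%N] _
  (fun i => i.2) (fun i _ => i.2%:R^-1) (fun i a => (i, a)) 1 _ p1 ltr01 D0 _ _ _
  rbounded_filter_row.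
rewrite -/filter_bound => H; apply: (rbounded_reindex (g := id) _ _ (H _ _ _)) => //.
- by move=> i x hi; exact: filteredE.
- by move=> i hi; exists (i, 0%N); split=> //=; have [] := hi.
- move=> i [_ _ q0 _ _]; rewrite sumr_const card_ord cabsV cabs_nat -[leLHS]mulr_natl.
  by rewrite divff// pnatr_eq0 -lt0n.
Qed.

End filter.

(** * From filtered differences to difference quotients *)

Section quotient.
Variables (R : realType) (p : R) (X : normedModType R[i]) (T : R -> X -> X) (M : R).
Hypothesis p1 : 1 <= p.
Hypothesis hT : c0_semigroup T.
Hypothesis M0 : 0 <= M.
Hypothesis hM : rbounded p [set t | 0 < t < 1] T M.
Variables (beta tau C : R).
Hypothesis tau0 : 0 < tau.
Hypothesis tau1 : tau <= 1.
Hypothesis C0 : 0 <= C.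
Hypothesis hB : rbounded_below p [set u : R * R | [/\ 0 < `|u.1|, `|u.1| <= beta,
       0 < u.2 & pi *+ 2 * u.2 < tau * `|u.1|]]
    (fun u x => (`|u.1|^-1)%:C%C *: (x - expi u.1 *: T u.2 x)) C.

Local Notation cell i := ('I_(8 * i.1.2) * 'I_(8 * i.1.2) * 'I_(8 * i.1.2))%type.

Definition level (r : nat) (j : 'I_r * 'I_r * 'I_r) : nat := (j.1.1 + j.1.2 + j.2)%N.

Definition weight (i : R * nat * nat) (j : cell i) : R :=
  fejer (32 * i.1.2) i.2 ((level j)%:R - 12 * i.1.2%:R) / (8 * i.1.2%:R) ^+ 2.

Definition total_weight (i : R * nat * nat) : R := \sum_j weight (i := i) j.

Lemma weight_ge0 i (j : cell i) : 0 <= weight j.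
Proof. by rewrite divr_ge0 ?fejer_ge0// sqr_ge0. Qed.

Lemma total_weight_ge i : (0 < i.1.2)%N -> (0 < i.2)%N -> (i.2 <= 32 * i.1.2)%N ->
  3 <= i.2%:R * (1 - cos (pi / 8)) :> R -> i.1.2%:R <= total_weight i.
Proof.
move=> r0 q0 qL hq; apply: le_trans (fejer_mass r0 q0 qL hq) _.
rewrite pair_bigA pair_bigA/=.
by apply: ler_sum => -[[a b] c] _; rewrite /weight /level /=.
Qed.

(** For [k = (t, rho, q, r)] and mesh [h], [12 rho h = t], so the factor is [t / (r h)] over the
    total weight: a weighted mean of [(t / s) (T(u) - T(u + s))] with [s = r h], concentrated at
    [u = t]. *)
Definition averaged (k : R * nat * nat * nat) (x : X) : X :=
  ((12 * k.1.1.2%:R) / (k.2%:R * total_weight k.1))%:C%C *: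
    \sum_(j : cell k.1) (weight j)%:C%C *:
       (T ((level j)%:R * mesh k.1) x - T (((level j) + k.2)%:R * mesh k.1) x).

Definition averaged_range := [set k : R * nat * nat * nat | [/\ filter_range beta tau k.1,
  3 <= k.1.2%:R * (1 - cos (pi / 8)) :> R, (0 < k.2)%N & (k.2 <= 12 * k.1.1.2)%N]].

Lemma mesh_gt0 i : filter_range beta tau i -> 0 < mesh i.
Proof.
by case: i => [[t rho] q] [/= /andP[t0 _] r0 _ _ _]; rewrite divr_gt0// mulr_gt0// ltr0n.
Qed.

(** An [r]-step difference is the sum of [r] translated one-step differences, so a mean of
    translates of [filtered] appears. *)
Lemma averagedE k x : averaged_range k -> averaged k x =
  ((12 * k.1.1.2%:R) / total_weight k.1)%:C%C *:
    \sum_(j < k.2) k.2%:R^-1 *: T (j%:R * mesh k.1) (filtered T k.1 x).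
Proof.
case: k => i r [/= hi _ r0 _]; have h0 := ltW (mesh_gt0 hi).
have wl : linear (wave T (0, mesh i, r)) by apply: (wave_linear hT).
have wE (y : X) : \sum_(j < r) r%:R^-1 *: T (j%:R * mesh i) y =
    r%:R^-1 *: wave T (0, mesh i, r) y.
  by rewrite /wave scaler_sumr; apply: eq_bigr => j _; rewrite expi0 expr1n scale1r.
rewrite wE /averaged /filtered (linear_fun_sum wl) scalerA.
have -> : (12 * i.1.2%:R / (r%:R * total_weight i))%:C%C =
    (12 * i.1.2%:R / total_weight i)%:C%C / r%:R :> R[i].
  rewrite -(rmorph_nat (real_complex R)) -(fmorphV (real_complex R)) -(rmorphM (real_complex R)).
  by congr (_%:C%C); rewrite invfM [_^-1 * _]mulrC mulrA.
congr (_ *: _); apply: eq_bigr => j _; rewrite (linear_funZ _ _ wl) -/(level j); congr (_ *: _).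
have l0 (n : nat) : 0 <= n%:R * mesh i by exact: mulr_ge0.
have := wave_telescope hT 0 r (T ((level j)%:R * mesh i) x) h0.
rewrite expi0 expr1n !scale1r -(semigroupD hT x h0 (l0 _)) -(semigroupD hT x (l0 _) (l0 _)).
have -> : mesh i + (level j)%:R * mesh i = ((level j)%:R + 1) * mesh i by rewrite mulrDl mul1r addrC.
by rewrite -mulrDl -natrD [(r + _)%N]addnC => ->.
Qed.

(** The 12 bounds [12 rho / total_weight], by [total_weight_ge]; [2 M] is the cost of the mean of
    translates. *)
Lemma rbounded_averaged :
  rbounded p averaged_range averaged (12 * (2 * 1 * M * filter_bound M C)).
Proof.
have F0 := filter_bound_ge0 M0 C0.
have A0 : 0 <= 2 * 1 * M by rewrite !mulr_ge0.
have hF := rbounded_filtered p1 hT M0 hM tau0 tau1 C0 hB.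
have hA : rbounded p averaged_range (fun k x =>
    \sum_(j < k.2) k.2%:R^-1 *: T (j%:R * mesh k.1) (filtered T k.1 x))
    (2 * 1 * M * filter_bound M C).
  have hF' := @rbounded_reindex R X p _ _ (filter_range beta tau) averaged_range (fun k => k.1) _ _ _
    (fun k h => let: And4 h _ _ _ := h in h) (fun k x _ => erefl) hF.
  have hW : rbounded p averaged_range
      (fun k y => \sum_(j < k.2) k.2%:R^-1 *: T (j%:R * mesh k.1) y) (2 * 1 * M).
    apply: (rbounded_reindex (g := fun k => (k.2, (fun=> k.2%:R^-1), mesh k.1)) _ _
      (rbounded_weighted p1 hT M0 hM)) => // -[i r] [/= hi _ r0 rL]; split=> /=.
      rewrite sumr_const card_ord cabsV cabs_nat -[leLHS]mulr_natl.
      by rewrite divff// pnatr_eq0 -lt0n.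
    move=> j jr; have [/andP[t0 tt] rho0 _ _ _] := hi; have h0 := mesh_gt0 hi.
  rewrite mulr_ge0 ?(ltW h0)//=; apply: (@le_lt_trans _ _ ((12 * i.1.2)%:R * mesh i)).
    by rewrite ler_pM2r// ler_nat; apply: leq_trans (ltnW jr) rL.
    rewrite /mesh natrM mulrC divfK ?mulf_neq0 ?pnatr_eq0 -?lt0n//; move: tau1 tt; lra.
  exact: (rbounded_comp A0 hW hF').
have := rbounded_real p1 (ler0n R 12) _ hA.
move=> /(_ (fun k => (12 * k.1.1.2%:R) / total_weight k.1)) h.
apply: (rbounded_reindex (g := id) _ _ (h _)) => // [k x hk|k [[_ r0 q0 qL _] hq _ _]].
  exact: averagedE.
have rr : 0 < k.1.1.2%:R :> R by rewrite ltr0n.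
have W := total_weight_ge r0 q0 qL hq; have W0 := lt_le_trans rr W.
rewrite ger0_norm; last by rewrite divr_ge0 ?mulr_ge0// ltW.
by rewrite ler_pdivrMr// ler_pM2l.
Qed.

(** [T(v) x - T(u) x = T(u) (T(v - u) x - x)] reduces the claim to right continuity at 0 and the
    bound [M]. *)
Lemma semigroup_unif_cont x e : 0 < e -> exists2 d, 0 < d &
  forall u v, 0 <= u < 1 -> 0 <= v < 1 -> `|u - v| < d -> rnorm (T u x - T v x) <= e.
Proof.
move=> e0; have M10 : 0 < M + 1 by rewrite ltr_wpDl.
have [d d0 hd] := semigroup_right_cont hT x (divr_gt0 e0 M10).
have key u v : 0 <= u -> u < v -> v < 1 -> v - u < d -> rnorm (T v x - T u x) <= e.
  move=> u0 uv v1 vu; have vu0 : 0 <= v - u by rewrite subr_ge0 ltW.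
  rewrite -{1}(subrK u v) [v - u + u]addrC (semigroupD hT x u0 vu0).
  rewrite -(linear_funB _ _ (semigroup_linear hT u0)).
  have uu : 0 <= u < 1 by rewrite u0 (lt_trans uv v1).
  apply: le_trans (rbounded_norm p1 (T _ x - x) (rbounded_semigroup p1 hT hM) uu) _.
  have hs : 0 < v - u < d by rewrite subr_gt0 uv.
  apply: (@le_trans _ _ (M * (e / (M + 1)))); first by apply: (ler_wpM2l M0); exact: hd.
  by rewrite mulrCA ler_piMr ?(ltW e0)// ler_pdivrMr// mul1r lerDl.
exists d => // u v /andP[u0 u1] /andP[v0 v1] huv.
have [uv|uv|->] := ltgtP u v.
- rewrite rnorm_distC; apply: key => //.
  by rewrite ltr0_norm in huv; [move: huv; rewrite opprB|rewrite subr_lt0].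
- by apply: key => //; rewrite gtr0_norm in huv; rewrite ?subr_gt0.
- by rewrite subrr rnorm0 ltW.
Qed.

(** Cells near the peak have an error [e1] relative to their weight, the others an absolute error
    [B]. There are [(8 rho)^3] cells and the total weight is at least [rho], hence [512 rho^2]. *)
Lemma averaged_dist k x F e1 B : averaged_range k -> 0 <= B ->
  (forall j : cell k.1, weight j * rnorm (T ((level j)%:R * mesh k.1) x -
     T ((level j + k.2)%:R * mesh k.1) x - F) <= weight j * e1 + B) ->
  rnorm (averaged k x - (12 * k.1.1.2%:R / k.2%:R)%:C%C *: F) <=
  12 * k.1.1.2%:R / k.2%:R * (e1 + 512 * k.1.1.2%:R ^+ 2 * B).
Proof.
move=> [[_ rho0 q0 qL _] hq r0 _] B0 hG.
have rr : 0 < k.1.1.2%:R :> R by rewrite ltr0n.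
have r0' : 0 < k.2%:R :> R by rewrite ltr0n.
have W := total_weight_ge rho0 q0 qL hq; have W0 := lt_le_trans rr W.
set c := 12 * k.1.1.2%:R / k.2%:R; have c0 : 0 < c by rewrite divr_gt0// mulr_gt0.
have -> : averaged k x - c%:C%C *: F = (c / total_weight k.1)%:C%C *: \sum_(j : cell k.1)
    (weight j)%:C%C *: (T ((level j)%:R * mesh k.1) x - T ((level j + k.2)%:R * mesh k.1) x - F).
  under eq_bigr => j _ do rewrite scalerBr.
  rewrite sumrB scalerBr -scaler_suml scalerA -(rmorph_sum (real_complex R))/=.
  rewrite -(rmorphM (real_complex R))/= -/(total_weight k.1) divfK ?gt_eqF//.
  by rewrite /averaged /c invfM mulrA.
rewrite rnormZ cabs_real ger0_norm; last by rewrite divr_ge0// ltW.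
rewrite -[leLHS]mulrA; apply: ler_wpM2l; first exact: ltW.
rewrite mulrC ler_pdivrMr//; apply: le_trans (rnorm_sum _ _ _) _.
apply: (@le_trans _ _ (\sum_(j : cell k.1) (weight j * e1 + B))).
  apply: ler_sum => j _; rewrite rnormZ cabs_real ger0_norm; last exact: weight_ge0.
  exact: hG.
rewrite big_split/= -mulr_suml -/(total_weight k.1) mulrDl [e1 * _]mulrC; apply: lerD => //.
rewrite sumr_const !card_prod card_ord -[leLHS]mulr_natl !natrM.
move: (total_weight _) (k.1.1.2%:R : R) W rr B0 => w u wu u0 B0.
have -> : 8 * u * (8 * u) * (8 * u) * B = 512 * u ^+ 2 * B * u by ring.
by apply: (ler_wpM2l (mulr_ge0 (mulr_ge0 (ler0n R 512) (sqr_ge0 u)) B0)); exact: wu.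
Qed.

End quotient.

(** The cost of rounding [s] down to a multiple [y] of the mesh [h]. *)
Lemma step_ratio (R : realFieldType) (t s h y : R) : 0 < s -> 0 < t -> h <= s / 2 ->
  y <= s -> s <= y + h ->
  [/\ 0 < y, t / s <= t / y, t / y <= 2 * t / s & t / y - t / s <= 2 * t * h / s ^+ 2].
Proof.
move=> s0 t0 hs ys sy; have y0 : 0 < y by lra.
have h0 : 0 <= h by lra.
have sy2 : s <= 2 * y by lra.
split=> //.
- by rewrite ler_pM2l// lef_pV2.
- rewrite -subr_ge0 (_ : _ - _ = t * (2 * y - s) / (y * s)); last by field; rewrite !gt_eqF.
  by rewrite divr_ge0 ?mulr_ge0 ?subr_ge0 ?(ltW t0) ?(ltW y0) ?(ltW s0).
rewrite -subr_ge0 (_ : _ - _ = t * (2 * h * y - s * (s - y)) / (y * s ^+ 2)); last first.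
  by field; rewrite !gt_eqF.
have hy : s * (s - y) <= 2 * y * h by apply: ler_pM => //; lra.
apply: divr_ge0; last by apply: mulr_ge0; [exact: ltW|exact: sqr_ge0].
by apply: mulr_ge0; [exact: ltW|rewrite subr_ge0 mulrAC].
Qed.

Lemma exists_nat_ge (R : realType) (a : R) : exists2 n, (0 < n)%N & a <= n%:R.
Proof.
exists (Num.truncn `|a|).+1 => //; apply: le_trans (ler_norm _) _; apply: ltW.
exact: truncnS_gt.
Qed.

(** A third of [e] goes to each source of error: the rounding of [s] to the mesh, the cells near
    [t], and the cells far from it. [A] stands for the bound on the orbit. *)
Lemma error_budget (R : realFieldType) (t s A e B h : R) : 0 < t -> 0 < s -> 0 <= A -> 0 < e ->
  B <= e * s / (192 * t * (A + 1)) -> h <= e * s ^+ 2 / (12 * t * (A + 1)) ->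
  2 * t * h / s ^+ 2 * (2 * A) + 2 * t / s * (2 * (e * s / (12 * t)) + 32 * A * B) <= e.
Proof.
move=> t0 s0 A0 e0 hB hh; have A1 : 0 < A + 1 by rewrite ltr_wpDl.
pose a := A / (A + 1); have a1 : a <= 1 by rewrite ler_pdivrMr// mul1r lerDl.
have h1 : 2 * t * h / s ^+ 2 * (2 * A) <= e / 3 * a.
  have -> : e / 3 * a = 4 * t * A / s ^+ 2 * (e * s ^+ 2 / (12 * t * (A + 1))).
    by rewrite /a; field; rewrite !gt_eqF.
  have -> : 2 * t * h / s ^+ 2 * (2 * A) = 4 * t * A / s ^+ 2 * h by field; rewrite gt_eqF.
  by apply: ler_wpM2l hh; rewrite divr_ge0 ?sqr_ge0// mulr_ge0// mulr_ge0// ltW.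
have h2 : 2 * t / s * (32 * A * B) <= e / 3 * a.
  have -> : e / 3 * a = 64 * t * A / s * (e * s / (192 * t * (A + 1))).
    by rewrite /a; field; rewrite !gt_eqF.
  have -> : 2 * t / s * (32 * A * B) = 64 * t * A / s * B by field; rewrite gt_eqF.
  by apply: ler_wpM2l hB; rewrite divr_ge0 ?(ltW s0)// mulr_ge0// mulr_ge0// ltW.
have h3 : 2 * t / s * (2 * (e * s / (12 * t))) = e / 3 by field; rewrite !gt_eqF.
have h4 : e / 3 * a <= e / 3 by rewrite ler_piMr// divr_ge0// ltW.
by rewrite mulrDr h3; lra.
Qed.

Section difference_quotient.
Variables (R : realType) (p : R) (X : normedModType R[i]) (T : R -> X -> X) (M : R).
Hypothesis p1 : 1 <= p.
Hypothesis hT : c0_semigroup T.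
Hypothesis M0 : 0 <= M.
Hypothesis hM : rbounded p [set t | 0 < t < 1] T M.
Variables (beta tau C : R).
Hypothesis beta0 : 0 < beta.
Hypothesis tau0 : 0 < tau.
Hypothesis tau1 : tau <= 1.
Hypothesis C0 : 0 <= C.
Hypothesis hB : rbounded_below p [set u : R * R | [/\ 0 < `|u.1|, `|u.1| <= beta,
       0 < u.2 & pi *+ 2 * u.2 < tau * `|u.1|]]
    (fun u x => (`|u.1|^-1)%:C%C *: (x - expi u.1 *: T u.2 x)) C.

Lemma exists_filter_order (e b : R) : 0 < e -> b < 1 -> exists q,
  [/\ (0 < q)%N, 3 <= q%:R * (1 - cos (pi / 8)) :> R & 2 / (q%:R * (1 - b)) <= e].
Proof.
move=> e0 b1; have p0 := @pi_gt0 R.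
have c1 : 0 < 1 - cos (pi / 8) :> R by rewrite subr_gt0; apply: cos_lt1; lra.
have b0 : 0 < 1 - b by rewrite subr_gt0.
have [q q0 hq] := exists_nat_ge (3 / (1 - cos (pi / 8)) + 2 / (e * (1 - b))).
have a1 : 0 <= 3 / (1 - cos (pi / 8)) :> R by rewrite divr_ge0// ltW.
have a2 : 0 <= 2 / (e * (1 - b)) by rewrite divr_ge0// mulr_ge0 ?ltW.
have q1 : 3 / (1 - cos (pi / 8)) <= q%:R :> R by apply: le_trans hq; rewrite lerDl.
have q2 : 2 / (e * (1 - b)) <= q%:R by apply: le_trans hq; rewrite lerDr.
exists q; split=> //; first by rewrite -ler_pdivrMr.
have qr : 0 < q%:R :> R by rewrite ltr0n.
rewrite ler_pdivrMr ?mulr_gt0//; move: q2; rewrite ler_pdivrMr ?mulr_gt0//.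
by rewrite mulrCA.
Qed.

(** The order [q] is given before [rho]: once it is fixed, a fine mesh brings all frequencies below
    [beta]. *)
Lemma exists_filter_scale (t eta : R) q : 0 < t <= tau / 4 -> 0 < eta -> (0 < q)%N ->
  exists rho, filter_range beta tau (t, rho, q) /\ mesh (t, rho, q) <= eta.
Proof.
move=> /andP[t0 tt] eta0 q0; have p0 : 0 < pi *+ 2 :> R by rewrite mulrn_wgt0// pi_gt0.
have a1 : 0 <= q%:R * (pi *+ 2) / beta by rewrite divr_ge0 ?mulr_ge0// ltW.
have a2 : 0 <= t / eta by rewrite divr_ge0// ltW.
have [rho r0 hr] := exists_nat_ge (q%:R + (q%:R * (pi *+ 2) / beta + t / eta)).
have rr : 0 < rho%:R :> R by rewrite ltr0n.
have h1 : q%:R <= rho%:R :> R by apply: le_trans hr; rewrite lerDl addr_ge0.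
have h2 : q%:R * (pi *+ 2) / beta <= rho%:R.
  by apply: le_trans hr; rewrite addrCA lerDl addr_ge0.
have h3 : t / eta <= rho%:R by apply: le_trans hr; rewrite addrA lerDr addr_ge0.
have le32 : rho%:R <= 32 * rho%:R :> R by rewrite ler_peMl// ?ler1n ?ltW.
exists rho; split; first (split=> //=; first by rewrite t0).
- by rewrite ler_nat in h1; apply: leq_trans h1 _; rewrite leq_pmull.
- rewrite /angle natrM mulrA ler_pdivrMr ?mulr_gt0//.
  move: h2; rewrite ler_pdivrMr// => h2; apply: le_trans h2 _.
  by rewrite mulrC ler_pM2l.
rewrite /mesh/= ler_pdivrMr ?mulr_gt0//; move: h3; rewrite ler_pdivrMr// => h3.
apply: le_trans h3 _; rewrite mulrC; apply: ler_wpM2l; first exact: ltW.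
by rewrite ler_peMl ?ler1n// ltW.
Qed.

Lemma rnorm_difference_le x u v : 0 <= u < 1 -> 0 <= v < 1 ->
  rnorm (T u x - T v x) <= 2 * (M * rnorm x).
Proof.
move=> hu hv; apply: le_trans (rnormB _ _) _.
have hS := rbounded_semigroup p1 hT hM.
have h1 := rbounded_norm p1 x hS hu; have h2 := rbounded_norm p1 x hS hv.
by rewrite mulr_natl mulr2n; apply: lerD.
Qed.

Lemma level_le r (j : 'I_r * 'I_r * 'I_r) : (level j <= 3 * r)%N.
Proof.
have h1 := ltn_ord j.1.1; have h2 := ltn_ord j.1.2; have h3 := ltn_ord j.2.
by rewrite /level; lia.
Qed.

(** Order of the choices: [d] from the uniform continuity of the orbit, the relative width [ep] of
    the peak, the order [q] that makes the kernel small outside it, [rho] for the mesh [h], and [r]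
    as the integer part of [s / h]. *)
Lemma difference_quotient_approx t s x e : 0 < t <= tau / 4 -> 0 < s <= t -> 0 < e ->
  exists2 k, averaged_range beta tau k &
    rnorm ((t / s)%:C%C *: (T t x - T (t + s) x) - averaged T k x) <= e.
Proof.
move=> /andP[t0 tt] /andP[s0 st] e0; have p0 := @pi_gt0 R.
pose A := M * rnorm x; have A0 : 0 <= A by rewrite mulr_ge0// rnorm_ge0.
have A1 : 0 < A + 1 by rewrite ltr_wpDl.
pose e2 := e * s / (12 * t).
have e20 : 0 < e2 by rewrite divr_gt0// mulr_gt0.
have [d d0 hd] := semigroup_unif_cont p1 hT M0 hM x e20.
pose ep := Num.min 1 (d / (2 * t)).
have ep0 : 0 < ep by rewrite lt_min ltr01 divr_gt0// mulr_gt0.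
have ep1 : ep <= 1 by rewrite ge_min lexx.
have epd : ep * t <= d / 2.
  apply: (@le_trans _ _ (d / (2 * t) * t)); first by rewrite ler_pM2r// ge_min lexx orbT.
  by rewrite (_ : d / (2 * t) * t = d / 2)//; field; rewrite gt_eqF.
have b1 : cos (ep * (pi / 2)) < 1.
  have e1 : 0 < ep * (pi / 2) by rewrite mulr_gt0// divr_gt0.
  have e3 : ep * (pi / 2) <= pi / 2 by apply: ler_piMl => //; rewrite divr_ge0// ltW.
  by apply: cos_lt1; rewrite e1/=; lra.
have eB0 : 0 < e * s / (192 * t * (A + 1)) by rewrite divr_gt0 ?mulr_gt0.
have [q [q0 q3 qB]] := exists_filter_order eB0 b1.
set B := 2 / _ in qB.
have B0 : 0 <= B by rewrite divr_ge0// mulr_ge0// subr_ge0 ltW.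
pose eta := Num.min (s / 2) (Num.min (d / 2) (e * s ^+ 2 / (12 * t * (A + 1)))).
have eta0 : 0 < eta by rewrite !lt_min !divr_gt0// ?mulr_gt0// exprn_gt0.
have [|rho [hi hh]] := exists_filter_scale (t := t) _ eta0 q0; first by rewrite t0.
have [_ rho0 _ qL _] := hi; rewrite /= in rho0 qL.
have rr : 0 < rho%:R :> R by rewrite ltr0n.
pose h := mesh (t, rho, q); have h0 : 0 < h := mesh_gt0 hi.
have [h1 h2 h3] : [/\ h <= s / 2, h <= d / 2 & h <= e * s ^+ 2 / (12 * t * (A + 1))].
  by move: hh; rewrite -/h /eta !le_min => /and3P[].
have ht : h * (12 * rho%:R) = t by rewrite /h /mesh/= divfK// mulf_neq0// ?gt_eqF.
pose r := Num.truncn (s / h).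
have /andP[r1 r2] := truncn_itv (divr_ge0 (ltW s0) (ltW h0)); rewrite -/r in r1 r2.
have rhs : r%:R * h <= s by rewrite -ler_pdivlMr.
have shr : s <= r%:R * h + h.
  by move: (ltW r2); rewrite ler_pdivrMr// -natr1 mulrDl mul1r.
have [y0 k1 k2 k3] := step_ratio s0 t0 h1 rhs shr.
have r0 : (0 < r)%N by move: y0; rewrite pmulr_lgt0// ltr0n.
have rL : (r <= 12 * rho)%N.
  rewrite -(ler_nat R) natrM; rewrite -(ler_pM2r h0) [_ * h in leRHS]mulrC ht.
  exact: le_trans rhs st.
have hk : averaged_range beta tau (t, rho, q, r) by split.
exists (t, rho, q, r) => //.
pose F := T t x - T (t + s) x.
have t4 : t <= 4^-1 by apply: le_trans tt _; move: tau1; lra.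
have ti : 0 <= t < 1 by rewrite ltW//=; move: t4; lra.
have tsi : 0 <= t + s < 1 by rewrite addr_ge0 ?ltW//=; move: t4 st; lra.
have hF : rnorm F <= 2 * A by exact: rnorm_difference_le.
have hG (j : 'I_(8 * rho) * 'I_(8 * rho) * 'I_(8 * rho)) :
    weight (i := (t, rho, q)) j * rnorm (T ((level j)%:R * h) x - T ((level j + r)%:R * h) x - F) <=
    weight (i := (t, rho, q)) j * (2 * e2) + B / (8 * rho%:R) ^+ 2 * (4 * A).
  have w0 := weight_ge0 (i := (t, rho, q)) j; have jr : (level j <= 24 * rho)%N by have := level_le j; rewrite mulnA.
  (* All times that occur are at most [36 rho h = 3 t <= 3/4]. *)
  have jh (n : nat) : (n <= 36 * rho)%N -> 0 <= n%:R * h < 1.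
    rewrite -(ler_nat R) natrM => hn; rewrite mulr_ge0 ?(ltW h0)//=.
    apply: (@le_lt_trans _ _ (36 * rho%:R * h)); first by rewrite ler_pM2r.
    by rewrite (_ : _ * h = 3 * t); [move: t4; lra|rewrite -ht; ring].
  have j1 : 0 <= (level j)%:R * h < 1 by apply: jh; apply: leq_trans jr _; rewrite leq_mul2r orbT.
  have j2 : 0 <= (level j + r)%:R * h < 1 by apply: jh; rewrite -[36%N]/(24 + 12)%N mulnDl leq_add.
  have [near|far] := ltrP `|(level j)%:R - 12 * rho%:R| (ep * (12 * rho%:R)).
    have n1 : `|(level j)%:R * h - t| < d / 2.
      have -> : (level j)%:R * h - t = h * ((level j)%:R - 12 * rho%:R) by rewrite -ht; ring.
      rewrite normrM (gtr0_norm h0); apply: lt_le_trans epd.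
      by rewrite -ht mulrCA ltr_pM2l.
    have n2 : `|(level j + r)%:R * h - (t + s)| < d.
      rewrite natrD mulrDl opprD addrACA; apply: le_lt_trans (ler_normD _ _) _.
      have n3 : `|r%:R * h - s| <= d / 2.
        by rewrite ler_norml; apply/andP; split; move: rhs shr h2 d0; lra.
      by move: n1 n3; lra.
    have n3 : `|(level j)%:R * h - t| < d by move: n1 d0; lra.
    rewrite -[leLHS]addr0; apply: lerD; last first.
      by apply: mulr_ge0; [exact: divr_ge0 B0 (sqr_ge0 _)|exact: mulr_ge0].
    apply: (ler_wpM2l w0); rewrite /F.
    have -> : T ((level j)%:R * h) x - T ((level j + r)%:R * h) x -
        (T t x - T (t + s) x) = (T ((level j)%:R * h) x - T t x) -
        (T ((level j + r)%:R * h) x - T (t + s) x).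
      by rewrite !opprD !opprK addrACA.
    apply: le_trans (rnormB _ _) _; rewrite [2 * e2]mulr_natl mulr2n.
    by apply: lerD; apply: hd.
  have wB : weight (i := (t, rho, q)) j <= B / (8 * rho%:R) ^+ 2.
    rewrite /weight /= ler_pM2r ?invr_gt0 ?exprn_gt0 ?mulr_gt0//.
    by apply: fejer_far => //; rewrite ep0.
  have hGF : rnorm (T ((level j)%:R * h) x - T ((level j + r)%:R * h) x - F) <= 4 * A.
    apply: le_trans (rnormB _ _) _; rewrite (_ : 4 * A = 2 * A + 2 * A); last by ring.
    by apply: lerD => //; exact: rnorm_difference_le.
  apply: (@le_trans _ _ (B / (8 * rho%:R) ^+ 2 * (4 * A))).
    by apply: ler_pM => //; exact: rnorm_ge0.
  by rewrite lerDr; apply: mulr_ge0 => //; apply: mulr_ge0 => //; exact: ltW.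
have Bd0 : 0 <= B / (8 * rho%:R) ^+ 2 * (4 * A).
  by apply: mulr_ge0; [exact: divr_ge0 B0 (sqr_ge0 _)|exact: mulr_ge0].
have := averaged_dist hk Bd0 hG; rewrite /= -/F.
have -> : 12 * rho%:R / r%:R = t / (r%:R * h).
  by rewrite -{1}ht; field; rewrite !gt_eqF// ltr0n.
have -> : 512 * rho%:R ^+ 2 * (B / (8 * rho%:R) ^+ 2 * (4 * A)) = 32 * A * B.
  by field; rewrite gt_eqF.
move: (averaged T _ x) => Z hZ.
have -> : (t / s)%:C%C *: F - Z = - (Z - (t / (r%:R * h))%:C%C *: F) -
    (t / (r%:R * h) - t / s)%:C%C *: F.
  by rewrite rmorphB/= scalerBl !opprB [RHS]addrC addrA subrK.
apply: le_trans (rnormB _ _) _; rewrite rnormN addrC.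
apply: le_trans (error_budget t0 s0 A0 e0 qB h3); apply: lerD.
  rewrite rnormZ cabs_real ger0_norm ?subr_ge0//.
  by apply: ler_pM => //; [rewrite subr_ge0|exact: rnorm_ge0].
apply: le_trans hZ _; apply: ler_wpM2r => //.
apply: addr_ge0; first by apply: mulr_ge0 => //; exact: ltW.
by apply: mulr_ge0 => //; apply: mulr_ge0.
Qed.

Lemma rbounded_difference_quotient :
  rbounded p [set ts : R * R | 0 < ts.1 <= tau / 4 /\ 0 < ts.2 <= ts.1]
    (fun ts x => (ts.1 / ts.2)%:C%C *: (T ts.1 x - T (ts.1 + ts.2) x))
    (12 * (2 * 1 * M * filter_bound M C)).
Proof.
have h := rbounded_averaged p1 hT M0 hM tau0 tau1 C0 hB.
apply: (rbounded_lim p1 _ h) => -[t s] x e [/= ht hs] e0.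
exact: difference_quotient_approx.
Qed.

End difference_quotient.

(** * The derivative of the semigroup *)

(** Completeness of [X] enters here, both for the derivative and for the Taylor series. *)
Lemma geometric_cvg (R : realType) (X : completeNormedModType R[i]) (u : nat -> X) (A q : R) :
  0 <= A -> 0 <= q < 1 -> (forall n, rnorm (u n.+1 - u n) <= A * q ^+ n) ->
  exists y, forall n, rnorm (u n - y) <= A * q ^+ n / (1 - q).
Proof.
move=> A0 /andP[q0 q1] hu; have q1' : 0 < 1 - q by rewrite subr_gt0.
have dist n k : rnorm (u (n + k)%N - u n) <= A * q ^+ n / (1 - q).
  have K0 : 0 <= A * q ^+ n / (1 - q) by rewrite divr_ge0 ?mulr_ge0 ?exprn_ge0// ltW.
  apply: (@le_trans _ _ (A * q ^+ n / (1 - q) * (1 - q ^+ k))); last first.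
    by rewrite ler_piMr// lerBlDr lerDl exprn_ge0.
  elim: k => [|k IH]; first by rewrite addn0 subrr rnorm0 expr0 subrr mulr0.
  rewrite addnS -(subrK (u (n + k)%N) (u (n + k).+1)) -addrA; apply: le_trans (rnormD _ _) _.
  apply: le_trans (lerD (hu (n + k)%N) IH) _.
  rewrite (_ : _ + _ = A * q ^+ n / (1 - q) * (1 - q ^+ k.+1))//.
  by rewrite exprD exprS; field; rewrite gt_eqF.
have smallA e : 0 < e -> exists n, A * q ^+ n / (1 - q) < e.
  move=> e0; have A1 : 0 < A + 1 by rewrite ltr_wpDl.
  have [||n /(_ n (leqnn n)) hn] := @exists_expr_lt R q (e * (1 - q) / (A + 1)); first by rewrite q0.
    by rewrite divr_gt0// mulr_gt0.
  exists n; rewrite ltr_pdivrMr//; move: hn; rewrite ltr_pdivlMr// => hn.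
  by apply: le_lt_trans hn; rewrite mulrC ler_wpM2l ?exprn_ge0// lerDl.
have /cauchy_cvgP cu : cauchy (u @ \oo).
  apply/cauchy_exP => e e0.
  have eE : e = (complex.Re e)%:C%C by move: e0; case: e => x y; rewrite ltcE/= => /andP[/eqP -> _].
  have e0' : 0 < complex.Re e by move: e0; rewrite {1}eE ltcR.
  have [n hn] := smallA _ e0'; exists (u n).
  exists n => //= m nm; rewrite -ball_normE /= norm_rnorm eE ltcR; apply: le_lt_trans hn.
  by rewrite rnorm_distC -(subnKC nm).
exists (lim (u @ \oo)) => n; apply/ler_addgt0Pr => e e0.
have eC : 0 < e%:C%C :> R[i] by rewrite ltcR.
have /cvgrPdist_lt/(_ _ eC)[N _ hN] := cu.
have := hN (n + N)%N (leq_addl _ _); rewrite /= norm_rnorm ltcR => /ltW h.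
rewrite -(subrK (u (n + N)%N) (u n)) -addrA; apply: le_trans (rnormD _ _) _.
by apply: lerD; [rewrite rnorm_distC|rewrite rnorm_distC].
Qed.

Section increments.
Variables (R : realType) (p : R) (X : completeNormedModType R[i]) (T : R -> X -> X) (M : R).
Hypothesis p1 : 1 <= p.
Hypothesis hT : c0_semigroup T.
Hypothesis M0 : 0 <= M.
Hypothesis hM : rbounded p [set t | 0 <= t < 2] T M.
Variables (a G : R).
Hypothesis a0 : 0 < a.
Hypothesis a1 : a <= 4^-1.
Hypothesis G0 : 0 <= G.
Hypothesis hG : rbounded p [set ts : R * R | 0 < ts.1 <= a /\ 0 < ts.2 <= ts.1]
    (fun ts x => (ts.1 / ts.2)%:C%C *: (T ts.1 x - T (ts.1 + ts.2) x)) G.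

Let le_M t x : 0 <= t < 2 -> rnorm (T t x) <= M * rnorm x.
Proof. by move=> ht; exact: (rbounded_norm p1 x hM ht). Qed.

Lemma increment_base r s x : 0 < r <= a -> 0 <= s <= r ->
  rnorm (T (r + s) x - T r x) <= G / r * s * rnorm x.
Proof.
move=> /andP[r0 ra] /andP[s0 sr]; have [->|sN0] := eqVneq s 0.
  by rewrite addr0 subrr rnorm0 mulr0 mul0r.
have s0' : 0 < s by rewrite lt_neqAle eq_sym sN0.
have hi : [set ts : R * R | 0 < ts.1 <= a /\ 0 < ts.2 <= ts.1] (r, s).
  by split => /=; rewrite ?r0 ?s0'.
have := rbounded_norm p1 x hG hi; rewrite /= rnormZ cabs_real rnorm_distC.
rewrite gtr0_norm ?divr_gt0//; move: (rnorm _) (rnorm x) => N n h.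
rewrite (_ : G / r * s * n = G * n / (r / s)); last by field; rewrite !gt_eqF.
by rewrite ler_pdivlMr ?divr_gt0// mulrC.
Qed.

Lemma increment r v s x : 0 < r <= a -> r <= v <= 3 / 2 -> 0 <= s <= r ->
  rnorm (T (v + s) x - T v x) <= M * (G / r * s * rnorm x).
Proof.
move=> hr /andP[rv v1] hs; have /andP[r0 ra] := hr; have /andP[s0 sr] := hs.
have w0 : 0 <= v - r by rewrite subr_ge0.
have w2 : 0 <= v - r < 2 by rewrite w0/=; lra.
rewrite -{1 2}(subrK r v) -addrA (semigroupD hT x w0 (addr_ge0 (ltW r0) s0)).
rewrite (semigroupD hT x w0 (ltW r0)) -(linear_funB _ _ (semigroup_linear hT w0)).
apply: le_trans (le_M _ w2) _; apply: (ler_wpM2l M0).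
exact: increment_base.
Qed.

(** The second difference is the product of [T(v - r + s1) - T(v - r)] and [T(r + s2) - T(r)], so
    the bound on first differences applies twice. *)
Lemma increment2 r v s1 s2 x : 0 < r <= a -> 2 * r <= v <= 3 / 2 ->
  0 <= s1 <= r -> 0 <= s2 <= r ->
  rnorm (T (v + s1 + s2) x - T (v + s1) x - (T (v + s2) x - T v x)) <=
  M * (G / r) ^+ 2 * (s1 * s2) * rnorm x.
Proof.
move=> hr /andP[rv v1] hs1 hs2; have /andP[r0 ra] := hr; have r0' := ltW r0.
have /andP[s10 _] := hs1; have /andP[s20 _] := hs2.
have w0 : 0 <= v - r by rewrite subr_ge0; lra.
have wr : r <= v - r <= 3 / 2 by apply/andP; split; lra.
have D1 u : 0 <= u -> T (v + u + s2) x - T (v + u) x = T (v - r + u) (T (r + s2) x - T r x).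
  move=> u0; rewrite (linear_funB _ _ (semigroup_linear hT (addr_ge0 w0 u0))).
  rewrite -(semigroupD hT x (addr_ge0 w0 u0) r0').
  rewrite -(semigroupD hT x (addr_ge0 w0 u0) (addr_ge0 r0' s20)).
  by rewrite addrA; congr (T (_ + _) x - T _ x); rewrite addrAC subrK.
rewrite (D1 s1 s10); have := D1 0 (lexx 0); rewrite !addr0 => ->.
apply: le_trans (increment _ hr wr hs1) _.
have c0 : 0 <= G / r by rewrite divr_ge0.
have := increment_base x hr hs2; move: (rnorm _) (rnorm x) => N n hN.
have -> : M * (G / r) ^+ 2 * (s1 * s2) * n = M * (G / r * s1 * (G / r * s2 * n)) by ring.
by apply: (ler_wpM2l M0); apply: (ler_wpM2l _ hN); apply: mulr_ge0.
Qed.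

(** One more step changes the defect by a second difference with steps [k h] and [h]; these add up
    to at most [(k h)^2]. *)
Lemma increment_mul r v h k x : 0 < r <= a -> 2 * r <= v <= 5 / 4 -> 0 <= h -> k%:R * h <= r ->
  rnorm (T (v + k%:R * h) x - T v x - k%:R *: (T (v + h) x - T v x)) <=
  M * (G / r) ^+ 2 * (k%:R * h) ^+ 2 * rnorm x.
Proof.
move=> hr /andP[rv v1] h0; have n0 := rnorm_ge0 x.
have c0 : 0 <= M * (G / r) ^+ 2 := mulr_ge0 M0 (sqr_ge0 _).
elim: k => [|k IH] hk.
  rewrite mul0r addr0 subrr scale0r subrr rnorm0.
  by apply: (mulr_ge0 _ n0); apply: (mulr_ge0 c0); exact: sqr_ge0.
have kh : k%:R * h <= r by apply: le_trans hk; rewrite ler_wpM2r// ler_nat.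
have {hk}hr' : h <= r by apply: le_trans hk; rewrite ler_peMl// ler1n.
have kh0 : 0 <= k%:R * h by exact: mulr_ge0.
have e1 : k.+1%:R * h = k%:R * h + h by rewrite -natr1 mulrDl mul1r.
have -> : T (v + k.+1%:R * h) x - T v x - k.+1%:R *: (T (v + h) x - T v x) =
   (T (v + k%:R * h) x - T v x - k%:R *: (T (v + h) x - T v x)) +
   (T (v + k%:R * h + h) x - T (v + k%:R * h) x - (T (v + h) x - T v x)).
  rewrite e1 addrA -natr1 scalerDl scale1r.
  move: (T (v + _ + _) x) (T (v + _) x) (T (v + h) x) (T v x) (_ *: _) => b c d e f.
  by abel.
apply: le_trans (rnormD _ _) _.
have hv : 2 * r <= v <= 3 / 2 by rewrite rv/=; lra.
have hs1 : 0 <= k%:R * h <= r by rewrite kh0.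
have hs2 : 0 <= h <= r by rewrite h0.
apply: le_trans (lerD (IH kh) (increment2 x hr hv hs1 hs2)) _.
rewrite -!mulrDl; apply: (ler_wpM2r n0); rewrite -mulrDr; apply: (ler_wpM2l c0).
rewrite e1; move: kh0; move: (k%:R * h) => u u0.
by have := mulr_ge0 u0 h0; have := sqr_ge0 h; rewrite sqrrD; lra.
Qed.

(** Quotients with steps [r0 / 2^n] form a Cauchy sequence by [increment_mul] with two steps. A
    general [h] is then compared with the largest multiple of [r0 / 2^n] below it. The limit does
    not depend on [r], while the error bound holds for each admissible [r]. *)
Lemma derivative_exists t x : 0 < t <= 1 -> exists y, forall r h,
  0 < r <= a -> 2 * r <= t -> 0 <= h <= r ->
  rnorm (T (t + h) x - T t x - h%:C%C *: y) <= M * (G / r) ^+ 2 * h ^+ 2 * rnorm x.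
Proof.
move=> /andP[t0 t1]; pose r0 := Num.min a (t / 2).
have r0p : 0 < r0 by rewrite lt_min a0 divr_gt0.
have r0a : r0 <= a by rewrite ge_min lexx.
have r0t : 2 * r0 <= t.
  have : r0 <= t / 2 by rewrite ge_min lexx orbT.
  by lra.
pose K := M * (G / r0) ^+ 2 * rnorm x.
have K0 : 0 <= K := mulr_ge0 (mulr_ge0 M0 (sqr_ge0 _)) (rnorm_ge0 x).
pose e n : R := r0 * 2^-1 ^+ n.
have ep n : 0 < e n by rewrite mulr_gt0// exprn_gt0.
pose u n := (e n)^-1%:C%C *: (T (t + e n) x - T t x).
have hu n : rnorm (u n.+1 - u n) <= K * r0 * 2^-1 ^+ n.
  have en : e n = 2 * e n.+1 by rewrite /e exprS; field.
  have en2 : 2%:R * e n.+1 <= r0.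
    by rewrite -en /e ler_piMr ?(ltW r0p)// exprn_ile1// invr_le1// ?unitfE// ler1n.
  have tr : 2 * r0 <= t <= 5 / 4 by rewrite r0t/=; lra.
  have r0r : 0 < r0 <= a by rewrite r0p.
  have := increment_mul x r0r tr (ltW (ep n.+1)) en2.
  rewrite -en => h.
  have -> : u n.+1 - u n = - ((e n)^-1%:C%C *:
      (T (t + e n) x - T t x - 2%:R *: (T (t + e n.+1) x - T t x))).
    rewrite [in RHS]scalerBr opprB scalerA /u; congr (_ *: _ - _).
    rewrite -(rmorph_nat (real_complex R)) -(rmorphM (real_complex R)); congr (_%:C%C).
    by have := ep n.+1; rewrite en; move: (e n.+1) => v v0; field; rewrite gt_eqF.
  rewrite rnormN rnormZ cabs_real gtr0_norm ?invr_gt0// mulrC ler_pdivrMr//.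
  apply: le_trans h _; rewrite /K -/(e n) -[X in _ <= X * _]mulrA -/(e n).
  by rewrite expr2 le_eqVlt; apply/orP; left; apply/eqP; ring.
have half : 0 <= (2^-1 : R) < 1 by rewrite invr_ge0 ler0n/= invf_lt1// ltr1n.
have [y hy] := geometric_cvg (mulr_ge0 K0 (ltW r0p)) half hu.
exists y => r h /andP[rp ra] rt /andP[h0 hr]; apply/ler_addgt0Pr => eps eps0.
(* [e n * W] collects what vanishes with the mesh: the increment of [T] over the remainder
   [h - k e_n], the defect [u n - y], and the remainder times [y]. *)
pose W := M * (G / r * rnorm x) + 2 * h * K + rnorm y.
have x0 := rnorm_ge0 x; have y0 := rnorm_ge0 y.
have W0 : 0 <= W.
  have w1 : 0 <= M * (G / r * rnorm x) by rewrite !mulr_ge0// invr_ge0 ltW.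
  have w2 : 0 <= 2 * h * K by apply: mulr_ge0 => //; apply: mulr_ge0.
  by rewrite /W !addr_ge0.
have W1 : 0 < r0 * (W + 1) by rewrite mulr_gt0// ltr_wpDl.
have [n /(_ n (leqnn n)) hn] := exists_expr_lt half (divr_gt0 eps0 W1).
have {hn}eW : e n * W <= eps.
  move: hn; rewrite ltr_pdivlMr// => /ltW; apply: le_trans; rewrite /e mulrCA mulrA.
  by apply: ler_wpM2l; [exact: ltW (ep n)|rewrite lerDl].
pose k := Num.truncn (h / e n).
have /andP[k1 k2] := truncn_itv (divr_ge0 h0 (ltW (ep n))); rewrite -/k in k1 k2.
have {}k1 : k%:R * e n <= h by rewrite -ler_pdivlMr.
have {}k2 : h - k%:R * e n <= e n.
  by move: (ltW k2); rewrite ler_pdivrMr// -natr1 mulrDl mul1r lerBlDl.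
have k0 : 0 <= k%:R * e n by rewrite mulr_ge0// ltW.
have rr : 0 < r <= a by rewrite rp.
have tr : 2 * r <= t <= 5 / 4 by rewrite rt/=; lra.
have i1 := increment_mul x rr tr (ltW (ep n)) (le_trans k1 hr).
have hv : r <= t + k%:R * e n <= 3 / 2 by apply/andP; split; lra.
have hs : 0 <= h - k%:R * e n <= r by rewrite subr_ge0 k1/=; lra.
have i2 := increment x rr hv hs.
rewrite (_ : t + k%:R * e n + (h - k%:R * e n) = t + h) in i2; last by rewrite -addrA subrKC.
have i3 := hy n.
have -> : T (t + h) x - T t x - h%:C%C *: y =
  (T (t + k%:R * e n) x - T t x - k%:R *: (T (t + e n) x - T t x)) +
  (T (t + h) x - T (t + k%:R * e n) x) + (k%:R * e n)%:C%C *: (u n - y) -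
  (h - k%:R * e n)%:C%C *: y.
  rewrite [_ *: (u n - y)]scalerBr /u scalerA -(rmorphM (real_complex R)) mulfK ?gt_eqF//.
  rewrite (rmorph_nat (real_complex R)) rmorphB scalerBl.
  move: (T (t + h) x) (T (t + _) x) (T t x) (k%:R *: _) (_ *: y) (_ *: y) => b c d f g l.
  by abel.
apply: le_trans (rnormB _ _) _; rewrite rnormZ cabs_real ger0_norm ?subr_ge0//.
apply: le_trans (lerD (le_trans (rnormD _ _) (lerD (le_trans (rnormD _ _)
  (lerD i1 i2)) (lexx _))) (lexx _)) _.
rewrite rnormZ cabs_real (ger0_norm k0).
have c0 : 0 <= G / r by rewrite divr_ge0// ltW.
apply: (@le_trans _ _ (M * (G / r) ^+ 2 * h ^+ 2 * rnorm x + e n * W)); last by rewrite lerD2l.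
have b1 : M * (G / r) ^+ 2 * (k%:R * e n) ^+ 2 * rnorm x <= M * (G / r) ^+ 2 * h ^+ 2 * rnorm x.
  apply: (ler_wpM2r x0); apply: (ler_wpM2l (mulr_ge0 M0 (sqr_ge0 _))).
  by rewrite ler_sqr ?nnegrE.
have b2 : M * (G / r * (h - k%:R * e n) * rnorm x) <= e n * (M * (G / r * rnorm x)).
  have -> : e n * (M * (G / r * rnorm x)) = M * (G / r * e n * rnorm x) by ring.
  by apply: (ler_wpM2l M0); apply: (ler_wpM2r x0); apply: (ler_wpM2l c0).
have b3 : k%:R * e n * rnorm (u n - y) <= e n * (2 * h * K).
  have -> : e n * (2 * h * K) = h * (K * r0 * 2^-1 ^+ n / (1 - 2^-1)).
    by rewrite /e; field.
  by apply: ler_pM => //; exact: rnorm_ge0.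
have b4 : (h - k%:R * e n) * rnorm y <= e n * rnorm y by exact: ler_wpM2r.
have -> : e n * W = e n * (M * (G / r * rnorm x)) + (e n * (2 * h * K) + e n * rnorm y).
  by rewrite /W; ring.
by rewrite -!addrA; exact: lerD b1 (lerD b2 (lerD b3 b4)).
Qed.

End increments.

Section derivative.
Variables (R : realType) (p : R) (X : completeNormedModType R[i]) (T : R -> X -> X) (M : R).
Hypothesis p1 : 1 <= p.
Hypothesis hT : c0_semigroup T.
Hypothesis M0 : 0 <= M.
Hypothesis hM : rbounded p [set t | 0 <= t < 2] T M.
Variables (a G : R).
Hypothesis a0 : 0 < a.
Hypothesis a1 : a <= 4^-1.
Hypothesis G0 : 0 <= G.
Hypothesis hG : rbounded p [set ts : R * R | 0 < ts.1 <= a /\ 0 < ts.2 <= ts.1]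
    (fun ts x => (ts.1 / ts.2)%:C%C *: (T ts.1 x - T (ts.1 + ts.2) x)) G.

(** The quadratic error is what [derivative_exists] provides; it makes the value unique, and [Q] may
    depend on [x]. *)
Definition right_derivative (t : R) (x y : X) := exists Q r : R, 0 < r /\
  forall h, 0 < h < r -> rnorm (T (t + h) x - T t x - h%:C%C *: y) <= Q * h ^+ 2.

Lemma right_derivative_unique t x y y' :
  right_derivative t x y -> right_derivative t x y' -> y = y'.
Proof.
move=> [Q [r [r0 hy]]] [Q' [r' [r0' hy']]]; apply: rnorm_eq_of_close => e e0.
pose q := `|Q| + `|Q'| + 1; have q0 : 0 < q by rewrite ltr_wpDl// addr_ge0.
pose h := Num.min (Num.min (r / 2) (r' / 2)) (e / q).
have h0 : 0 < h by rewrite !lt_min !divr_gt0.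
have [hr hr' he] : [/\ h <= r / 2, h <= r' / 2 & h <= e / q].
  by split; rewrite /h !ge_min lexx ?orbT.
have h1 : 0 < h < r by rewrite h0/=; lra.
have h2 : 0 < h < r' by rewrite h0/=; lra.
have := lerD (hy' h h2) (hy h h1).
have E : h%:C%C *: (y - y') = (T (t + h) x - T t x - h%:C%C *: y') -
    (T (t + h) x - T t x - h%:C%C *: y).
  by rewrite scalerBr; move: (T _ x) (T _ x) (_ *: y) (_ *: y') => b c d f; abel.
have := rnormB (T (t + h) x - T t x - h%:C%C *: y') (T (t + h) x - T t x - h%:C%C *: y).
rewrite -E rnormZ cabs_real (gtr0_norm h0).
move=> /le_trans le1 /le1; rewrite -mulrDl expr2 mulrA [_ * h]mulrC ler_pM2l// => le2.
apply: le_trans le2 _; apply: (@le_trans _ _ (q * h)); last first.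
  by rewrite mulrC -ler_pdivlMr.
apply: (ler_wpM2r (ltW h0)); rewrite /q addrC -[leLHS]addr0; apply: lerD => //.
by apply: lerD; exact: ler_norm.
Qed.

Definition deriv (t : R) (x : X) : X := xget 0 [set y | right_derivative t x y].

Lemma deriv_eq t x y : right_derivative t x y -> deriv t x = y.
Proof.
by move=> hy; apply: (@right_derivative_unique t x) => //; exact: (xgetI 0 hy).
Qed.

Lemma derivP t x r h : 0 < t <= 1 -> 0 < r <= a -> 2 * r <= t -> 0 <= h <= r ->
  rnorm (T (t + h) x - T t x - h%:C%C *: deriv t x) <= M * (G / r) ^+ 2 * h ^+ 2 * rnorm x.
Proof.
move=> ht hr rt hh; have [y hy] := derivative_exists p1 hT M0 hM a0 G0 hG x ht.
rewrite (deriv_eq (y := y)); first exact: hy.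
exists (M * (G / r) ^+ 2 * rnorm x), r; case/andP: (hr) => r0 _; split=> // k /andP[k0 kr].
by rewrite mulrAC; apply: hy; rewrite // ?(ltW k0) ?(ltW kr).
Qed.

Lemma right_derivative_deriv t x : 0 < t <= 1 -> right_derivative t x (deriv t x).
Proof.
move=> ht; have /andP[t0 _] := ht; pose r := Num.min a (t / 2).
have r0 : 0 < r by rewrite lt_min a0 divr_gt0.
have ra : r <= a by rewrite ge_min lexx.
have rt : 2 * r <= t.
  have : r <= t / 2 by rewrite ge_min lexx orbT.
  by lra.
exists (M * (G / r) ^+ 2 * rnorm x), r; split=> // k /andP[k0 kr].
by rewrite mulrAC; apply: derivP; rewrite // ?r0 ?(ltW k0) ?(ltW kr).
Qed.

Lemma deriv_linear t : 0 < t <= 1 -> linear (deriv t).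
Proof.
move=> ht c x y; apply: deriv_eq; have /andP[t0 _] := ht.
have [Q [r [r0 hx]]] := right_derivative_deriv x ht.
have [Q' [r' [r0' hy]]] := right_derivative_deriv y ht.
exists (cabs c * Q + Q'), (Num.min r r'); split=> [|h]; first by rewrite lt_min r0.
rewrite lt_min => /and3P[h0 hr hr'].
have tl := semigroup_linear hT (ltW t0); have thl := semigroup_linear hT (addr_ge0 (ltW t0) (ltW h0)).
rewrite tl thl.
have -> : c *: T (t + h) x + T (t + h) y - (c *: T t x + T t y) -
    h%:C%C *: (c *: deriv t x + deriv t y) =
  c *: (T (t + h) x - T t x - h%:C%C *: deriv t x) + (T (t + h) y - T t y - h%:C%C *: deriv t y).
  rewrite !scalerBr scalerDr !scalerA [h%:C%C * c]mulrC.
  by move: (c *: _) (c *: _) (_ *: deriv t x) (_ *: deriv t y) (T _ y) (T _ y) => b d e f g k; abel.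
apply: le_trans (rnormD _ _) _; rewrite rnormZ mulrDl -mulrA; apply: lerD; last first.
  by apply: hy; rewrite h0.
by apply: (ler_wpM2l (cabs_ge0 _)); apply: hx; rewrite h0.
Qed.

Lemma deriv_shift t u x : 0 < t <= 1 -> 0 <= u -> deriv (t + u) x = T u (deriv t x).
Proof.
move=> ht u0; apply: deriv_eq; have [Q [r [r0 hx]]] := right_derivative_deriv x ht.
have /andP[t0 _] := ht; have ul := semigroup_linear hT u0.
have [hb _ _ _] := hT; have [_ [K hK]] := hb u u0.
exists (`|K| * Q), r; split=> // h /andP[h0 hr].
have -> : t + u + h = u + (t + h) by ring.
rewrite [t + u]addrC (semigroupD hT x u0 (addr_ge0 (ltW t0) (ltW h0))).
rewrite (semigroupD hT x u0 (ltW t0)) -(linear_funZ _ _ ul) -!(linear_funB _ _ ul).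
apply: le_trans (hK _) _; apply: (@le_trans _ _ (`|K| * rnorm (T (t + h) x - T t x - h%:C%C *: deriv t x))).
  by apply: ler_wpM2r; [exact: rnorm_ge0|exact: ler_norm].
by rewrite -mulrA; apply: ler_wpM2l => //; apply: hx; rewrite h0.
Qed.

Lemma deriv_shift' t u x : 0 < t <= 1 -> 0 <= u -> deriv (t + u) x = deriv t (T u x).
Proof.
move=> ht u0; apply: deriv_eq; have [Q [r [r0 hx]]] := right_derivative_deriv (T u x) ht.
have /andP[t0 _] := ht; exists Q, r; split=> // h /andP[h0 hr].
have -> : t + u + h = t + h + u by ring.
rewrite (semigroupD hT x (addr_ge0 (ltW t0) (ltW h0)) u0) (semigroupD hT x (ltW t0) u0).
by apply: hx; rewrite h0.
Qed.

(** The strong limit of the difference quotients as their step tends to 0; they carry the opposite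
    sign. *)
Lemma rbounded_deriv_base :
  rbounded p [set t | 0 < t <= a] (fun t x => (- t)%:C%C *: deriv t x) G.
Proof.
apply: (rbounded_lim p1 _ hG) => t x e /= /andP[t0 ta] e0.
have t1 : 0 < t <= 1 by rewrite t0 (le_trans ta)// (le_trans a1)// invf_le1// ler1n.
have [Q [r [r0 hQ]]] := right_derivative_deriv x t1.
have q0 : 0 < t * (`|Q| + 1) by rewrite mulr_gt0// ltr_wpDl.
pose s := Num.min (r / 2) (Num.min t (e / (t * (`|Q| + 1)))).
have s0 : 0 < s by rewrite !lt_min t0 !divr_gt0.
have [sr st se] : [/\ s <= r / 2, s <= t & s <= e / (t * (`|Q| + 1))].
  by split; rewrite /s !ge_min lexx ?orbT.
exists (t, s); first by split; rewrite /= ?t0 ?s0.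
rewrite /=; have -> : (- t)%:C%C *: deriv t x - (t / s)%:C%C *: (T t x - T (t + s) x) =
    (t / s)%:C%C *: (T (t + s) x - T t x - s%:C%C *: deriv t x).
  rewrite [in RHS]scalerBr scalerA -(rmorphM (real_complex R)) divfK ?gt_eqF//.
  by rewrite -[T t x - _]opprB scalerN opprK rmorphN scaleNr addrC.
rewrite rnormZ cabs_real ger0_norm; last by rewrite divr_ge0// ltW.
have hs : 0 < s < r by rewrite s0/=; lra.
apply: (@le_trans _ _ (t / s * ((`|Q| + 1) * s ^+ 2))).
  apply: ler_wpM2l; first by rewrite divr_ge0// ltW.
  apply: le_trans (hQ _ hs) _; apply: ler_wpM2r; first exact: sqr_ge0.
  by apply: le_trans (ler_norm _) _; rewrite lerDl.
have -> : t / s * ((`|Q| + 1) * s ^+ 2) = s * (t * (`|Q| + 1)) by field; rewrite gt_eqF.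
by rewrite -ler_pdivlMr.
Qed.

Definition deriv_bound := a^-1 * (M * G).

Lemma deriv_bound_ge0 : 0 <= deriv_bound.
Proof. by apply: mulr_ge0; [rewrite invr_ge0 ltW|exact: mulr_ge0]. Qed.

(** Beyond [a], [t T'(t) = (t / a) T(t - a) (a T'(a))] with [t / a <= 1 / a]. *)
Lemma rbounded_deriv :
  rbounded p [set t | 0 < t <= 1] (fun t x => t%:C%C *: deriv t x) deriv_bound.
Proof.
have mP t : 0 < t <= 1 -> [/\ 0 < Num.min t a, Num.min t a <= a, Num.min t a <= t &
    t / Num.min t a <= a^-1].
  move=> /andP[t0 t1]; have m0 : 0 < Num.min t a by rewrite lt_min t0.
  split=> //; rewrite ?ge_min ?lexx ?orbT//; rewrite ler_pdivrMr//.
  have [ta|ta] := leP t a; last by rewrite mulVf// gt_eqF.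
  have aV : 1 <= a^-1 by rewrite invf_ge1//; move: a1; lra.
  by rewrite ler_peMl// ltW.
have h1 := @rbounded_reindex R X p _ _ _ [set t | 0 < t <= 1] (fun t => Num.min t a) _ _ _ _
  (fun t x _ => erefl) rbounded_deriv_base.
have h2 := @rbounded_reindex R X p _ _ _ [set t | 0 < t <= 1] (fun t => t - Num.min t a) _ _ _ _
  (fun t x _ => erefl) hM.
have {}h1 := h1 _; have {}h2 := h2 _.
have h3 := rbounded_comp M0 (h2 _) (h1 _).
have h4 := rbounded_real p1 (a := fun t => - (t / Num.min t a)) (B := a^-1) _ _ (h3 _ _).
apply: (rbounded_reindex (g := id) _ _ (h4 _ _ _ _)) => //.
- move=> t x ht /=; have [m0 ma mt _] := mP t ht; have /andP[t0 t1] := ht.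
  have m1 : 0 < Num.min t a <= 1 by rewrite m0 (le_trans mt).
  have tm0 : 0 <= t - Num.min t a by rewrite subr_ge0.
  rewrite (linear_funZ _ _ (semigroup_linear hT tm0)) -deriv_shift// subrKC scalerA.
  rewrite -(rmorphM (real_complex R)) mulrNN divfK// gt_eqF//.
- by rewrite invr_ge0 ltW.
- move=> t ht; have [m0 _ _ ma] := mP t ht; have /andP[t0 _] := ht.
  by rewrite normrN ger0_norm// divr_ge0// ltW.
- move=> t ht /=; have [m0 _ mt _] := mP t ht; have /andP[t0 t1] := ht.
  rewrite subr_ge0 mt/=; apply: (@le_lt_trans _ _ t); first by rewrite gerBl ltW.
  by apply: le_lt_trans t1 _; rewrite ltr1n.
- by move=> t ht /=; have [m0 ma _ _] := mP t ht; rewrite m0.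
Qed.

Lemma deriv_norm t x : 0 < t <= 1 -> rnorm (deriv t x) <= deriv_bound / t * rnorm x.
Proof.
move=> ht; have /andP[t0 _] := ht; have := rbounded_norm p1 x rbounded_deriv ht.
rewrite /= rnormZ cabs_real gtr0_norm// => h.
by rewrite mulrAC ler_pdivlMr// mulrC.
Qed.

(** [T'(v) = T(v - r) T'(r)], so an increment of [T'] is an increment of [T] at the vector
    [T'(r) x]. *)
Lemma deriv_lipschitz r v h x : 0 < r <= a -> 2 * r <= v <= 1 -> 0 <= h <= r ->
  rnorm (deriv (v + h) x - deriv v x) <= M * (G / r * h * (deriv_bound / r * rnorm x)).
Proof.
move=> hr /andP[rv v1] hh; have /andP[r0 ra] := hr; have /andP[h0 hr'] := hh.
have r1 : 0 < r <= 1 by rewrite r0/=; move: a1; lra.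
have w0 : 0 <= v - r by rewrite subr_ge0; lra.
have -> : deriv (v + h) x - deriv v x = T (v - r + h) (deriv r x) - T (v - r) (deriv r x).
  rewrite -(deriv_shift x r1 (addr_ge0 w0 h0)) -(deriv_shift x r1 w0).
  by congr (deriv _ x - deriv _ x); ring.
have hv : r <= v - r <= 3 / 2 by apply/andP; split; lra.
apply: le_trans (increment p1 hT M0 hM hG _ hr hv hh) _.
apply: (ler_wpM2l M0); apply: ler_wpM2l; last exact: deriv_norm.
by apply: mulr_ge0 => //; rewrite divr_ge0// ltW.
Qed.

(** The constants are uniform in [x], as differentiability in operator norm requires. For [s < 0]
    the right derivative is taken at [t + s], and the Lipschitz bound moves it to [t]. *)
Lemma deriv_local t : 0 < t <= 1 -> exists K d, [/\ 0 <= K, 0 < d & forall s x, `|s| <= d ->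
  rnorm (T (t + s) x - T t x - s%:C%C *: deriv t x) <= K * s ^+ 2 * rnorm x /\
  rnorm (deriv (t + s) x - deriv t x) <= K * `|s| * rnorm x].
Proof.
move=> /andP[t0 t1]; pose r := Num.min a (t / 4).
have r0 : 0 < r by rewrite lt_min a0 divr_gt0.
have ra : r <= a by rewrite ge_min lexx.
have rt : 4 * r <= t.
  have : r <= t / 4 by rewrite ge_min lexx orbT.
  by lra.
have hr : 0 < r <= a by rewrite r0.
pose K1 := M * (G / r) ^+ 2; pose K2 := M * (G / r * (deriv_bound / r)).
have K10 : 0 <= K1 := mulr_ge0 M0 (sqr_ge0 _).
have K20 : 0 <= K2.
  apply: (mulr_ge0 M0); apply: mulr_ge0; apply: divr_ge0 => //; try exact: ltW.
  exact: deriv_bound_ge0.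
have lip v h x : 2 * r <= v <= 1 -> 0 <= h <= r -> rnorm (deriv (v + h) x - deriv v x) <= K2 * h * rnorm x.
  move=> hv hh; apply: le_trans (deriv_lipschitz x hr hv hh) _.
  by rewrite /K2 le_eqVlt; apply/orP; left; apply/eqP; ring.
have bound v h x : 2 * r <= v <= 1 -> 0 <= h <= r ->
    rnorm (T (v + h) x - T v x - h%:C%C *: deriv v x) <= K1 * h ^+ 2 * rnorm x.
  move=> /andP[v1 v2] hh; apply: derivP => //; rewrite v2 andbT.
  by apply: lt_le_trans v1; rewrite mulr_gt0.
exists (K1 + K2), r; split=> //; first exact: addr_ge0.
have le1 (N c n : R) : 0 <= c -> 0 <= n -> N <= K1 * c * n -> N <= (K1 + K2) * c * n.
  move=> c0 n0 h; apply: le_trans h _; apply: (ler_wpM2r n0); apply: (ler_wpM2r c0).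
  by rewrite lerDl.
have le2 (N c n : R) : 0 <= c -> 0 <= n -> N <= K2 * c * n -> N <= (K1 + K2) * c * n.
  move=> c0 n0 h; apply: le_trans h _; apply: (ler_wpM2r n0); apply: (ler_wpM2r c0).
  by rewrite lerDr.
move=> s x sr; have x0 := rnorm_ge0 x; have [s0|s0] := lerP 0 s.
  rewrite ger0_norm// in sr; have hs : 0 <= s <= r by rewrite s0.
  have hv : 2 * r <= t <= 1 by rewrite t1 andbT; lra.
  rewrite ger0_norm//; split; [apply: le1 => //; [exact: sqr_ge0|exact: bound]|].
  by apply: le2 => //; exact: lip.
have hv : 2 * r <= t + s <= 1.
  by rewrite ltr0_norm// in sr; apply/andP; split; lra.
rewrite ltr0_norm// in sr *; have hs : 0 <= - s <= r by rewrite sr oppr_ge0 ltW.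
have := bound _ _ x hv hs; have := lip _ _ x hv hs; rewrite addrK sqrrN => l b; split.
  have -> : T (t + s) x - T t x - s%:C%C *: deriv t x =
      - (T t x - T (t + s) x - (- s)%:C%C *: deriv (t + s) x) +
      (- s)%:C%C *: (deriv t x - deriv (t + s) x).
    rewrite scalerBr rmorphN !scaleNr.
    by move: (T _ x) (T t x) (_ *: deriv _ x) (_ *: deriv t x) => d e f g; abel.
  have ns : 0 <= - s by rewrite oppr_ge0 ltW.
  apply: le_trans (rnormD _ _) _; rewrite rnormN rnormZ cabs_real (ger0_norm ns).
  have -> : (K1 + K2) * s ^+ 2 * rnorm x =
      K1 * s ^+ 2 * rnorm x + (- s) * (K2 * (- s) * rnorm x) by ring.
  by apply: lerD b _; exact: ler_wpM2l.
by rewrite rnorm_distC; apply: le2 => //; rewrite oppr_ge0 ltW.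
Qed.

End derivative.

(** * The holomorphic extension *)

Section extension.
Variables (R : realType) (p : R) (X : completeNormedModType R[i]) (T D : R -> X -> X) (M C : R).
Hypothesis p1 : 1 <= p.
Hypothesis hT : c0_semigroup T.
Hypothesis M0 : 0 <= M.
Hypothesis hM : rbounded p [set t | 0 <= t < 2] T M.
Hypothesis C0 : 0 <= C.
Hypothesis D_linear : forall t, 0 < t <= 1 -> linear (D t).
Hypothesis D_shift : forall t u x, 0 < t <= 1 -> 0 <= u -> D (t + u) x = T u (D t x).
Hypothesis D_shift' : forall t u x, 0 < t <= 1 -> 0 <= u -> D (t + u) x = D t (T u x).
Hypothesis hD : rbounded p [set t | 0 < t <= 1] (fun t x => t%:C%C *: D t x) C.

Lemma iter_D_semigroup k m u x : 0 < m <= 1 -> 0 <= u ->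
  iter k (D m) (T u x) = T u (iter k (D m) x).
Proof.
by move=> hm u0; elim: k => [//|k IH]; rewrite !iterS IH -D_shift// -D_shift'.
Qed.

Lemma iter_D_shift k m d u x : 0 < m -> 0 <= d -> m + d <= 1 -> 0 <= u ->
  iter k (D (m + d)) (T u x) = iter k (D m) (T (u + k%:R * d) x).
Proof.
move=> m0 d0 md u0; have hm : 0 < m <= 1 by rewrite m0 (le_trans _ md)// lerDl.
elim: k => [|k IH]; first by rewrite mul0r addr0.
rewrite !iterS IH D_shift'// -iter_D_semigroup//.
rewrite -(semigroupD hT x d0); last by rewrite addr_ge0 ?mulr_ge0.
by congr (D m (iter k _ (T _ x))); rewrite -natr1; ring.
Qed.

(* With [D t = T'(t)], the [k]-th derivative of [T] at [t]. *)
Definition derivn (k : nat) (t : R) (x : X) : X :=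
  iter k (D (t / k.+1%:R)) (T (t / k.+1%:R) x).

Lemma derivnE k m t x : 0 < m -> t <= 1 -> m * k.+1%:R <= t ->
  derivn k t x = iter k (D m) (T (t - k%:R * m) x).
Proof.
move=> m0 t1 mt; have k0 : 0 < k.+1%:R :> R by rewrite ltr0n.
have d0 : 0 <= t / k.+1%:R - m by rewrite subr_ge0 ler_pdivlMr.
have t0 : 0 <= t by apply: le_trans mt; rewrite mulr_ge0// ltW.
have e1 : t / k.+1%:R <= 1.
  by rewrite ler_pdivrMr// mul1r; apply: le_trans t1 _; rewrite ler1n.
rewrite /derivn -{1}(subrKC m (t / k.+1%:R)) iter_D_shift ?subrKC// ?divr_ge0//.
congr (iter k _ (T _ x)); rewrite -natr1; field.
by rewrite natr1 gt_eqF.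
Qed.

Lemma derivn_prod j k s t x : 0 < s -> 0 < t -> s + t <= 1 ->
  derivn j s (derivn k t x) = derivn (j + k) (s + t) x.
Proof.
move=> s0 t0 st; have n0 : 0 < (j + k).+1%:R :> R by rewrite ltr0n.
(* Small enough for the three derivatives involved. *)
pose m := Num.min s t / (j + k).+1%:R.
have mm : 0 < Num.min s t by rewrite lt_min s0.
have m0 : 0 < m by rewrite divr_gt0.
have ms : m * (j + k).+1%:R <= s by rewrite divfK ?gt_eqF// ge_min lexx.
have mt : m * (j + k).+1%:R <= t by rewrite divfK ?gt_eqF// ge_min lexx orbT.
have mj : m * j.+1%:R <= s by apply: le_trans ms; rewrite ler_pM2l// ler_nat ltnS leq_addr.
have mk : m * k.+1%:R <= t by apply: le_trans mt; rewrite ler_pM2l// ler_nat ltnS leq_addl.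
have s1 : s <= 1 by apply: le_trans st; rewrite lerDl ltW.
have t1 : t <= 1 by apply: le_trans st; rewrite lerDr ltW.
have hm : 0 < m <= 1 by rewrite m0/= (le_trans _ s1)// (le_trans _ mj)// ler_peMr ?ler1n// ltW.
rewrite (derivnE _ m0 s1 mj) (derivnE _ m0 t1 mk) (derivnE _ m0 st); last first.
  by apply: le_trans ms _; rewrite lerDl ltW.
have js : 0 <= s - j%:R * m.
  by rewrite subr_ge0 mulrC (le_trans _ mj)// ler_pM2l// ler_nat.
have kt : 0 <= t - k%:R * m.
  by rewrite subr_ge0 mulrC (le_trans _ mk)// ler_pM2l// ler_nat.
rewrite -(iter_D_semigroup k _ hm js) -iterD -(semigroupD hT x js kt).
by congr (iter _ _ (T _ x)); rewrite natrD; ring.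
Qed.


Lemma rbounded_iter_D k :
  rbounded p [set t | 0 < t <= 1] (fun t x => (t ^+ k)%:C%C *: iter k (D t) x) (C ^+ k).
Proof.
elim: k => [|k IH].
  apply: (rbounded_reindex (g := id) _ _ (@rbounded_id R X p _ _)) => // t x _ /=.
  by rewrite expr0 scale1r.
rewrite exprS; apply: (rbounded_reindex (g := id) _ _ (rbounded_comp C0 hD IH)) => // t x ht /=.
by rewrite (linear_funZ _ _ (D_linear ht)) scalerA -(rmorphM (real_complex R)) -exprS.
Qed.

(** The derivative is [T'(u)^k T(u)] with [u = t / (k + 1)], and [t^k = (k + 1)^k u^k]. *)
Lemma rbounded_derivn k : rbounded p [set t | 0 < t <= 1]
  (fun t x => (t ^+ k)%:C%C *: derivn k t x) (k.+1%:R ^+ k * (C ^+ k * M)).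
Proof.
have k0 : 0 < k.+1%:R :> R by rewrite ltr0n.
have hk (t : R) : 0 < t <= 1 -> 0 < t / k.+1%:R <= 1.
  move=> /andP[t0 t1]; apply/andP; split; first by rewrite divr_gt0.
  by rewrite ler_pdivrMr// mul1r; apply: le_trans t1 _; rewrite ler1n.
have h1 := @rbounded_reindex R X p _ _ [set t | 0 < t <= 1] [set t | 0 < t <= 1] _ _ _ _ hk
  (fun t x _ => erefl) (rbounded_iter_D k).
have h2 : rbounded p [set t | 0 < t <= 1] (fun t => T (t / k.+1%:R)) M.
  apply: (rbounded_reindex (g := fun t => t / k.+1%:R) _ _ hM) => // t /hk /andP[u0 u1] /=.
  by rewrite ltW//=; apply: le_lt_trans u1 _; rewrite ltr1n.
have h3 := rbounded_scale p1 (k.+1%:R ^+ k) (rbounded_comp (exprn_ge0 k C0) h1 h2).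
rewrite cabsX cabs_nat in h3.
apply: (rbounded_reindex (g := id) _ _ h3) => // t x ht /=.
rewrite scalerA /derivn; congr (_ *: _).
rewrite -(rmorph_nat (real_complex R)) -(rmorphXn (real_complex R)) -(rmorphM (real_complex R)).
by congr (_%:C%C); rewrite -exprMn mulrC divfK ?gt_eqF.
Qed.

Lemma derivn_linear k t : 0 < t <= 1 -> linear (derivn k t).
Proof.
move=> /andP[t0 t1]; have k0 : 0 < k.+1%:R :> R by rewrite ltr0n.
have h : 0 < t / k.+1%:R <= 1.
  apply/andP; split; first by rewrite divr_gt0.
  by rewrite ler_pdivrMr// mul1r; apply: le_trans t1 _; rewrite ler1n.
have h0 := ltW (andP h).1; move=> c x y; rewrite /derivn (semigroup_linear hT h0).
move: (t / _) h {h0} => u hu.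
have il n : linear (iter n (D u)).
  by elim: n => [//|n IH] a v w; rewrite !iterS IH (D_linear hu).
exact: il.
Qed.

(** The term of degree [k] in the exponential series at [k + 1]. *)
Lemma factorial_bound k : k.+1%:R ^+ k / k`!%:R <= expR 1 ^+ k.+1 :> R.
Proof.
have e0 : 0 < k`!%:R :> R by rewrite ltr0n fact_gt0.
case: k e0 => [|k] e0; first by rewrite expr0 fact0 divr1 expr1; have := expR_ge1Dx (1 : R); lra.
rewrite -expRM_natl mulr1; have := @expR_ge1Dxn R k.+2%:R k (ler0n R _).
by apply: le_trans; rewrite lerDr.
Qed.

Let b : R := expR 1.
(** Chosen so that [slope * C * e <= 1/4], [e] the base of the exponential: by [factorial_bound] the
    Taylor terms on the cone then decay like [4^-k]. *)
Definition slope : R := (4 * b * (C + 1))^-1.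
Definition term_bound : R := 2 * M * b.

Lemma expR1_gt0 : 0 < b. Proof. exact: expR_gt0. Qed.

Lemma slope_gt0 : 0 < slope.
Proof. by rewrite invr_gt0 mulr_gt0 ?ltr_wpDl// mulr_gt0// expR1_gt0. Qed.

Lemma term_bound_ge0 : 0 <= term_bound.
Proof. by rewrite /term_bound mulr_ge0 ?(ltW expR1_gt0)// mulr_ge0. Qed.

Definition cone : set R[i] :=
  [set z | 0 < complex.Re z <= 1 /\ `|complex.Im z| <= slope * complex.Re z].

Definition taylor_term (z : R[i]) (k : nat) (x : X) : X :=
  (('i * (complex.Im z)%:C%C) ^+ k / k`!%:R) *: derivn k (complex.Re z) x.

Lemma cabs_term_coef (z : R[i]) k : cabs (('i * (complex.Im z)%:C%C) ^+ k / k`!%:R) =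
  `|complex.Im z| ^+ k / k`!%:R.
Proof. by rewrite cabsM cabsV cabs_nat cabsX cabsM cabs_i mul1r cabs_real. Qed.

Lemma rbounded_taylor_term k (c : R[i] -> R) B : 0 <= B -> (forall z, cone z -> `|c z| <= B) ->
  rbounded p cone (fun z x => (c z)%:C%C *: taylor_term z k x) (B * (term_bound * 4^-1 ^+ k)).
Proof.
move=> B0 hc; have e0 : 0 < k`!%:R :> R by rewrite ltr0n fact_gt0.
have sk : 0 <= slope ^+ k / k`!%:R by rewrite divr_ge0 ?exprn_ge0 ?(ltW slope_gt0)// ltW.
have h1 : rbounded p cone (fun z x => (complex.Re z ^+ k)%:C%C *: derivn k (complex.Re z) x)
    (k.+1%:R ^+ k * (C ^+ k * M)).
  by apply: (rbounded_reindex (g := fun z : R[i] => complex.Re z) _ _ (rbounded_derivn k)) => // z [].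
have h2 := rbounded_complex p1 (c := fun z => ('i * (complex.Im z)%:C%C) ^+ k / k`!%:R /
  (complex.Re z ^+ k)%:C%C) sk _ h1.
have {h2}h3 := rbounded_real p1 B0 hc (h2 _).
apply: (rbounded_weaken _ (rbounded_reindex (g := id) _ _ (h3 _))) => //.
- apply: (ler_wpM2l B0); have b0 := expR1_gt0.
  have sCb : 0 <= slope * C * b <= 4^-1.
    have s0 := ltW slope_gt0; apply/andP; split.
      by apply: mulr_ge0 (ltW b0); exact: mulr_ge0.
    have -> : slope * C * b = 4^-1 * (C / (C + 1)).
      by rewrite /slope; field; rewrite !gt_eqF// ltr_wpDl.
    by rewrite ler_piMr// ler_pdivrMr ?ltr_wpDl// mul1r lerDl.
  apply: (@le_trans _ _ (2 * M * slope ^+ k * C ^+ k * (k.+1%:R ^+ k / k`!%:R))).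
    by rewrite le_eqVlt; apply/orP; left; apply/eqP; ring.
  have c0 : 0 <= 2 * M * slope ^+ k * C ^+ k.
    apply: mulr_ge0 (exprn_ge0 k C0); apply: mulr_ge0 (exprn_ge0 k (ltW slope_gt0)).
    exact: mulr_ge0.
  apply: le_trans (ler_wpM2l c0 (factorial_bound k)) _.
  have -> : 2 * M * slope ^+ k * C ^+ k * expR 1 ^+ k.+1 = term_bound * (slope * C * b) ^+ k.
    by rewrite exprS !exprMn /term_bound -/b; ring.
  apply: (ler_wpM2l term_bound_ge0); case/andP: sCb => s1 s2.
  by apply: lerXn2r => //; rewrite nnegrE.
- move=> z x [/andP[z0 _] _]; rewrite /taylor_term; congr (_ *: _); rewrite scalerA divfK//.
  by rewrite fmorph_eq0 expf_neq0// gt_eqF.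
- move=> z [/andP[z0 _] hz]; rewrite cabsM cabs_term_coef cabsV cabs_real (ger0_norm (exprn_ge0 k (ltW z0))).
  rewrite ler_pdivrMr ?exprn_gt0//.
  rewrite mulrAC -exprMn ler_pM2r ?invr_gt0//.
  by apply: lerXn2r; rewrite ?nnegrE ?mulr_ge0 ?(ltW slope_gt0) ?(ltW z0).
Qed.

Lemma taylor_term_norm z k x : cone z ->
  rnorm (taylor_term z k x) <= term_bound * 4^-1 ^+ k * rnorm x.
Proof.
move=> hz; have h1 (w : R[i]) : cone w -> `|1 : R| <= 1 by rewrite normr1.
have := rbounded_norm p1 x (rbounded_taylor_term k ler01 h1) hz.
by rewrite /= scale1r mul1r.
Qed.

(** By homogeneity in [y] the term is compared with the one on the edge of the cone, which keeps the
    powers of [y]. *)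
Lemma taylor_term_scale t y k x : 0 < t <= 1 -> `|y| <= slope * t ->
  rnorm (taylor_term (t +i* y)%C k x) <=
  (`|y| / (slope * t)) ^+ k * (term_bound * 4^-1 ^+ k * rnorm x).
Proof.
move=> ht hy; have /andP[t0 _] := ht; have st : 0 < slope * t := mulr_gt0 slope_gt0 t0.
have hz : cone (t +i* (slope * t))%C by split=> //=; rewrite gtr0_norm.
have -> : taylor_term (t +i* y)%C k x =
    ((y / (slope * t)) ^+ k)%:C%C *: taylor_term (t +i* (slope * t))%C k x.
  rewrite /taylor_term /= scalerA; congr (_ *: _); rewrite mulrA; congr (_ / _).
  rewrite rmorphXn -exprMn; congr (_ ^+ _); rewrite mulrCA -(rmorphM (real_complex R)).
  by rewrite divfK// gt_eqF.
rewrite rnormZ cabs_real normrX normrM normfV (gtr0_norm st).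
by apply: ler_wpM2l (taylor_term_norm k x hz); rewrite exprn_ge0// divr_ge0// ltW.
Qed.

Lemma taylor_term_linear z k : cone z -> linear (taylor_term z k).
Proof.
move=> [h _] c x y; rewrite /taylor_term (derivn_linear k h) scalerDr !scalerA.
by rewrite [_ * c]mulrC.
Qed.

Definition partial_sum (z : R[i]) (n : nat) (x : X) : X := \sum_(k < n) taylor_term z k x.

Lemma sum_half n : \sum_(k < n) 2^-1 ^+ k + 2 * 2^-1 ^+ n = 2 :> R.
Proof.
elim: n => [|n IH]; first by rewrite big_ord0 expr0 add0r mulr1.
by rewrite big_ord_recr/= -addrA (_ : 2^-1 ^+ n + _ = 2 * 2^-1 ^+ n)// exprS; field.
Qed.

Lemma expr4V_le n : 4^-1 ^+ n <= 2^-1 ^+ n :> R.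
Proof. by apply: lerXn2r; rewrite ?nnegrE ?invr_ge0// lef_pV2 ?posrE// ler_nat. Qed.

Lemma sum_quarter n : \sum_(k < n) 4^-1 ^+ k <= 2 :> R.
Proof.
rewrite -[leRHS](sum_half n); apply: ler_wpDr; first by rewrite mulr_ge0// exprn_ge0// invr_ge0.
by apply: ler_sum => k _; exact: expr4V_le.
Qed.

Lemma partial_sum_norm z n x : cone z -> rnorm (partial_sum z n x) <= 2 * term_bound * rnorm x.
Proof.
move=> hz; apply: le_trans (rnorm_sum _ _ _) _.
apply: le_trans (ler_sum _ (fun (k : 'I_n) _ => taylor_term_norm k x hz)) _.
rewrite -mulr_suml -mulr_sumr [2 * _]mulrC; apply: (ler_wpM2r (rnorm_ge0 x)).
by apply: (ler_wpM2l term_bound_ge0); exact: sum_quarter.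
Qed.

Lemma partial_sum_linear z n : cone z -> linear (partial_sum z n).
Proof.
move=> hz c x y; rewrite /partial_sum scaler_sumr -big_split/=.
by apply: eq_bigr => k _; exact: taylor_term_linear.
Qed.

Definition partial_limit (z : R[i]) (x : X) := [set y : X | forall n,
  rnorm (partial_sum z n x - y) <= term_bound * rnorm x * 4^-1 ^+ n / (1 - 4^-1)].

Definition extend (z : R[i]) (x : X) : X := xget 0 (partial_limit z x).

Lemma extendP z n x : cone z ->
  rnorm (partial_sum z n x - extend z x) <= 2 * term_bound * rnorm x * 2^-1 ^+ n.
Proof.
move=> hz; have t0 := term_bound_ge0.
have [||u|y hy] := @geometric_cvg R X (fun n => partial_sum z n x) (term_bound * rnorm x) 4^-1.
- exact: mulr_ge0 t0 (rnorm_ge0 x).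
- by rewrite invr_ge0 ler0n/= invf_lt1// ltr1n.
- rewrite /partial_sum big_ord_recr/= [X in X - _]addrC addrK mulrAC.
  exact: taylor_term_norm.
have he : partial_limit z x (extend z x) := xgetI 0 (hy : partial_limit z x y).
apply: le_trans (he n) _.
have -> : (1 - 4^-1)^-1 = 4 / 3 :> R by field.
have n0 := mulr_ge0 t0 (rnorm_ge0 x).
have := expr4V_le n; have : 0 <= 2^-1 ^+ n :> R by rewrite exprn_ge0// invr_ge0.
have -> : 2 * term_bound * rnorm x * 2^-1 ^+ n = term_bound * rnorm x * (2 * 2^-1 ^+ n) by ring.
move: (term_bound * rnorm x) (4^-1 ^+ n) (2^-1 ^+ n) n0 => N u v N0 v0 uv.
by rewrite -mulrA; apply: (ler_wpM2l N0); move: v0 uv; lra.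
Qed.

Lemma le_of_geometric (a B K : R) : (forall n, a <= B + K * 2^-1 ^+ n) -> a <= B.
Proof.
move=> h; apply/ler_addgt0Pr => e e0; have K1 : 0 < `|K| + 1 by rewrite ltr_wpDl.
have half : 0 <= (2^-1 : R) < 1 by rewrite invr_ge0 ler0n/= invf_lt1// ltr1n.
have [n /(_ n (leqnn n)) hn] := exists_expr_lt half (divr_gt0 e0 K1).
apply: le_trans (h n) _; rewrite lerD2l; apply: (@le_trans _ _ ((`|K| + 1) * 2^-1 ^+ n)).
  apply: ler_wpM2r; first by rewrite exprn_ge0// invr_ge0.
  by apply: le_trans (ler_norm _) _; rewrite lerDl.
by rewrite mulrC -ler_pdivlMr// ltW.
Qed.

Lemma eq_of_geometric (x y : X) K : (forall n, rnorm (x - y) <= K * 2^-1 ^+ n) -> x = y.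
Proof.
move=> h; apply: rnorm_eq_of_close => e e0; apply: le_trans (ltW e0).
by apply: (@le_of_geometric _ _ K) => n; rewrite add0r.
Qed.

Lemma extend_linear z : cone z -> linear (extend z).
Proof.
move=> hz c x y; pose K := 2 * term_bound * rnorm (c *: x + y) +
  cabs c * (2 * term_bound * rnorm x) + 2 * term_bound * rnorm y.
apply: (@eq_of_geometric _ _ K) => n.
have -> : extend z (c *: x + y) - (c *: extend z x + extend z y) =
    - (partial_sum z n (c *: x + y) - extend z (c *: x + y)) +
    c *: (partial_sum z n x - extend z x) + (partial_sum z n y - extend z y).
  rewrite (partial_sum_linear n hz) scalerBr.
  move: (_ *: extend z x) (extend z y) (extend z _) (_ *: partial_sum z n x) (partial_sum z n y).
  by move=> u v w d e; abel.
have -> : K * 2^-1 ^+ n = 2 * term_bound * rnorm (c *: x + y) * 2^-1 ^+ n +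
    cabs c * (2 * term_bound * rnorm x * 2^-1 ^+ n) + 2 * term_bound * rnorm y * 2^-1 ^+ n.
  by rewrite /K; ring.
apply: le_trans (rnormD _ _) _; apply: lerD; last exact: extendP.
apply: le_trans (rnormD _ _) _; rewrite rnormN; apply: lerD; first exact: extendP.
by rewrite rnormZ; apply: (ler_wpM2l (cabs_ge0 c)); exact: extendP.
Qed.

Lemma extend_norm z x : cone z -> rnorm (extend z x) <= 2 * term_bound * rnorm x.
Proof.
move=> hz; have := extendP 0 x hz.
by rewrite /partial_sum big_ord0 sub0r rnormN expr0 mulr1.
Qed.

Lemma extend_real t x : 0 < t <= 1 -> extend t%:C%C x = T t x.
Proof.
move=> ht; have hz : cone t%:C%C.
  by split=> //=; rewrite normr0 mulr_ge0// ltW// ?slope_gt0//; case/andP: ht.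
symmetry; apply: (@eq_of_geometric _ _ (2 * term_bound * rnorm x)) => n.
have -> : T t x = partial_sum t%:C%C n.+1 x.
  rewrite /partial_sum big_ord_recl/= big1 ?addr0 => [|k _].
    by rewrite /taylor_term /derivn expr0 fact0 divr1 scale1r divr1.
  by rewrite /taylor_term /= mulr0 expr0n mul0r scale0r.
apply: le_trans (extendP n.+1 x hz) _.
apply: ler_wpM2l; first by apply: mulr_ge0 (rnorm_ge0 x); exact: mulr_ge0 term_bound_ge0.
by rewrite exprS ler_piMl ?exprn_ge0 ?invr_ge0// invf_le1// ler1n.
Qed.

Lemma rbounded_extend : rbounded p cone extend (2 * term_bound).
Proof.
move=> n z x hz; apply/ler_addgt0Pr => e e0.
have h1 (w : R[i]) : cone w -> `|1 : R| <= 1 by rewrite normr1.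
have hs m : rbounded p cone (fun z => partial_sum z m) (2 * term_bound).
  apply: (rbounded_weaken _ (@rbounded_sum R X p p1 _ cone m (fun k z => taylor_term z k)
    (fun k => term_bound * 4^-1 ^+ k) _)).
    by rewrite -mulr_sumr mulrC; apply: (ler_wpM2r term_bound_ge0); exact: sum_quarter.
  move=> k _; have := rbounded_taylor_term k ler01 h1; rewrite mul1r.
  by apply: (rbounded_reindex (g := id)) => // w y _; rewrite scale1r.
pose W := \sum_(k < n) 2 * term_bound * rnorm (x k).
have W0 : 0 <= W.
  by apply: sumr_ge0 => k _; apply: mulr_ge0 (rnorm_ge0 _); exact: mulr_ge0 term_bound_ge0.
have W1 : 0 < W + 1 by rewrite ltr_wpDl.
have half : 0 <= (2^-1 : R) < 1 by rewrite invr_ge0 ler0n/= invf_lt1// ltr1n.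
have [m /(_ m (leqnn m)) hm] := exists_expr_lt half (divr_gt0 e0 W1).
rewrite (_ : (fun k => _) = (fun k => partial_sum (z k) m (x k) -
  (partial_sum (z k) m (x k) - extend (z k) (x k)))); last first.
  by apply/funext => k; rewrite subKr.
apply: le_trans (rad_normB p1 _ _) _; apply: lerD; first exact: hs.
apply: le_trans (rad_norm_le_sum p1 _) _.
apply: (@le_trans _ _ (\sum_(k < n) 2 * term_bound * rnorm (x k) * 2^-1 ^+ m)).
  by apply: ler_sum => k _; exact: extendP.
rewrite -mulr_suml -/W; apply: (@le_trans _ _ ((W + 1) * 2^-1 ^+ m)).
  by apply: ler_wpM2r; [rewrite exprn_ge0// invr_ge0|rewrite lerDl].
by rewrite mulrC -ler_pdivlMr// ltW.
Qed.

Lemma triangular_sum (V : zmodType) (F : nat -> nat -> V) n :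
  \sum_(l < n) \sum_(j < l.+1) F j (l - j)%N = \sum_(j < n) \sum_(k < n - j) F j k.
Proof.
elim: n => [|n IH]; first by rewrite !big_ord0.
rewrite big_ord_recr/= IH [RHS]big_ord_recr/= subSnn big_ord1.
under [in RHS]eq_bigr => j _ do rewrite subSn ?(ltnW (ltn_ord j))// big_ord_recr/=.
by rewrite big_split/= [in LHS]big_ord_recr/= subnn addrA.
Qed.

Lemma taylor_term_mul z w k j x : cone z -> cone w -> cone (z + w) ->
  taylor_term z k (taylor_term w j x) =
  (('i * (complex.Im z)%:C%C) ^+ k / k`!%:R * (('i * (complex.Im w)%:C%C) ^+ j / j`!%:R)) *:
     derivn (j + k) (complex.Re (z + w)) x.
Proof.
case: z => a1 b1; case: w => a2 b2 [/= h1 _] [/= h2 _] [/= /andP[_ h3] _].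
have /andP[a10 _] := h1; have /andP[a20 _] := h2.
rewrite /taylor_term /= (linear_funZ _ _ (derivn_linear k h1)) scalerA.
by rewrite derivn_prod// addnC.
Qed.

(** A Cauchy product: by the binomial formula and [derivn_prod] the partial sum at [z + w] consists
    of the terms with [j + k < n]. In the others, [4^-(j+k)] is split into [2^-(j+k) <= 2^-n] and
    the summable [2^-j 2^-k]. *)
Lemma partial_sum_mul z w n x : cone z -> cone w -> cone (z + w) ->
  rnorm (partial_sum z n (partial_sum w n x) - partial_sum (z + w) n x) <=
  4 * term_bound ^+ 2 * rnorm x * 2^-1 ^+ n.
Proof.
move=> hz hw hzw; pose F j k := taylor_term z k (taylor_term w j x).
have -> : partial_sum z n (partial_sum w n x) = \sum_(j < n) \sum_(k < n) F j k.
  rewrite {1}/partial_sum exchange_big/=; apply: eq_bigr => k _.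
  by rewrite (linear_fun_sum (taylor_term_linear k hz)).
have -> : partial_sum (z + w) n x = \sum_(j < n) \sum_(k < n - j) F j k.
  rewrite -triangular_sum; apply: eq_bigr => l _.
  rewrite {1}/taylor_term.
  have -> : 'i * (complex.Im (z + w))%:C%C = 'i * (complex.Im z)%:C%C + 'i * (complex.Im w)%:C%C.
    by case: (z) (w) => a1 b1 [a2 b2]; rewrite /= rmorphD mulrDr.
  rewrite exprDn mulr_suml scaler_suml; apply: eq_bigr => j _.
  have jl : (j <= l)%N by rewrite -ltnS ltn_ord.
  rewrite /F taylor_term_mul// subnKC//; congr (_ *: _).
  have f0 m : m`!%:R != 0 :> R[i] by rewrite pnatr_eq0 -lt0n fact_gt0.
  rewrite -mulr_natr -(bin_fact jl) !natrM; field.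
  by rewrite !f0 pnatr_eq0 -lt0n bin_gt0 jl.
rewrite -sumrB; apply: le_trans (rnorm_sum _ _ _) _.
have t0 := term_bound_ge0; have x0 := rnorm_ge0 x.
have p0 m : 0 <= 2^-1 ^+ m :> R by rewrite exprn_ge0// invr_ge0.
pose c := term_bound ^+ 2 * rnorm x * 2^-1 ^+ n.
have c0 : 0 <= c := mulr_ge0 (mulr_ge0 (sqr_ge0 _) x0) (p0 n).
have half m : \sum_(k < m) 2^-1 ^+ k <= 2 :> R.
  by rewrite -[leRHS](sum_half m) lerDl mulr_ge0.
apply: (@le_trans _ _ (\sum_(j < n) (2 * c) * 2^-1 ^+ j)); last first.
  rewrite -mulr_sumr; apply: le_trans (ler_wpM2l _ (half n)) _; first exact: mulr_ge0.
  by rewrite /c le_eqVlt; apply/orP; left; apply/eqP; ring.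
apply: ler_sum => j _; rewrite (big_ord_widen n (fun k => F j k) (leq_subr j n)).
rewrite [X in X - _](bigID (fun k : 'I_n => (k < n - j)%N))/= addrAC subrr add0r.
apply: le_trans (rnorm_sum _ _ _) _.
apply: (@le_trans _ _ (\sum_(k < n | ~~ (k < n - j)%N) c * 2^-1 ^+ j * 2^-1 ^+ k)).
  apply: ler_sum => k; rewrite -leqNgt leq_subLR => jk.
  apply: le_trans (taylor_term_norm _ _ hz) _.
  have tk : 0 <= term_bound * 4^-1 ^+ k by rewrite mulr_ge0// exprn_ge0// invr_ge0.
  apply: le_trans (ler_wpM2l tk (taylor_term_norm j x hw)) _.
  have -> : 4^-1 = 2^-1 * 2^-1 :> R by field.
  rewrite !exprMn /c.
  have le1 : 2^-1 ^+ (j + k) <= 2^-1 ^+ n :> R.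
    by apply: ler_wiXn2l jk; rewrite ?invr_ge0// invf_le1// ler1n.
  have -> : term_bound * (2^-1 ^+ k * 2^-1 ^+ k) * (term_bound * (2^-1 ^+ j * 2^-1 ^+ j) * rnorm x) =
      term_bound ^+ 2 * rnorm x * 2^-1 ^+ j * 2^-1 ^+ k * 2^-1 ^+ (j + k).
    by rewrite exprD; ring.
  have -> : term_bound ^+ 2 * rnorm x * 2^-1 ^+ n * 2^-1 ^+ j * 2^-1 ^+ k =
      term_bound ^+ 2 * rnorm x * 2^-1 ^+ j * 2^-1 ^+ k * 2^-1 ^+ n by ring.
  apply: ler_wpM2l le1; apply: mulr_ge0 (p0 _); apply: mulr_ge0 (p0 _).
  by apply: mulr_ge0 x0; exact: sqr_ge0.
have cj : 0 <= c * 2^-1 ^+ j by exact: mulr_ge0.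
apply: (@le_trans _ _ (\sum_(k < n) c * 2^-1 ^+ j * 2^-1 ^+ k)).
  rewrite [leRHS](bigID (fun k : 'I_n => (k < n - j)%N))/= lerDr.
  by apply: sumr_ge0 => k _; exact: mulr_ge0.
rewrite -mulr_sumr; apply: le_trans (ler_wpM2l cj (half n)) _.
by rewrite le_eqVlt; apply/orP; left; apply/eqP; ring.
Qed.

Lemma extend_mul z w x : cone z -> cone w -> cone (z + w) ->
  extend z (extend w x) = extend (z + w) x.
Proof.
move=> hz hw hzw; pose t := term_bound; have t0 := term_bound_ge0.
apply: (@eq_of_geometric _ _ (2 * t * rnorm (extend w x) + 2 * t * (2 * t * rnorm x) +
  4 * t ^+ 2 * rnorm x + 2 * t * rnorm x)) => n.
have -> : extend z (extend w x) - extend (z + w) x =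
    - (partial_sum z n (extend w x) - extend z (extend w x)) -
    partial_sum z n (partial_sum w n x - extend w x) +
    (partial_sum z n (partial_sum w n x) - partial_sum (z + w) n x) +
    (partial_sum (z + w) n x - extend (z + w) x).
  rewrite (linear_funB _ _ (partial_sum_linear n hz)).
  move: (extend z _) (extend (z + w) x) (partial_sum z n (extend w x)).
  move: (partial_sum z n _) (partial_sum (z + w) n x) => u1 u2 u3 u4 u5.
  by abel.
have -> (k1 k2 k3 k4 v : R) : (k1 + k2 + k3 + k4) * v = k1 * v + k2 * v + k3 * v + k4 * v.
  by ring.
apply: le_trans (rnormD _ _) _; apply: lerD; last exact: extendP.
apply: le_trans (rnormD _ _) _; apply: lerD; last exact: partial_sum_mul.
apply: le_trans (rnormB _ _) _; rewrite rnormN; apply: lerD; first exact: extendP.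
apply: le_trans (partial_sum_norm n _ hz) _.
have := extendP n x hw; rewrite -/t; move: (rnorm _) (rnorm x) => N m hN.
have -> : 2 * t * (2 * t * m) * 2^-1 ^+ n = 2 * t * (2 * t * m * 2^-1 ^+ n) by ring.
by apply: ler_wpM2l hN; apply: mulr_ge0.
Qed.

Hypothesis D_local : forall t, 0 < t <= 1 -> exists K d, [/\ 0 <= K, 0 < d & forall s x, `|s| <= d ->
  rnorm (T (t + s) x - T t x - s%:C%C *: D t x) <= K * s ^+ 2 * rnorm x /\
  rnorm (D (t + s) x - D t x) <= K * `|s| * rnorm x].

Lemma taylor_tail t y n x : 0 < t <= 1 -> `|y| <= slope * t ->
  rnorm (partial_sum (t +i* y)%C n.+2 x - partial_sum (t +i* y)%C 2 x) <=
  (`|y| / (slope * t)) ^+ 2 * (2 * term_bound * rnorm x).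
Proof.
move=> ht hy; have /andP[t0 _] := ht; have st : 0 < slope * t := mulr_gt0 slope_gt0 t0.
set l := `|y| / (slope * t); have l0 : 0 <= l by rewrite divr_ge0// ltW.
have l1 : l <= 1 by rewrite ler_pdivrMr// mul1r.
rewrite /partial_sum -(addn2 n) addnC big_split_ord/= [X in X - _]addrC addrK.
apply: le_trans (rnorm_sum _ _ _) _.
have tx := mulr_ge0 term_bound_ge0 (rnorm_ge0 x).
apply: (@le_trans _ _ (\sum_(k < n) l ^+ 2 * (term_bound * rnorm x) * 4^-1 ^+ k)); last first.
  rewrite -mulr_sumr; apply: le_trans (ler_wpM2l _ (sum_quarter n)) _.
    by apply: mulr_ge0 tx; exact: sqr_ge0.
  by rewrite le_eqVlt; apply/orP; left; apply/eqP; ring.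
apply: ler_sum => k _; apply: le_trans (taylor_term_scale _ x ht hy) _; rewrite -/l.
have q0 : 0 <= 4^-1 ^+ k :> R by rewrite exprn_ge0// invr_ge0.
have -> : l ^+ (2 + k) * (term_bound * 4^-1 ^+ (2 + k) * rnorm x) =
    l ^+ 2 * (term_bound * rnorm x) * 4^-1 ^+ k * (l ^+ k * 4^-1 ^+ 2) by rewrite !exprD; ring.
rewrite ler_piMr//; first by apply: mulr_ge0 q0; apply: mulr_ge0 tx; exact: sqr_ge0.
apply: mulr_ile1; rewrite ?exprn_ge0 ?exprn_ile1 ?invr_ge0// invf_le1// ler1n//.
Qed.

Lemma partial_sum2 t y x : 0 < t <= 1 ->
  partial_sum (t +i* y)%C 2 x = T t x + ('i * y%:C%C) *: D t x.
Proof.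
move=> /andP[t0 t1]; rewrite /partial_sum !big_ord_recr big_ord0/= add0r /taylor_term /derivn /=.
rewrite expr0 fact0 divr1 scale1r divr1 expr1 divr1; congr (_ + _ *: _).
have h : 0 < t / 2 <= 1 by rewrite divr_gt0//=; lra.
have h0 : 0 <= t / 2 by case/andP: h => /ltW.
by rewrite -(D_shift' x h h0) -splitr.
Qed.

(** With [w = t + s + iy], the series at [t + s] is cut after its linear term, with a tail quadratic
    in [y]; then [T] and [T'] are moved from [t + s] to [t] by [D_local]. The quadratic error is
    uniform in [x], hence valid in operator norm. *)
Lemma extend_local t : 0 < t < 1 -> exists K d, [/\ 0 <= K, 0 < d & forall w : R[i],
  cabs (w - t%:C%C) <= d -> cone w /\ forall x,
    rnorm (extend w x - T t x - (w - t%:C%C) *: D t x) <= K * cabs (w - t%:C%C) ^+ 2 * rnorm x].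
Proof.
move=> /andP[t0 t1]; have [|K [d [K0 d0 hK]]] := @D_local t; first by rewrite t0 ltW.
have s0 := slope_gt0; have b0 := term_bound_ge0.
have st : 0 < slope * (t / 2) by rewrite mulr_gt0// divr_gt0.
pose L := 2 * term_bound / (slope * (t / 2)) ^+ 2.
have L0 : 0 <= L by apply: divr_ge0 (sqr_ge0 _); exact: mulr_ge0.
exists (2 * K + L), (Num.min (Num.min d (t / 2)) (Num.min (1 - t) (slope * (t / 2)))); split.
- by apply: addr_ge0 L0; exact: mulr_ge0.
- by rewrite !lt_min d0 st subr_gt0 t1 divr_gt0.
move=> w; rewrite !le_min => /andP[/andP[wd wt] /andP[w1 ws]].
have hr := Re_le_cabs (w - t%:C%C); have hi := Im_le_cabs (w - t%:C%C).
have [s [y wE]] : exists s y, w = ((t + s) +i* y)%C.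
  by exists (complex.Re w - t), (complex.Im w); rewrite subrKC; case: (w).
have dE : w - t%:C%C = (s +i* y)%C by rewrite wE; apply/eqP; rewrite eq_complex/= subr0 addrAC subrr add0r !eqxx.
rewrite dE in hr hi wd wt w1 ws *; rewrite /= in hr hi.
set c := cabs (s +i* y)%C in hr hi wd wt w1 ws *; have c0 : 0 <= c := cabs_ge0 _.
have s2 : `|s| <= t / 2 := le_trans hr wt; have s3 : `|s| <= 1 - t := le_trans hr w1.
have ht : 0 < t + s <= 1.
  have := ler_norm s; have := ler_norm (- s); rewrite normrN; move: s2 s3 t0; lra.
have tt : t / 2 <= t + s by have := ler_norm (- s); rewrite normrN; move: s2; lra.
have hy : `|y| <= slope * (t + s).
  by apply: le_trans hi _; apply: le_trans ws _; rewrite ler_pM2l.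
have hw : cone w by rewrite wE; split.
split=> // x; have x0 := rnorm_ge0 x; have [k1 k2] := hK s x (le_trans hr wd).
have tail : rnorm (extend w x - (T (t + s) x + ('i * y%:C%C) *: D (t + s) x)) <= L * c ^+ 2 * rnorm x.
  rewrite -partial_sum2// -wE; apply: (@le_of_geometric _ _ (2 * term_bound * rnorm x)) => n.
  have -> : extend w x - partial_sum w 2 x = (partial_sum w n.+2 x - partial_sum w 2 x) -
     (partial_sum w n.+2 x - extend w x).
    by move: (extend w x) (partial_sum w 2 x) (partial_sum w n.+2 x) => u1 u2 u3; abel.
  apply: le_trans (rnormB _ _) _; apply: lerD; last first.
    apply: le_trans (extendP _ _ hw) _; apply: ler_wpM2l; first by apply: mulr_ge0 x0; exact: mulr_ge0.
    by apply: ler_wiXn2l; rewrite ?invr_ge0// ?invf_le1// ?ler1n// ltnW.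
  rewrite wE; apply: le_trans (taylor_tail n x ht hy) _.
  have -> : L * c ^+ 2 * rnorm x = (c / (slope * (t / 2))) ^+ 2 * (2 * term_bound * rnorm x).
    by rewrite /L; field; rewrite !gt_eqF.
  apply: ler_wpM2r; first by apply: mulr_ge0 x0; exact: mulr_ge0.
  have s1 : 0 < slope * (t + s) by case/andP: ht => ? _; exact: mulr_gt0.
  have l0 : 0 <= `|y| / (slope * (t + s)) by apply: divr_ge0 => //; exact: ltW.
  apply: lerXn2r; rewrite ?nnegrE//; first by apply: divr_ge0 c0 _; exact: ltW.
  apply: ler_pM => //; first by rewrite invr_ge0 ltW.
  by rewrite lef_pV2// ler_pM2l.
have -> : extend w x - T t x - (s +i* y)%C *: D t x =
   (extend w x - (T (t + s) x + ('i * y%:C%C) *: D (t + s) x)) +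
   (T (t + s) x - T t x - s%:C%C *: D t x) + ('i * y%:C%C) *: (D (t + s) x - D t x).
  have -> : (s +i* y)%C = s%:C%C + 'i * y%:C%C.
    by apply/eqP; rewrite eq_complex /= !(mul0r, mul1r, add0r, addr0, subr0, mulr0)/= !eqxx.
  rewrite scalerDl scalerBr.
  move: (extend w x) (T t x) (T (t + s) x) (_ *: D (t + s) x) => u1 u2 u3 u4.
  move: (s%:C%C *: D t x) => u5.
  move: (_ *: D t x) => u6.
  by abel.
have c2 : `|s| * `|s| <= c ^+ 2 by rewrite expr2; apply: ler_pM.
have c3 : `|y| * `|s| <= c ^+ 2 by rewrite expr2; apply: ler_pM.
apply: le_trans (rnormD _ _) _.
have -> : (2 * K + L) * c ^+ 2 * rnorm x =
  L * c ^+ 2 * rnorm x + K * c ^+ 2 * rnorm x + K * c ^+ 2 * rnorm x by ring.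
apply: lerD.
  apply: le_trans (rnormD _ _) _; apply: lerD tail _; apply: le_trans k1 _.
  apply: (ler_wpM2r x0); apply: (ler_wpM2l K0).
  by rewrite -real_normK ?num_real// expr2.
rewrite rnormZ cabsM cabs_i mul1r cabs_real; apply: le_trans (ler_wpM2l (normr_ge0 y) k2) _.
have -> : `|y| * (K * `|s| * rnorm x) = K * (`|y| * `|s|) * rnorm x by ring.
by apply: (ler_wpM2r x0); apply: (ler_wpM2l K0).
Qed.

(** Unlike [cone], it is stable under addition. *)
Definition open_cone : set R[i] :=
  [set z | 0 < complex.Re z /\ `|complex.Im z| <= slope * complex.Re z].

Lemma cone_scale (z : R[i]) (c : R) : open_cone z -> 0 < c -> complex.Re z * c <= 1 ->
  cone (z * c%:C%C).
Proof.
case: z => a1 b1 [/= a0 hb] c0 ac; split; rewrite /= ?(mulr0, subr0, add0r, addr0).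
  by rewrite mulr_gt0.
by rewrite normrM (gtr0_norm c0) mulrA ler_pM2r.
Qed.

Lemma iter_extend k z x : cone z -> complex.Re z * k.+1%:R <= 1 ->
  iter k.+1 (extend z) x = extend (z * k.+1%:R) x.
Proof.
move=> hz; have [/andP[z0 _] hi] := hz; have oz : open_cone z by [].
elim: k => [|k IH] hk; first by rewrite mulr1.
have hk' : complex.Re z * k.+1%:R <= 1.
  by apply: le_trans hk; rewrite ler_pM2l// ler_nat.
have n0 n : 0 < n.+1%:R :> R by rewrite ltr0n.
have cs n : complex.Re z * n.+1%:R <= 1 -> cone (z * n.+1%:R).
  by move=> h; rewrite -(rmorph_nat (real_complex R)); exact: cone_scale.
have e : z + z * k.+1%:R = z * k.+2%:R by rewrite -[k.+2%:R]natr1 mulrDr mulr1 addrC.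
by rewrite iterS IH// extend_mul ?e//; exact: cs.
Qed.

Lemma iter_eq (f g : X -> X) n x : (forall y, f y = g y) -> iter n f x = iter n g x.
Proof. by move=> fg; elim: n => [//|n IH]; rewrite !iterS IH fg. Qed.

Lemma iter_comp_comm (f g : X -> X) n x : (forall y, f (g y) = g (f y)) ->
  iter n f (iter n g x) = iter n (fun y => f (g y)) x.
Proof.
move=> fg; elim: n => [//|n IH]; rewrite [RHS]iterS -IH [in LHS]iterS iterS; congr (f _).
by elim: n {IH} (iter n g x) => [//|n IH] y; rewrite !iterS IH fg.
Qed.

Definition power (n : nat) (z : R[i]) : X -> X := iter n (extend (z / n%:R)).

Lemma cone_div z n : open_cone z -> complex.Re z <= n.+1%:R -> cone (z / n.+1%:R).
Proof.
move=> hz zn; rewrite -(rmorph_nat (real_complex R)) -(fmorphV (real_complex R)).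
by apply: cone_scale => //; rewrite ?invr_gt0 ?ltr0n// ler_pdivrMr ?ltr0n// mul1r.
Qed.

(** Both sides equal the power with exponent [(n + 1) (m + 1)]. *)
Lemma power_indep n m z x : open_cone z -> complex.Re z <= n.+1%:R -> complex.Re z <= m.+1%:R ->
  power n.+1 z x = power m.+1 z x.
Proof.
have key k l y : open_cone y -> complex.Re y <= k.+1%:R ->
    power k.+1 y x = iter (k.+1 * l.+1) (extend (y / (k.+1 * l.+1)%:R)) x.
  move=> hy yk; have nz j : j.+1%:R != 0 :> R[i] by rewrite pnatr_eq0.
  have kl : (k.+1 * l.+1)%N = (k.+1 * l.+1).-1.+1 by rewrite prednK// muln_gt0.
  have ykl : complex.Re y <= (k.+1 * l.+1).-1.+1%:R.
    by rewrite -kl; apply: le_trans yk _; rewrite ler_nat leq_pmulr.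
  have c1 := cone_div hy yk; have := cone_div hy ykl; rewrite -kl => c2.
  rewrite iterM; apply: iter_eq => v; rewrite iter_extend//.
    by congr (extend _ v); rewrite natrM invfM mulrA divfK.
  case: c1; rewrite -(rmorph_nat (real_complex R)) -(fmorphV (real_complex R)).
  rewrite -(rmorph_nat (real_complex R)) -(fmorphV (real_complex R)).
  case: (y) => u v' /=; rewrite !(mulr0, subr0) natrM => /andP[_ h] _.
  by rewrite invfM mulrA divfK// pnatr_eq0.
by move=> hz zn zm; rewrite (key _ m)// (key m n)// mulnC.
Qed.

(* [extend] is defined for real parts at most [1]; beyond, [S(z) = S(z/n)^n]. *)
Definition extension (z : R[i]) : X -> X := power (Num.truncn (complex.Re z)).+1 z.

Lemma extensionE n z x : open_cone z -> complex.Re z <= n.+1%:R ->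
  extension z x = power n.+1 z x.
Proof. by move=> hz zn; apply: power_indep => //; apply: ltW; exact: truncnS_gt. Qed.

Lemma extension_cone z x : cone z -> extension z x = extend z x.
Proof.
by move=> [/andP[z0 z1] hi]; rewrite (@extensionE 0)//= /power /= divr1.
Qed.

Lemma extension_mul z w x : open_cone z -> open_cone w ->
  extension z (extension w x) = extension (z + w) x.
Proof.
move=> hz hw; have hzw : open_cone (z + w).
  case: z w hz hw => a1 b1 [a2 b2] [/= h1 h2] [/= h3 h4]; split=> /=; first exact: addr_gt0.
  by apply: le_trans (ler_normD _ _) _; rewrite mulrDr; exact: lerD.
pose n := Num.truncn (complex.Re (z + w)).
have sn : complex.Re (z + w) <= n.+1%:R by apply: ltW; exact: truncnS_gt.
have rE : complex.Re (z + w) = complex.Re z + complex.Re w by case: (z) (w) => ? ? [].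
have zn : complex.Re z <= n.+1%:R by apply: le_trans sn; rewrite rE lerDl ltW//; case: hw.
have wn : complex.Re w <= n.+1%:R by apply: le_trans sn; rewrite rE lerDr ltW//; case: hz.
have c1 := cone_div hz zn; have c2 := cone_div hw wn; have c3 := cone_div hzw sn.
rewrite (extensionE _ hz zn) (extensionE _ hw wn) (extensionE _ hzw sn) /power.
have e : z / n.+1%:R + w / n.+1%:R = (z + w) / n.+1%:R by rewrite mulrDl.
have c4 : cone (z / n.+1%:R + w / n.+1%:R) by rewrite e.
have c5 : cone (w / n.+1%:R + z / n.+1%:R) by rewrite addrC.
rewrite iter_comp_comm => [|y]; last first.
  by rewrite (extend_mul _ c1 c2 c4) (extend_mul _ c2 c1 c5) addrC.
by apply: iter_eq => y; rewrite (extend_mul _ c1 c2 c4) e.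
Qed.

Lemma extension_real t x : 0 < t -> extension t%:C%C x = T t x.
Proof.
move=> t0; set n := Num.truncn t; have tn : t <= n.+1%:R by apply: ltW; exact: truncnS_gt.
have n0 : 0 < n.+1%:R :> R by rewrite ltr0n.
have h : 0 < t / n.+1%:R <= 1 by rewrite divr_gt0//= ler_pdivrMr// mul1r.
rewrite /extension /power -/n -(rmorph_nat (real_complex R)) -(fmorphV (real_complex R)).
rewrite -(rmorphM (real_complex R)) (iter_eq _ _ (fun y => extend_real y h)).
have h0 : 0 <= t / n.+1%:R by case/andP: h => /ltW.
rewrite (semigroup_iter hT n.+1 x h0); congr (T _ x).
by rewrite mulrC divfK// gt_eqF.
Qed.

Lemma extension_bounded z : open_cone z -> bounded_operator (extension z).
Proof.
move=> hz; have zn : complex.Re z <= (Num.truncn (complex.Re z)).+1%:R.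
  by apply: ltW; exact: truncnS_gt.
have hc := cone_div hz zn; rewrite /extension /power; move: (_ / _) hc => w hw.
elim: (_.+1) => [|n [IHl [K hK]]]; first by split=> //; exists 1 => x; rewrite mul1r.
have K0 : 0 <= 2 * term_bound by exact: mulr_ge0 term_bound_ge0.
split=> [c x y|]; first by rewrite !iterS IHl (extend_linear hw).
exists (2 * term_bound * K) => x; rewrite iterS; apply: le_trans (extend_norm _ hw) _.
by rewrite -(mulrA (2 * term_bound)); exact: ler_wpM2l.
Qed.

(** For a small real [e], [S(w) = S(z - e) S(e + w - z)], so differentiability at [z] follows from
    the expansion at the real point [e]. The slope is halved so that [z - e] remains in the cone. *)
Lemma extension_differentiable z : 0 < complex.Re z ->
  `|complex.Im z| <= slope / 2 * complex.Re z ->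
  exists2 S' : X -> X, bounded_operator S' &
    operator_norm (fun x => (w - z)^-1 *: (extension w x - extension z x) - S' x)
      @[w --> (z : R[i]^o)^'] --> (0 : R).
Proof.
move=> z0 hz; have s0 := slope_gt0.
pose e := Num.min (1 / 2) (complex.Re z / 4).
have e0 : 0 < e by rewrite lt_min !divr_gt0.
have e1 : e <= 1 / 2 by rewrite ge_min lexx.
have ez : e <= complex.Re z / 4 by rewrite ge_min lexx orbT.
have he : 0 < e < 1 by rewrite e0/=; lra.
have he1 : 0 < e <= 1 by rewrite e0/=; lra.
have [K [d [K0 d0 hd]]] := extend_local he.
have oz : open_cone (z - e%:C%C).
  case: (z) z0 hz ez => a1 b1 /= a10 hb ea; split=> /=; first lra.
  rewrite subr0; apply: le_trans hb _; rewrite -mulrA ler_pM2l//; lra.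
have [hl _] := extension_bounded oz; have [B B0 hB] := bounded_operator_ge0 (extension_bounded oz).
have ce : cone e%:C%C.
  by split=> //=; rewrite normr0; apply: mulr_ge0; exact: ltW.
have oc w : cone w -> open_cone w by case=> /andP[].
have zE x : extension z x = extension (z - e%:C%C) (T e x).
  by rewrite -(extension_real x e0) extension_mul ?subrK//; exact: oc.
exists (fun x => extension (z - e%:C%C) (D e x)).
  split=> [c x y|]; first by rewrite (D_linear he1) hl.
  have [C1 C10 h1] : exists2 C1, 0 <= C1 & forall x, rnorm (D e x) <= C1 * rnorm x.
    exists (e^-1 * C) => [|x]; first by apply: mulr_ge0 => //; rewrite invr_ge0 ltW.
    have := rbounded_norm p1 x hD he1; rewrite /= rnormZ cabs_real gtr0_norm// => h.
    by rewrite -mulrA ler_pdivlMl.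
  exists (B * C1) => x; apply: le_trans (hB _) _.
  by rewrite -mulrA; apply: ler_wpM2l.
have key w : w != z -> cabs (w - z) <= d -> forall x,
    rnorm ((w - z)^-1 *: (extension w x - extension z x) - extension (z - e%:C%C) (D e x)) <=
    B * (K * cabs (w - z)) * rnorm x.
  move=> wz wd x; have wz0 : w - z != 0 by rewrite subr_eq0.
  have eq1 : e%:C%C + (w - z) - e%:C%C = w - z by rewrite addrC addKr.
  have := hd (e%:C%C + (w - z)); rewrite eq1 => /(_ wd)[hc hx].
  have eq2 : z - e%:C%C + (e%:C%C + (w - z)) = w by rewrite addrA subrK subrKC.
  have -> : extension w x = extension (z - e%:C%C) (extend (e%:C%C + (w - z)) x).
    by rewrite -extension_cone// extension_mul ?eq2//; exact: oc.
  rewrite zE -(linear_funB _ _ hl) -(linear_funZ _ _ hl) -(linear_funB _ _ hl).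
  apply: le_trans (hB _) _; rewrite -mulrA; apply: (ler_wpM2l B0).
  have -> : (w - z)^-1 *: (extend (e%:C%C + (w - z)) x - T e x) - D e x =
    (w - z)^-1 *: (extend (e%:C%C + (w - z)) x - T e x - (w - z) *: D e x).
    by rewrite [RHS]scalerBr scalerA mulVf// scale1r.
  have c0 : 0 < cabs (w - z) by rewrite lt_neqAle cabs_ge0 andbT eq_sym cabs_eq0.
  rewrite rnormZ cabsV ler_pdivrMl//; apply: le_trans (hx x) _.
  by rewrite le_eqVlt; apply/orP; left; apply/eqP; ring.
apply/cvgrPdist_le => q q0; apply/near_punctured.
have BK : 0 < B * K + 1 by rewrite ltr_wpDl// mulr_ge0.
exists (Num.min d (q / (B * K + 1))); first by rewrite lt_min d0 divr_gt0.
move=> w wz; rewrite lt_min => /andP[wd wq].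
have cw := cabs_ge0 (w - z).
have N0 : 0 <= B * (K * cabs (w - z)) by rewrite !mulr_ge0.
have /andP[on0 on1] := operator_norm_le (key w wz (ltW wd)) N0.
rewrite sub0r normrN ger0_norm//; apply: le_trans on1 _.
move: wq; rewrite ltr_pdivlMr// => /ltW; apply: le_trans.
by rewrite mulrA mulrC; apply: ler_wpM2l => //; rewrite lerDl.
Qed.

(** For angles below [1/2] the cosine is at least [1/2], and [|sin th| <= |th| <= k / 2]. *)
Lemma sector_subcone (k : R) : 0 < k -> exists2 delta, 0 < delta & forall z : R[i],
  sector delta z -> 0 < complex.Re z /\ `|complex.Im z| <= k * complex.Re z.
Proof.
move=> k0; exists (Num.min (1 / 2) (k / 2)); first by rewrite lt_min !divr_gt0.
move=> z [z0 [th [_ zE]]]; rewrite lt_min => /andP[h1 h2].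
have r0 : 0 < cabs z by rewrite lt_neqAle cabs_ge0 andbT eq_sym cabs_eq0.
have cs : 1 / 2 <= cos th.
  have := Re_le_cabs (expi th - 1); rewrite /= => /le_trans/(_ (cabs_expi_sub1_le _)).
  by have := ler_norm (1 - cos th); rewrite distrC; move: h1; lra.
have sn := sin_norm_le th.
have hre : complex.Re z = cabs z * cos th by rewrite zE normc_cabs/= mul0r subr0 -zE.
have him : complex.Im z = cabs z * sin th by rewrite zE normc_cabs/= mul0r addr0 -zE.
rewrite hre him; move: (cabs _) r0 => r r0; split; first by rewrite mulr_gt0//; move: cs; lra.
rewrite normrM (gtr0_norm r0) mulrCA ler_pM2l//; apply: le_trans sn _; apply: le_trans (ltW h2) _.
by rewrite ler_pM2l//; move: cs; lra.
Qed.

Lemma extension_analytic : R_analytic p T.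
Proof.
have s0 := slope_gt0; have s2 : 0 < slope / 2 by rewrite divr_gt0.
have [theta th0 hth] := sector_subcone s2.
have oc z : sector theta z -> open_cone z.
  move=> /hth[z0 hz]; split=> //; apply: le_trans hz _; rewrite ler_pM2r//; lra.
exists theta, extension; split=> //.
- move=> z hz; split; first by apply: extension_bounded; exact: oc.
  by have [z0 hi] := hth z hz; exact: extension_differentiable.
- by move=> t t0; apply/funext => x; exact: extension_real.
exists theta; first by rewrite th0 lexx.
have b0 : 0 <= 2 * term_bound by exact: mulr_ge0 term_bound_ge0.
have hR : rbounded p (sector theta `&` [set z : R[i] | `|z| <= 1]) extension (2 * term_bound).
  have hc (z : R[i]) : sector theta z /\ `|z| <= 1 -> cone z.
    move=> [hz]; rewrite normc_cabs -[1]/(1%:C%C) lecR => z1; have [z0 hi] := oc z hz.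
    split=> //; rewrite z0/=; apply: le_trans z1; apply: le_trans (Re_le_cabs z).
    exact: ler_norm.
  by apply: (rbounded_reindex (g := id) _ _ rbounded_extend) => // z x /hc /extension_cone.
apply: (@le_lt_trans _ _ (2 * term_bound)%:E); last exact: ltry.
exact: (rbound_le b0 hR).
Qed.

End extension.

(** * From the hypothesis on [f] to R-analyticity *)

Lemma sufficiency (R : realType) (p : R) (X : completeNormedModType R[i]) (T : R -> X -> X)
    (f : {poly R[i]}) : 1 <= p -> c0_semigroup T ->
  (rbound p [set T t | t in [set t : R | (0 < t < 1)%R]] < +oo)%E ->
  (lim (rbound p [set operator_poly f (T t) |
                    t in [set t : R | (0 < t < e)%R]] @[e --> 0^'+]) < (disk_norm f)%:E)%E ->
  R_analytic p T.
Proof.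
move=> p1 hT /rbound_lt[M [M0 _] hM] /lim_rbound_lt[e [c [e0 /andP[c0 cf] hc]]].
have [zeta [t1 [t2 [hz ht1 ht2 [e1 e2]]]]] := circle_point c0 cf.
have hcz : 0 <= c < cabs f.[expi zeta] by rewrite c0.
have [eta [tau [C [eta0 tau0 tau1 C0 hP]]]] := rbounded_below_point p1 hT M0 hM hcz e0 hc.
have hB := rbounded_below_unit p1 hT M0 hM eta0 tau1 C0 ht1 ht2 e1 e2 hP.
have beta0 : 0 < Num.min eta (Num.min t1 t2).
  by rewrite !lt_min eta0; case/andP: ht1 => -> _; case/andP: ht2 => -> _.
have pi0 : 0 <= pi *+ 2 :> R by rewrite mulrn_wge0// pi_ge0.
have C'0 : 0 <= C * (2 * 1 * M * (pi *+ 2)).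
  by apply: (mulr_ge0 C0); apply: (mulr_ge0 _ pi0); apply: (mulr_ge0 _ M0); rewrite mulr1.
have hG := rbounded_difference_quotient p1 hT M0 hM beta0 tau0 tau1 C'0 hB.
set G := 12 * _ in hG; have G0 : 0 <= G.
  apply: mulr_ge0 => //; apply: mulr_ge0 (filter_bound_ge0 M0 C'0).
  by apply: (mulr_ge0 _ M0); rewrite mulr1.
have a0 : 0 < tau / 4 by rewrite divr_gt0.
have a1 : tau / 4 <= 4^-1 by rewrite ler_piMl// invr_ge0.
have hS := rbounded_semigroup p1 hT hM.
have half (t : R) : 0 <= t < 2 -> 0 <= t / 2 < 1.
  by move=> /andP[t0 t1']; rewrite divr_ge0//= ltr_pdivrMr// mul1r.
(* [T(t) = T(t / 2)^2] doubles the range of times, since the estimates of increments and derivatives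
   run past time 1. *)
have hM2 : rbounded p [set t | 0 <= t < 2] T (M * M).
  have hS2 : rbounded p [set t | 0 <= t < 2] (fun t => T (t / 2)) M.
    by apply: (rbounded_reindex (g := fun t => t / 2) _ _ hS).
  apply: (rbounded_reindex (g := id) _ _ (rbounded_comp M0 hS2 hS2)) => // t x /half/andP[t0 _].
  by rewrite -(semigroupD hT x t0 t0) -splitr.
have MM0 := mulr_ge0 M0 M0.
exact: (extension_analytic p1 hT MM0 hM2 (deriv_bound_ge0 MM0 a0 G0)
  (deriv_linear p1 hT MM0 hM2 a0 G0 hG)
  (fun t u x => deriv_shift p1 hT MM0 hM2 a0 G0 hG x)
  (fun t u x => deriv_shift' p1 hT MM0 hM2 a0 G0 hG x)
  (rbounded_deriv p1 hT MM0 hM2 a0 a1 G0 hG)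
  (deriv_local p1 hT MM0 hM2 a0 a1 G0 hG)).
Qed.

Theorem theorem5p4 (R : realType) (p : R) (X : completeNormedModType R[i])
    (T : R -> X -> X) (hp : 1 <= p) (hT : c0_semigroup T) :
  ((rbound p [set T t | t in [set t : R | (0 < t < 1)%R]] < +oo)%E ->
   (exists f : {poly R[i]},
      (lim (rbound p [set operator_poly f (T t) |
                        t in [set t : R | (0 < t < e)%R]] @[e --> 0^'+])
       < (disk_norm f)%:E)%E) ->
   R_analytic p T)
  /\
  (R_analytic p T ->
   forall f : {poly R[i]}, complex.Re `|f.[1]| < disk_norm f ->
   exists N0 : nat, forall N : nat, (N0 <= N)%N ->
   exists2 K0 : R, 0 <= K0 & forall K : R, K0 <= K ->
     (lim (rbound p [set operator_poly (f ^+ N) (T t) \o T (K * t)%R |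
                       t in [set t : R | (0 < t < e)%R]] @[e --> 0^'+])
      < (disk_norm (f ^+ N))%:E)%E).
Proof.
split=> [hM [f hf]|hA f hf]; first exact: (sufficiency hp hT hM hf).
exact: (necessity hp hT hA hf).
Qed.
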